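(* Write $z=(x,y)\in\mathbb{R}^2\times\mathbb{R}=\mathbb{R}^3$. Let $0<\gamma<2$ and let $\phi$ be a measurable function of $|x|$ such that $(1+|x|)^\gamma\phi\in L^\infty(\mathbb{R}^3)$. Let $2(3-\gamma)<q<6$. If $u\in\mathcal{D}^{1,2}(\mathbb{R}^3)$, $u>0$, is a weak solution of $-\Delta u=\phi(|x|)\,u^{q-1}$ in $\mathbb{R}^3$, then $u$ has finite mass: $\int_{\mathbb{R}^3}|\phi(|x|)|\,u^{q-1}\,dz<\infty$.
   Context: $\mathcal{D}^{1,2}(\mathbb{R}^3)$ is the closure of $C_c^\infty(\mathbb{R}^3)$ with respect to $\|\nabla u\|_{L^2}$. Note $2(3-\gamma)=2^*(\gamma)=\frac{2(n-\gamma)}{n-2}$ with $n=3$. *)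

(* Defs.v *)
From HB Require Import structures.
From mathcomp Require Import all_boot all_order all_algebra.
From mathcomp Require Import all_classical all_reals all_analysis.
Set Implicit Arguments. Unset Strict Implicit. Unset Printing Implicit Defensive.
Import Order.TTheory GRing.Theory Num.Theory.
Import numFieldNormedType.Exports.
Local Open Scope classical_set_scope.
Local Open Scope ring_scope.

Definition R3 (R : realType) : Type := ((R * R) * R)%type.

Notation leb3 R :=
  ((@lebesgue_measure R \x @lebesgue_measure R) \x @lebesgue_measure R)%E.

Definition norm2 (R : realType) (x : R * R) : R := Num.sqrt (x.1 ^+ 2 + x.2 ^+ 2).

Definition evec (R : realType) (i : 'I_3) : R * R * R :=
  if val i == 0%N then ((1, 0), 0)
  else if val i == 1%N then ((0, 1), 0) else ((0, 0), 1).

Definition partial (R : realType) (i : 'I_3) (f : R * R * R -> R) : R * R * R -> R :=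
  fun z => 'D_(evec R i) f z.

Fixpoint iter_partial (R : realType) (l : seq 'I_3) (f : R * R * R -> R) : R * R * R -> R :=
  match l with
  | [::] => f
  | i :: l' => partial i (iter_partial l' f)
  end.

(* C^infinity: every iterated partial derivative exists and is (Frechet)
   differentiable everywhere (hence all of them are continuous). *)
Definition smooth3 (R : realType) (f : R * R * R -> R) : Prop :=
  forall (l : seq 'I_3) (z : R * R * R), differentiable (iter_partial l f) z.

Definition compact_support3 (R : realType) (f : R * R * R -> R) : Prop :=
  exists M : R, forall z : R * R * R, M < `|z| -> f z = 0.

Definition test_fun3 (R : realType) (f : R * R * R -> R) : Prop :=
  smooth3 f /\ compact_support3 f.

Definition weak_gradient (R : realType) (u : R * R * R -> R) (g : 'I_3 -> R * R * R -> R) : Prop :=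
  (forall i, measurable_fun setT (g i)) /\
  forall (psi : R * R * R -> R), test_fun3 psi -> forall i : 'I_3,
    (leb3 R).-integrable setT (fun z => (u z * partial i psi z)%:E) /\
    (leb3 R).-integrable setT (fun z => (g i z * psi z)%:E) /\
    (\int[leb3 R]_z (u z * partial i psi z)%:E
       = - \int[leb3 R]_z (g i z * psi z)%:E)%E.

Definition grad_dist2 (R : realType) (f : R * R * R -> R) (g : 'I_3 -> R * R * R -> R)
  (z : R * R * R) : R :=
  \sum_(i < 3) (partial i f z - g i z) ^+ 2.

(* D^{1,2}(R^3), realized concretely as a space of functions: u is in
   L^{2^*}(R^3) = L^6(R^3), it has a weak gradient g in L^2(R^3)^3, and g is
   the L^2-limit of the gradients of a sequence of C_c^infinity functions
   (i.e. u lies in the closure of C_c^infinity for the norm ||grad .||_2). *)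
Definition D12 (R : realType) (u : R * R * R -> R) (g : 'I_3 -> R * R * R -> R) : Prop :=
  measurable_fun setT u /\
  (\int[leb3 R]_z (`|u z| ^+ 6)%:E < +oo)%E /\
  weak_gradient u g /\
  (forall i, (\int[leb3 R]_z (g i z ^+ 2)%:E < +oo)%E) /\
  exists psi : nat -> (R * R * R -> R),
    (forall n, test_fun3 (psi n)) /\
    ((fun n => \int[leb3 R]_z (grad_dist2 (psi n) g z)%:E)%E : nat -> \bar R) @ \oo
      --> (0 : \bar R).

Definition weak_solution (R : realType) (phi : R -> R) (q : R)
  (u : R * R * R -> R) (g : 'I_3 -> R * R * R -> R) : Prop :=
  forall psi : R * R * R -> R, test_fun3 psi ->
    (\int[leb3 R]_z (\sum_(i < 3) g i z * partial i psi z)%:E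
     = \int[leb3 R]_z (phi (norm2 z.1) * (u z `^ (q - 1)) * psi z)%:E)%E.

(* Main.v *)
Require Import Defs.
From HB Require Import structures.
From mathcomp Require Import all_boot all_order all_algebra.
From mathcomp Require Import all_classical all_reals all_analysis.
From mathcomp Require Import measurable_realfun ring lra.
Set Implicit Arguments.
Unset Strict Implicit.
Unset Printing Implicit Defensive.
Import Order.TTheory GRing.Theory Num.Theory.
Import numFieldNormedType.Exports.
Local Open Scope classical_set_scope.
Local Open Scope ring_scope.

(** Put [p = 3 - gamma], [rho = 1 + |x|^2] and [w = rho^(-gamma/2)], so that
    [|phi| <= C w].  Integrating by parts the fields [x_i rho^(-s) |f|^t] upgrades
    Sobolev's inequality, by iteration in the weight exponent, to the Hardy-Sobolev
    inequality [int w |f|^(2p) <= C (int |grad f|^2)^p].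

    For [e > 0] let [H(s) = s^3 (e + s^2)^nu] and [G(s) = H(s)^2 / s].  Testing the
    equation with [G(u)] bounds the Dirichlet energy of [H(u)] by
    [K Y], where [Y = int w u^(q-2) H(u)^2].  As [q > 2p], on [{u < d}] one has
    [u^(q-2) H^2 <= u^(2p-2) H^2], which by Young and the Hardy-Sobolev inequality
    for [H(u)] is absorbed in the left-hand side once [d] is small, while on
    [{u >= d}] the integrand is at most [C_d u^6].  Hence [Y] is bounded
    independently of [e], and [e -> 0] gives [int w u^(2p-1) < oo] for
    [nu = ((p-1)/p - 5)/4].  Since [2p - 1 < q - 1 < 6], the mass is controlled by
    [w u^(2p-1)] where [u < 1] and by [u^6] where [u >= 1].

    Only smooth functions may be tested, so the argument runs along test functions
    [psi_k] with gradients converging to [g]: they converge in [L^6] by Sobolev's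
    inequality, and the limit is [u] because a function of [L^6] with a vanishing
    weak partial derivative is null. *)

(** The regularisation makes the absorption legitimate: for [e > 0] the integrand of [Y] is at most
    [C_e u^6], so [Y] is known to be finite before a multiple of it is moved to the left. The
    obstacle is homogeneity. The Hardy-Sobolev inequality has degree [p > 1] in the energy, so it
    bounds [int w H(u)^(2p)] only by a superlinear function of [Y]. Dividing [H^2] by [N = K Y + 1]
    inside Young's inequality turns this bound into a small multiple of [N]. The other Young term
    carries [w u^(2p)] on [{u < d}], which is small because [int w u^(2p)] is finite. Young's
    parameter is fixed before [d], and both before [e]; this is where uniformity in [e] comes from.
    The sign of [5 + 4 nu] decides whether [G'] controls [H'^2]. At [e = 0] one has
    [H^(2p) = u^((6 + 4 nu) p)], and [5 + 4 nu = (p - 1)/p] gives the power [2p - 1]. In the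
    Hardy-Sobolev inequality one integration by parts passes from the weight [2 gam - 2] to [gam],
    halving the distance to 2; weights between the values so reached follow by pointwise
    interpolation. *)

Local Notation meas f := (measurable_fun setT f).

(** * Integrals of nonnegative real-valued functions *)

Section ge0_integral_real.
Context d (T : measurableType d) (R : realType) (mu : {measure set T -> \bar R}).
Implicit Types (f g : T -> R).
Local Open Scope ereal_scope.

Lemma ge0_le_integralr f g : meas f -> meas g ->
  (forall z, 0 <= f z)%R -> (forall z, f z <= g z)%R ->
  \int[mu]_z (f z)%:E <= \int[mu]_z (g z)%:E.
Proof.
move=> mf mg f0 fg; apply: ge0_le_integral.
- exact: measurableT.
- by move=> z _; rewrite lee_fin.
- exact/measurable_EFinP.
- exact/measurable_EFinP.
- by move=> z _; rewrite lee_fin.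
Qed.

Lemma ge0_integralrZ f c : meas f -> (0 <= c)%R ->
  (forall z, 0 <= f z)%R ->
  \int[mu]_z (c * f z)%:E = c%:E * \int[mu]_z (f z)%:E.
Proof.
move=> mf c0 f0; under eq_integral do rewrite EFinM.
apply: ge0_integralZl.
- exact: measurableT.
- exact/measurable_EFinP.
- by move=> z _; rewrite lee_fin.
- by rewrite lee_fin.
Qed.

Lemma ge0_integralrD f g : meas f -> meas g ->
  (forall z, 0 <= f z)%R -> (forall z, 0 <= g z)%R ->
  \int[mu]_z (f z + g z)%:E = \int[mu]_z (f z)%:E + \int[mu]_z (g z)%:E.
Proof.
move=> mf mg f0 g0; under eq_integral do rewrite EFinD.
apply: ge0_integralD.
- exact: measurableT.
- by move=> z _; rewrite lee_fin.
- exact/measurable_EFinP.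
- by move=> z _; rewrite lee_fin.
- exact/measurable_EFinP.
Qed.

Lemma le_integrable_real f g : meas f -> meas g ->
  (forall z, `|f z| <= g z)%R -> \int[mu]_z (g z)%:E < +oo ->
  mu.-integrable setT (EFin \o f).
Proof.
move=> mf mg fg goo; apply/integrableP; split; first exact/measurable_EFinP.
apply: le_lt_trans goo; apply: (@ge0_le_integralr (fun z => `|f z|%R) g) => //.
exact: measurableT_comp (@normr_measurable R setT) mf.
Qed.

End ge0_integral_real.

(** * Joint measurability *)

Ltac mfun := repeat first
  [ assumption
  | exact: measurable_cst
  | apply: measurable_funD
  | apply: measurable_funM
  | apply: measurable_funN
  | apply: measurable_funX
  | apply: (measurableT_comp (@normr_measurable _ setT))
  | apply: (measurableT_comp (@measurable_powR _ _)) ].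

(** Rounding the last variable down to the grid of step [1/(n+1)] gives functions whose preimages
    are countable unions of measurable rectangles; continuity in that variable makes them converge
    pointwise to [f]. *)
Lemma measurable_fun_prod_continuous d (T : measurableType d) (R : realType)
    (f : T * R -> R) :
  (forall t, continuous (fun r => f (t, r))) ->
  (forall r, meas (fun t => f (t, r))) ->
  meas f.
Proof.
move=> cf mf.
pose p n (r : R) : R := (Num.floor (r * n.+1%:R))%:~R / n.+1%:R.
have pcvg r : p ^~ r @ \oo --> r.
  apply/cvgrPdist_lt => e e0.
  have := @near_infty_natSinv_lt R (PosNum e0).
  apply: filterS => n /= ne.
  have n0 : (0 : R) < n.+1%:R by rewrite ltr0n.
  have -> : r - p n r = (r * n.+1%:R - (Num.floor (r * n.+1%:R))%:~R) / n.+1%:R.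
    by rewrite /p mulrBl mulfK // gt_eqF.
  rewrite normrM (ger0_norm (x := n.+1%:R^-1)) ?invr_ge0 ?ltW//.
  apply: le_lt_trans ne; rewrite ler_piMl ?invr_ge0 ?ltW//.
  have := floor_le_tmp (r * n.+1%:R).
  have := floorD1_gt (r * n.+1%:R).
  rewrite intrD1 => h1 h2.
  by rewrite ger0_norm; lra.
apply: (@measurable_fun_cvg _ _ _ _ (fun n tr => f (tr.1, p n tr.2))); last first.
  move=> [t r] _ /=; exact: (cvg_comp _ _ (pcvg r) (cf t r)).
move=> n _ Y mY; rewrite setTI.
have -> : (fun tr : T * R => f (tr.1, p n tr.2)) @^-1` Y =
  \bigcup_(k in [set: int]) ((fun t => f (t, k%:~R / n.+1%:R)) @^-1` Y `*`
    [set r : R | Num.floor (r * n.+1%:R) = k]).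
  apply/seteqP; split=> [[t r]/= h|[t r] /= [k _ [/= h hk]]]; last by rewrite /p hk.
  by exists (Num.floor (r * n.+1%:R)).
apply: countable_bigcupT_measurable => [|k]; first exact: countableP.
apply: measurableX.
  by rewrite -[X in measurable X]setTI; exact: mf.
rewrite (_ : [set r : R | _] = `[k%:~R / n.+1%:R, (k + 1)%:~R / n.+1%:R[%classic); first exact: measurable_itv.
have n0 : (0 : R) < n.+1%:R by rewrite ltr0n.
apply/seteqP; split=> r /=; rewrite in_itv /= ler_pdivrMr // ltr_pdivlMr //.
  by move=> <-; rewrite floor_le_tmp floorD1_gt.
by move=> h; apply: floor_def.
Qed.

Lemma continuous_pairr (S T : topologicalType) (t : T) :
  continuous (fun r : S => (t, r)).
Proof. by move=> r; apply: (cvg_pair (cvg_cst t) cvg_id). Qed.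

Lemma continuous_pairl (S T : topologicalType) (t : T) :
  continuous (fun r : S => (r, t)).
Proof. by move=> r; apply: (cvg_pair cvg_id (cvg_cst t)). Qed.

(** * Cauchy-Schwarz inequality and partial integrals *)

Section cauchy_schwarz.
Context d (T : measurableType d) (R : realType) (mu : {measure set T -> \bar R}).

Lemma cauchy_schwarz (f g : T -> R) (a b : R) :
  meas f -> meas g ->
  (forall z, 0 <= f z) -> (forall z, 0 <= g z) -> 0 <= a -> 0 <= b ->
  (\int[mu]_z (f z ^+ 2)%:E <= a%:E)%E -> (\int[mu]_z (g z ^+ 2)%:E <= b%:E)%E ->
  (\int[mu]_z (f z * g z)%:E <= (Num.sqrt a * Num.sqrt b)%:E)%E.
Proof.
move=> mf mg f0 g0 a0 b0 fa gb.
have N2 (h : T -> R) c : 0 <= c -> (forall z, 0 <= h z) ->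
    (\int[mu]_z (h z ^+ 2)%:E <= c%:E)%E -> ('N[mu]_2%:E[EFin \o h] <= (Num.sqrt c)%:E)%E.
  move=> c0 h0 hc.
  have : ('N[mu]_2%:E[EFin \o h] `^ 2 <= c%:E)%E.
    rewrite powR_Lnorm //; apply: le_trans hc; rewrite le_eqVlt; apply/orP; left; apply/eqP.
    by apply: eq_integral => z _ /=; rewrite ger0_norm // powR_mulrn.
  have := Lnorm_ge0 mu 2%:E (EFin \o h).
  case: ('N[mu]_2%:E[EFin \o h])%E => [r| |//].
    rewrite poweR_EFin !lee_fin => r0; rewrite powR_mulrn // => rc.
    by rewrite -(ger0_norm r0) -sqrtr_sqr ler_wsqrtr.
  by rewrite poweRyr ?leye_eq // ; lra.
have := @hoelder _ _ _ mu f g 2 2 mf mg ltac:(by []) ltac:(by []) ltac:(by lra).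
rewrite Lnorm1 => H.
apply: (le_trans (y := (\int[mu]_x `|((f \* g)%R x)%:E|)%E)).
  rewrite le_eqVlt; apply/orP; left; apply/eqP.
  by apply: eq_integral => z _ /=; rewrite ger0_norm // mulr_ge0.
apply: (le_trans H); rewrite EFinM; apply: lee_pmul; rewrite ?Lnorm_ge0 //; exact: N2.
Qed.

End cauchy_schwarz.

Section pint.
Context d (T : measurableType d) (R : realType).
Local Notation lam := (@lebesgue_measure R).
Implicit Types h : T * R -> R.

(** Real-valued, so that square roots of marginals can be taken. An infinite inner integral is sent
    to 0 by [fine], hence the finiteness hypothesis of [pintE]. *)
Definition pint h (t : T) : R := fine (\int[lam]_r (h (t, r))%:E)%E.

Lemma pint_ge0 h t : (forall z, 0 <= h z) -> 0 <= pint h t.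
Proof. by move=> h0; apply: fine_ge0; apply: integral_ge0 => r _; rewrite lee_fin. Qed.

Lemma pintE h t : (forall z, 0 <= h z) -> (\int[lam]_r (h (t, r))%:E < +oo)%E ->
  ((pint h t)%:E = \int[lam]_r (h (t, r))%:E)%E.
Proof.
by move=> h0 hoo; rewrite fineK // ge0_fin_numE //; apply: integral_ge0 => r _; rewrite lee_fin.
Qed.

Lemma measurable_pint h : meas h -> (forall z, 0 <= h z) ->
  meas (pint h).
Proof.
move=> mh h0; apply: (measurableT_comp (fine_measurable measurableT)) => //.
apply: (@measurable_fun_fubini_tonelli_F _ _ T _ R lam (EFin \o h)).
  exact/measurable_EFinP.
by move=> z /=; rewrite lee_fin.
Qed.

End pint.

Ltac mpair := repeat first
  [ exact: measurable_id | exact: measurable_fst | exact: measurable_snd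
  | exact: (measurableT_comp measurable_fst measurable_fst)
  | exact: (measurableT_comp measurable_snd measurable_fst)
  | apply: measurable_fun_pair ].

(* The library registers product measures as sigma-finite only for
   subprobabilities, hence this alias. *)
Definition leb2 (R : realType) : set (measurableTypeR R * measurableTypeR R) -> \bar R :=
  (@lebesgue_measure R \x @lebesgue_measure R)%E.

HB.instance Definition _ (R : realType) := Measure.on (@leb2 R).

Lemma leb2_sigma_finite (R : realType) : sigma_finite setT (@leb2 R).
Proof.
exists (fun n => `[- n%:R, n%:R]%classic `*` `[- n%:R, n%:R]%classic).
  rewrite predeqE => -[x y]; split => // _.
  exists (Num.trunc (`|x| + `|y|)).+1 => //=.
  have h : `|x| + `|y| < (Num.trunc (`|x| + `|y|)).+1%:R by exact: truncnS_gt.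
  split; rewrite /= in_itv /= -ler_norml ltW // (le_lt_trans _ h) //.
    by rewrite lerDl.
  by rewrite lerDr.
move=> k; split; first exact: measurableX.
have -> : (leb2 (`[(- k%:R)%R, k%:R] `*` `[(- k%:R)%R, k%:R]) =
    @lebesgue_measure R `[(- k%:R)%R, k%:R] * @lebesgue_measure R `[(- k%:R)%R, k%:R])%E.
  exact: product_measure1E.
have fin : (@lebesgue_measure R `[(- k%:R)%R, k%:R] \is a fin_num)%E.
  rewrite ge0_fin_numE // lebesgue_measure_itv /=; case: ifP => // _.
  by rewrite -EFinD ltry.
by rewrite -ge0_fin_numE ?mule_ge0 // fin_numM.
Qed.

HB.instance Definition _ (R : realType) :=
  Measure_isSigmaFinite.Build _ _ _ (@leb2 R) (@leb2_sigma_finite R).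

(** * Vanishing of integrals on a generated sigma-algebra *)

Section dynkin.
Context d (T : measurableType d) (R : realType) (mu : {measure set T -> \bar R}).
Context d' (T' : measurableType d').

(** The sets [A] with vanishing integral form a Dynkin system: complements by the hypothesis on [S],
    countable disjoint unions by integrability of [f]. Taking a coordinate for [F] and a product
    with one full factor for [S] allows the factors of a product set to be treated one at a time. *)
Lemma dynkin_integral0 (G : set (set T')) (F : T -> T') (S : set T) (f : T -> \bar R) :
  @measurable _ T' = <<s G >> -> setI_closed G ->
  meas F -> measurable S -> mu.-integrable setT f ->
  (\int[mu]_(z in S) f z = 0)%E ->
  (forall A, G A -> \int[mu]_(z in S `&` F @^-1` A) f z = 0)%E ->
  (forall A, measurable A -> \int[mu]_(z in S `&` F @^-1` A) f z = 0)%E.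
Proof.
move=> GE GI mF mS fi f0 fG A; rewrite GE.
have mFA B : measurable B -> measurable (S `&` F @^-1` B).
  by move=> mB; apply: measurableI => //; rewrite -[X in measurable X]setTI; exact: mF.
apply: (dynkin_induction (P := fun A => (\int[mu]_(z in S `&` F @^-1` A) f z = 0)%E)) => //.
- by rewrite preimage_setT setIT.
- move=> B mB PB.
  have := f0; rewrite -{1}(setIT S) -(preimage_setT F) -(setUv B) preimage_setU setIUr.
  rewrite integral_setU //.
  + by rewrite PB add0e.
  + exact: mFA.
  + by apply: mFA; exact: measurableC.
  + by apply: measurable_funS (measurable_int _ fi).
  + apply/disj_setPS; rewrite preimage_setC => z [[_ h1] [_ h2]]; exact: h2.
- move=> H mH tH PH; rewrite preimage_bigcup setI_bigcupr integral_bigcup.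
  + by apply: eseries0 => n _ _; exact: PH.
  + apply/trivIsetP => i j _ _ ij; move/trivIsetP : tH => /(_ i j I I ij) h.
    rewrite setIACA setIid -preimage_setI h preimage_set0 setI0 //.
  + by move=> k; exact: mFA.
  + by apply: integrableS fi => //; apply: bigcup_measurable => k _; exact: mFA.
Qed.

End dynkin.

(** * Cubes, coordinate lines and compactly supported functions *)

Section space.
Variable R : realType.
Local Notation T3 := (R * R * R)%type.
Local Notation mu3 := (leb3 R).
Local Notation lam := (@lebesgue_measure R).
Local Notation "'\I_' z F" := (integral mu3 setT (fun z : T3 => F%:E))
  (at level 36, z name, F at level 36).
Implicit Types (f g : T3 -> R).

(** The criterion for functions continuous in the last variable is applied to the third coordinate,
    then to the second, leaving a continuous function on the line. *)
Lemma continuous_measurable3 f : continuous f -> meas f.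
Proof.
move=> cf; apply: measurable_fun_prod_continuous => [t r|z].
  exact: (@continuous_comp R (R * R * R)%type R (fun s => (t, s)) f r
    (@continuous_pairr _ _ t r) (cf (t, r))).
apply: measurable_fun_prod_continuous => [x r|y].
  apply: (@continuous_comp R (R * R * R)%type R (fun s => ((x, s), z)) f r); last exact: cf.
  apply: (@continuous_comp R (R * R)%type (R * R * R)%type (fun s => (x, s)) (fun s => (s, z)) r).
    exact: continuous_pairr.
  exact: continuous_pairl.
apply: continuous_measurable_fun => x.
apply: (@continuous_comp R (R * R * R)%type R (fun s => ((s, y), z)) f x); last exact: cf.
apply: (@continuous_comp R (R * R)%type (R * R * R)%type (fun s => (s, y)) (fun s => (s, z)) x).
  exact: continuous_pairl.
exact: continuous_pairl.
Qed.

Definition cube (M : R) : set T3 := (`[- M, M] `*` `[- M, M]) `*` `[- M, M].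

Lemma cubeP M (z : T3) : cube M z <-> `|z| <= M.
Proof.
case: z => [[x y] z]; rewrite /cube /= !prod_normE /= !ge_max !in_itv /= -!ler_norml.
split; first by move=> [[-> ->] ->].
by move=> /andP[/andP[-> ->] ->].
Qed.

Lemma measurable_cube M : measurable (cube M).
Proof. by apply: measurableX => //; exact: measurableX. Qed.

Lemma cube_lty M : (mu3 (cube M) < +oo)%E.
Proof.
have oo : (@lebesgue_measure R `[(- M)%R, M] < +oo)%E.
  by rewrite lebesgue_measure_itv /=; case: ifP => // _; rewrite -EFinD ltry.
have h2 : ((@lebesgue_measure R \x @lebesgue_measure R) (`[(- M)%R, M] `*` `[(- M)%R, M]) =
    @lebesgue_measure R `[(- M)%R, M] * @lebesgue_measure R `[(- M)%R, M])%E.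
  exact: product_measure1E.
have h3 : (mu3 (cube M) = (@lebesgue_measure R `[(- M)%R, M] *
    @lebesgue_measure R `[(- M)%R, M]) * @lebesgue_measure R `[(- M)%R, M])%E.
  rewrite -h2; apply: product_measure1E => //; exact: measurableX.
have fin : (@lebesgue_measure R `[(- M)%R, M] \is a fin_num)%E by rewrite ge0_fin_numE.
by rewrite h3 -ge0_fin_numE ?mule_ge0 // !fin_numM.
Qed.

Lemma compact_cube M : compact (cube M).
Proof. by do 2?apply: compact_setX; exact: segment_compact. Qed.

Lemma compact_support3P f :
  compact_support3 f -> exists2 M : R, 0 < M & forall z : T3, M < `|z| -> f z = 0.
Proof.
move=> [M h]; exists (`|M| + 1); first by rewrite ltr_wpDl.
move=> z hz; apply: h; apply: le_lt_trans hz.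
by rewrite (le_trans (ler_norm _)) // lerDl.
Qed.

Lemma bounded_compact_support3 f : continuous f -> compact_support3 f ->
  exists2 C : R, 0 < C & forall z, `|f z| <= C.
Proof.
move=> cf /compact_support3P[M M0 hM].
have /compact_bounded [C [_ hC]] : compact (f @` cube M).
  apply: continuous_compact; last exact: compact_cube.
  exact: continuous_subspaceT.
exists (`|C| + 1); first by rewrite ltr_wpDl.
move=> z; have [/hM ->|zM] := ltP M `|z|; first by rewrite normr0 addr_ge0.
apply: (hC (`|C| + 1)); first by rewrite (le_lt_trans (ler_norm _)) // ltrDl.
by exists z => //; apply/cubeP.
Qed.

Lemma integrable_compact_support3 f : continuous f -> compact_support3 f ->
  mu3.-integrable setT (EFin \o f).
Proof.
move=> cf sf; have [M M0 hM] := compact_support3P sf.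
have [C C0 hC] := bounded_compact_support3 cf sf.
have m1 : meas (\1_(cube M) : T3 -> R).
  exact: measurable_indic (measurable_cube M).
have mf : meas f by exact: continuous_measurable3.
apply: (@le_integrable_real _ _ R mu3 f (fun z => C * \1_(cube M) z) mf).
- by mfun.
- move=> z /=; rewrite indicE.
  have [zM|zM] := leP `|z| M; first by rewrite mem_set ?mulr1 //; exact/cubeP.
  by rewrite hM // normr0 mulr_ge0 // ltW.
rewrite ge0_integralrZ //; last exact: ltW.
rewrite integral_indic ?setIT//; last exact: measurable_cube.
by rewrite lte_mul_pinfty ?lee_fin ?ltW // cube_lty.
Qed.

(** The [i]-th coordinate of [z] is overwritten rather than translated, so the parameter is the
    coordinate itself and is bounded by the norm of the point. *)
Definition line (i : 'I_3) (z : T3) (s : R) : T3 :=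
  if val i == 0%N then ((s, z.1.2), z.2)
  else if val i == 1%N then ((z.1.1, s), z.2) else ((z.1.1, z.1.2), s).

Lemma lineD i z h s : line i z (h + s) = h *: evec R i + line i z s.
Proof.
case: i => [[|[|[|//]]] hi]; rewrite /line /evec /=.
- by transitivity ((h * 1 + s, h * 0 + z.1.2), h * 0 + z.2) => //; rewrite mulr1 !mulr0 !add0r.
- by transitivity ((h * 0 + z.1.1, h * 1 + s), h * 0 + z.2) => //; rewrite mulr1 !mulr0 !add0r.
- by transitivity ((h * 0 + z.1.1, h * 0 + z.1.2), h * 1 + s) => //; rewrite mulr1 !mulr0 !add0r.
Qed.

Lemma is_derive_line f i z s : derivable f (line i z s) (evec R i) ->
  is_derive s (1 : R) (fun r => f (line i z r)) (partial i f (line i z s)).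
Proof.
move=> df; rewrite /partial.
have E : (fun h : R => h^-1 *: (f (line i z (h *: 1 + s)) - f (line i z s))) =
   (fun h : R => h^-1 *: (f (h *: evec R i + line i z s) - f (line i z s))).
  by apply/funext => h; rewrite lineD [h *: 1]mulr1.
split; first by rewrite /derivable E.
by rewrite /derive E.
Qed.

Lemma norm_line_ge i z s : `|s| <= `|line i z s|.
Proof.
by case: i => [[|[|[|//]]] hi]; rewrite /line /= !prod_normE /= !le_max lexx ?orbT.
Qed.

Lemma line_continuous i z : continuous (line i z).
Proof.
move=> s; case: i => [[|[|[|//]]] hi]; rewrite /line /=.
- apply: (@continuous_comp R (R * R)%type (R * R * R)%type (fun s => (s, z.1.2)) (fun s => (s, z.2)) s).
    exact: continuous_pairl.
  exact: continuous_pairl.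
- apply: (@continuous_comp R (R * R)%type (R * R * R)%type (fun s => (z.1.1, s)) (fun s => (s, z.2)) s).
    exact: continuous_pairr.
  exact: continuous_pairl.
- exact: continuous_pairr.
Qed.

Lemma integral_restrict_itv (h : R -> R) (M : R) :
  (forall s, M < `|s| -> h s = 0) ->
  (\int[lam]_s (h s)%:E = \int[lam]_(s in `[(- M)%R, M]) (h s)%:E)%E.
Proof.
move=> h0; rewrite [in RHS]integral_mkcond.
apply: eq_integral => s _.
rewrite patchE; case: ifPn => // /negP; rewrite inE /= in_itv /= -ler_norml => /negP.
by rewrite -ltNge => /h0 ->.
Qed.

(** The first conclusion feeds integration by parts; the second, obtained by integrating from
    outside the support up to [x], is the one-dimensional estimate behind Sobolev's inequality. *)
Lemma FTC2_compact_support (F F' : R -> R) (M : R) : 0 < M ->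
  (forall s : R, is_derive s (1 : R) F (F' s)) -> continuous F' ->
  (forall s, M < `|s| -> F s = 0) -> (forall s, M < `|s| -> F' s = 0) ->
  (\int[lam]_s (F' s)%:E = 0)%E /\
  (forall x, (`|F x|%:E <= \int[lam]_s `|F' s|%:E)%E).
Proof.
move=> M0 dF cF' F0 F'0.
have dFd s : derivable F s 1 by have [] := dF s.
have cF s : F x @[x --> s] --> F s.
  by apply: differentiable_continuous; apply/derivable1_diffP.
have ftc a b : a < b -> (\int[lam]_(x in `[a, b]) (F' x)%:E = (F b)%:E - (F a)%:E)%E.
  move=> ab; apply: continuous_FTC2 => //.
  - exact: continuous_subspaceT.
  - by split=> [s _||]; [exact: dFd|exact: cvg_at_right_filter|exact: cvg_at_left_filter].
  - by move=> s _; rewrite derive1E; have [_ ->] := dF s.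
(* The margin 1 is there because the support hypothesis is strict and says nothing at [M] itself. *)
have Mend s : s = M + 1 \/ s = - (M + 1) -> F s = 0.
  by move=> [|] ->; apply: F0; rewrite ?normrN gtr0_norm; lra.
split.
  rewrite (@integral_restrict_itv _ (M + 1)); last by move=> s ?; apply: F'0; lra.
  have -> := ftc (- (M + 1)) (M + 1) ltac:(lra).
  by rewrite (Mend (M + 1)) ?(Mend (- (M + 1))) ?subee //; [right|left].
move=> x; have [/F0 ->|xM] := ltP M `|x|.
  by rewrite normr0; apply: integral_ge0 => s _; rewrite lee_fin.
have xM1 : - (M + 1) < x by move: xM; rewrite ler_norml; lra.
have := ftc _ _ xM1; rewrite (Mend (- (M + 1))); last by right.
rewrite sube0 => /(congr1 abse) /= <-.
have mF' : meas F' by exact: continuous_measurable_fun.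
have mE : meas (fun s => (F' s)%:E) by exact/measurable_EFinP.
apply: (le_trans (le_abse_integral _ _ _)) => //.
  exact: measurable_funS mE.
apply: ge0_subset_integral => //.
by apply/measurable_EFinP; exact: measurableT_comp (@normr_measurable R setT) mF'.
Qed.

Definition C1c f := [/\ forall z, differentiable f z,
  forall i, continuous (partial i f) & compact_support3 f].

Lemma partial_support f i : forall M : R, (forall z : T3, M < `|z| -> f z = 0) ->
  forall z : T3, M < `|z| -> partial i f z = 0.
Proof.
move=> M f0 z Mz; rewrite /partial.
rewrite (@near_eq_derive R T3 R f (cst 0)) ?derive_cst //.
have : \forall y \near z, M < `|y|.
  by have /cvgr_gt := (@norm_continuous R T3 z); apply.
by apply: filterS => y /f0.
Qed.

Lemma differentiable_continuous3 f : (forall z, differentiable f z) -> continuous f.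
Proof. by move=> df z; exact: differentiable_continuous. Qed.

Section C1c_facts.
Variables (f : T3 -> R) (cf : C1c f).

Lemma C1c_continuous : continuous f.
Proof. by case: cf => df _ _; exact: differentiable_continuous3. Qed.

Lemma C1c_partial_support i : compact_support3 (partial i f).
Proof.
by have [_ _ [M h]] := cf; exists M => z; exact: partial_support.
Qed.

Lemma C1c_supports : exists2 M : R, 0 < M &
  (forall z : T3, M < `|z| -> f z = 0) /\ (forall i (z : T3), M < `|z| -> partial i f z = 0).
Proof.
have [_ _ /compact_support3P [M M0 h]] := cf; exists M => //; split => // i z.
exact: partial_support.
Qed.

Lemma C1c_line i z :
  (\int[lam]_s (partial i f (line i z s))%:E = 0)%E /\
  (forall s, (`|f (line i z s)|%:E <= \int[lam]_s `|partial i f (line i z s)|%:E)%E).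
Proof.
have [M M0 [h1 h2]] := C1c_supports; have [df cpf _] := cf.
apply: (@FTC2_compact_support (fun s => f (line i z s)) _ M M0).
- by move=> s; apply: is_derive_line; exact: diff_derivable.
- move=> s; apply: (@continuous_comp R T3 R (line i z) (partial i f) s).
    exact: line_continuous.
  exact: cpf.
- by move=> s Ms; apply: h1; exact: lt_le_trans (norm_line_ge i z s).
- by move=> s Ms; apply: h2; exact: lt_le_trans (norm_line_ge i z s).
Qed.

End C1c_facts.
(** * Iterated integrals and the Loomis-Whitney inequality *)

Section tonelli.
Local Open Scope ereal_scope.

Lemma measurable_pair_fst (x : R) : meas (fun y : R => (x, y)).
Proof. by apply: measurable_fun_pair => //; exact: measurable_cst. Qed.

Lemma tonelli2 (h : R * R -> \bar R) : meas h -> (forall w, 0 <= h w) ->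
  \int[(lam \x lam)]_w h w = \int[lam]_x \int[lam]_y h (x, y).
Proof. exact: (@fubini_tonelli1 _ _ _ _ R lam lam h). Qed.

Lemma tonelli2_swap (h : R * R -> \bar R) : meas h -> (forall w, 0 <= h w) ->
  \int[lam]_x \int[lam]_y h (x, y) = \int[lam]_y \int[lam]_x h (x, y).
Proof. exact: (@fubini_tonelli _ _ _ _ R lam lam h). Qed.

Section g.
Variables (g : T3 -> R) (mg : meas g) (g0 : forall z, (0 <= g z)%R).

Let mEg : meas (EFin \o g). Proof. exact/measurable_EFinP. Qed.
Let Eg0 z : 0 <= (EFin \o g) z. Proof. by rewrite /= lee_fin. Qed.

Lemma tonelli3 : \I_z (g z) = \int[(lam \x lam)]_w \int[lam]_z (g (w, z))%:E.
Proof. exact: (@fubini_tonelli1 _ _ _ _ R (@leb2 R) lam (EFin \o g) mEg Eg0). Qed.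

Let mF : meas (fun w : R * R => \int[lam]_z (g (w, z))%:E).
Proof. exact: (@measurable_fun_fubini_tonelli_F _ _ _ _ R lam (EFin \o g) mEg Eg0). Qed.
Let F0 (w : R * R) : 0 <= \int[lam]_z (g (w, z))%:E.
Proof. by apply: integral_ge0 => z _; exact: Eg0. Qed.

Lemma tonelli3_xyz :
  \I_z (g z) = \int[lam]_x \int[lam]_y \int[lam]_z (g ((x, y), z))%:E.
Proof. by rewrite tonelli3 (tonelli2 mF). Qed.

Lemma tonelli3_xzy :
  \I_z (g z) = \int[lam]_x \int[lam]_z \int[lam]_y (g ((x, y), z))%:E.
Proof.
rewrite tonelli3_xyz; apply: eq_integral => x _.
apply: (@tonelli2_swap (fun p => (g ((x, p.1), p.2))%:E)) => [|p]; last exact: Eg0.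
apply/measurable_EFinP; apply: (measurableT_comp mg).
apply: measurable_fun_pair => //; apply: measurable_fun_pair => //; exact: measurable_cst.
Qed.

Lemma tonelli3_yzx :
  \I_z (g z) = \int[lam]_y \int[lam]_z \int[lam]_x (g ((x, y), z))%:E.
Proof.
rewrite tonelli3_xyz (tonelli2_swap mF F0); apply: eq_integral => y _.
apply: (@tonelli2_swap (fun p => (g ((p.1, y), p.2))%:E)) => [|p]; last exact: Eg0.
apply/measurable_EFinP; apply: (measurableT_comp mg).
apply: measurable_fun_pair => //; apply: measurable_fun_pair => //; exact: measurable_cst.
Qed.

End g.

Lemma integral_bounded_support (k : R -> R) (C M : R) : meas k ->
  (0 <= C)%R -> (0 < M)%R -> (forall r, (0 <= k r <= C)%R) ->
  (forall r, (M < `|r|)%R -> k r = 0%R) ->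
  \int[lam]_r (k r)%:E <= (C * (M + M))%:E.
Proof.
move=> mk C0 M0 kC k0; rewrite (integral_restrict_itv k0).
apply: (@le_trans _ _ (\int[lam]_(r in `[(- M)%R, M]) (cst C%:E) r)).
  apply: ge0_le_integral => //.
  - by move=> r _; rewrite lee_fin; have /andP[] := kC r.
  - by apply/measurable_EFinP; exact: measurable_funTS.
  - by move=> r _; rewrite lee_fin; have /andP[] := kC r.
rewrite integral_cst //= lebesgue_measure_itv /= lte_fin ifT; last lra.
by rewrite -EFinB -EFinM opprK.
Qed.

End tonelli.

Lemma measurable_sqrt d (T : measurableType d) (f : T -> R) :
  meas f -> meas (fun t => Num.sqrt (f t)).
Proof.
move=> mf; apply: (measurableT_comp (f := @Num.sqrt R)) => //.
by apply: continuous_measurable_fun => x; exact: sqrt_continuous.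
Qed.

Lemma cauchy_schwarz1 (f g : R -> R) (a b : R) :
  meas f -> meas g ->
  (forall z, 0 <= f z) -> (forall z, 0 <= g z) -> 0 <= a -> 0 <= b ->
  (\int[lam]_z (f z ^+ 2)%:E <= a%:E)%E -> (\int[lam]_z (g z ^+ 2)%:E <= b%:E)%E ->
  (\int[lam]_z (f z * g z)%:E <= (Num.sqrt a * Num.sqrt b)%:E)%E.
Proof. exact: (@cauchy_schwarz _ _ R lam f g). Qed.

Lemma cauchy_schwarz3 (f g : T3 -> R) (a b : R) :
  meas f -> meas g ->
  (forall z, 0 <= f z) -> (forall z, 0 <= g z) -> 0 <= a -> 0 <= b ->
  (\I_z (f z ^+ 2) <= a%:E)%E -> (\I_z (g z ^+ 2) <= b%:E)%E ->
  (\I_z (f z * g z) <= (Num.sqrt a * Num.sqrt b)%:E)%E.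
Proof. exact: (@cauchy_schwarz _ _ R mu3 f g). Qed.

(** Cauchy-Schwarz three times: in [z] for the factors from [a] and [b], in [y] for [c] against the
    marginal of [a], and in [x] for the marginals of [b] and [c]. *)
Lemma loomis_whitney (a b c : R * R -> R) (al be ga : R) :
  meas a -> meas b -> meas c ->
  (forall w, 0 <= a w) -> (forall w, 0 <= b w) -> (forall w, 0 <= c w) ->
  (forall y, \int[lam]_z (a (y, z))%:E < +oo)%E ->
  (forall x, \int[lam]_z (b (x, z))%:E < +oo)%E ->
  (forall x, \int[lam]_y (c (x, y))%:E < +oo)%E ->
  0 <= al -> 0 <= be -> 0 <= ga ->
  (\int[lam]_y (pint a y)%:E <= al%:E)%E ->
  (\int[lam]_x (pint b x)%:E <= be%:E)%E ->
  (\int[lam]_x (pint c x)%:E <= ga%:E)%E ->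
  (\I_z (Num.sqrt (a (z.1.2, z.2)) * Num.sqrt (b (z.1.1, z.2)) * Num.sqrt (c z.1))
    <= (Num.sqrt al * Num.sqrt be * Num.sqrt ga)%:E)%E.
Proof.
move=> ma mb mc a0 b0 c0 aoo boo coo al0 be0 ga0 aal bbe cga.
have sq0 (x : R) : 0 <= Num.sqrt x by exact: sqrtr_ge0.
have mA := measurable_pint ma a0; have mB := measurable_pint mb b0.
have mC := measurable_pint mc c0.
have A0 y : 0 <= pint a y by exact: pint_ge0.
have B0 y : 0 <= pint b y by exact: pint_ge0.
have C0 y : 0 <= pint c y by exact: pint_ge0.
have mas y : meas (fun z => Num.sqrt (a (y, z))).
  by apply: measurable_sqrt; exact: measurableT_comp ma (measurable_pair_fst y).
have mbs y : meas (fun z => Num.sqrt (b (y, z))).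
  by apply: measurable_sqrt; exact: measurableT_comp mb (measurable_pair_fst y).
have mcs y : meas (fun z => Num.sqrt (c (y, z))).
  by apply: measurable_sqrt; exact: measurableT_comp mc (measurable_pair_fst y).
have mF : meas (fun z : T3 =>
    Num.sqrt (a (z.1.2, z.2)) * Num.sqrt (b (z.1.1, z.2)) * Num.sqrt (c z.1)).
  apply: measurable_funM; first apply: measurable_funM; apply: measurable_sqrt.
  + by apply: (measurableT_comp ma); mpair.
  + by apply: (measurableT_comp mb); mpair.
  + by apply: (measurableT_comp mc); mpair.
have mAw : meas (fun w : R * R => Num.sqrt (pint a w.2)).
  by apply: measurable_sqrt; apply: measurableT_comp mA measurable_snd.
have mBw : meas (fun w : R * R => Num.sqrt (pint b w.1)).
  by apply: measurable_sqrt; apply: measurableT_comp mB measurable_fst.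
have mG : meas (fun w : R * R =>
    Num.sqrt (c w) * (Num.sqrt (pint a w.2) * Num.sqrt (pint b w.1))).
  by apply: measurable_funM; [exact: measurable_sqrt|exact: measurable_funM].
rewrite tonelli3 //.
apply: (@le_trans _ _ (\int[(lam \x lam)]_w
   (Num.sqrt (c w) * (Num.sqrt (pint a w.2) * Num.sqrt (pint b w.1)))%:E)%E).
  apply: ge0_le_integral => //.
  - by move=> w _; apply: integral_ge0 => z _; rewrite lee_fin !mulr_ge0.
  - apply: (@measurable_fun_fubini_tonelli_F _ _ _ _ R lam (fun z : T3 => (Num.sqrt (a (z.1.2, z.2)) * Num.sqrt (b (z.1.1, z.2)) * Num.sqrt (c z.1))%:E)).
      exact/measurable_EFinP.
    by move=> z; rewrite lee_fin !mulr_ge0.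
  - exact/measurable_EFinP.
  move=> [x y] _ /=.
  under eq_integral do rewrite mulrC.
  rewrite ge0_integralrZ; [|exact: (measurable_funM (mas y) (mbs x))|by []|by move=> z; rewrite mulr_ge0].
  rewrite EFinM lee_wpmul2l ?lee_fin //.
  apply: (cauchy_schwarz1 (mas y) (mbs x)) => //.
  - by rewrite pintE // le_eqVlt; apply/orP; left; apply/eqP/eq_integral => z _; rewrite sqr_sqrtr.
  - by rewrite pintE // le_eqVlt; apply/orP; left; apply/eqP/eq_integral => z _; rewrite sqr_sqrtr.
rewrite tonelli2; last 2 first.
- exact/measurable_EFinP.
- by move=> z; rewrite lee_fin !mulr_ge0.
have mAs := measurable_sqrt mA; have mBs := measurable_sqrt mB; have mCs := measurable_sqrt mC.
apply: (@le_trans _ _ (\int[lam]_x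
   (Num.sqrt al * (Num.sqrt (pint b x) * Num.sqrt (pint c x)))%:E)%E).
  apply: ge0_le_integral => //.
  - by move=> w _; apply: integral_ge0 => z _; rewrite lee_fin !mulr_ge0.
  - apply: (@measurable_fun_fubini_tonelli_F _ _ _ _ R lam (fun w : R * R =>
    (Num.sqrt (c w) * (Num.sqrt (pint a w.2) * Num.sqrt (pint b w.1)))%:E)).
      exact/measurable_EFinP.
    by move=> z; rewrite lee_fin !mulr_ge0.
  - by apply/measurable_EFinP; apply: measurable_funM => //; exact: measurable_funM.
  move=> x _ /=.
  under eq_integral do rewrite mulrA mulrC.
  rewrite ge0_integralrZ; [|exact: (measurable_funM (mcs x) mAs)|by []|by move=> z; rewrite mulr_ge0].
  rewrite (_ : _ * (_ * _) = Num.sqrt (pint b x) * (Num.sqrt (pint c x) * Num.sqrt al)); last by ring.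
  rewrite EFinM lee_wpmul2l ?lee_fin //.
  apply: (cauchy_schwarz1 (mcs x) mAs) => //.
  - by rewrite pintE // le_eqVlt; apply/orP; left; apply/eqP/eq_integral => z _; rewrite sqr_sqrtr.
  - by under eq_integral do rewrite sqr_sqrtr //.
rewrite ge0_integralrZ; [|exact: (measurable_funM mBs mCs)|by []|by move=> z; rewrite mulr_ge0].
rewrite -mulrA EFinM lee_wpmul2l ?lee_fin //.
by apply: (cauchy_schwarz1 mBs mCs) => //; under eq_integral do rewrite sqr_sqrtr //.
Qed.

(** * Chain and product rules for partial derivatives *)

Lemma is_derive_exprnS n (s : R) :
  is_derive s (1 : R) (fun x : R => x ^+ n.+1) (n.+1%:R * s ^+ n).
Proof.
have := @is_deriveX R R id n.+1 s 1 1 (is_derive_id s 1).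
rewrite (_ : id ^+ n.+1 = fun x : R => x ^+ n.+1); last first.
  by apply/funext => x; rewrite fctE.
by rewrite /= [_ *: 1]mulr1.
Qed.

Lemma differentiable_comp_at (T : R -> R) (T' : R) f z :
  differentiable f z -> is_derive (f z) (1 : R) T T' -> differentiable (T \o f) z.
Proof.
move=> df dT; apply: differentiable_comp => //.
by apply/derivable1_diffP; have [] := dT.
Qed.

Lemma partial_comp_at i (T : R -> R) (T' : R) f z :
  differentiable f z -> is_derive (f z) (1 : R) T T' ->
  partial i (T \o f) z = T' * partial i f z.
Proof.
move=> df dT; have dTf : differentiable T (f z).
  by apply/derivable1_diffP; have [] := dT.
rewrite /partial deriveE; last exact: differentiable_comp.
rewrite diff_comp // /= deriveE // diff1E //= derive1E.
by have [_ ->] := dT; rewrite [_ *: _]mulrC.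
Qed.

Section comp.
Variables (T T' : R -> R) (f : T3 -> R).
Hypothesis dT : forall s : R, is_derive s (1 : R) T (T' s).

Lemma differentiable_comp3 z : differentiable f z -> differentiable (T \o f) z.
Proof. by move=> df; exact: differentiable_comp_at (dT (f z)). Qed.

Lemma partial_comp i z : differentiable f z ->
  partial i (T \o f) z = T' (f z) * partial i f z.
Proof. by move=> df; exact: partial_comp_at. Qed.

Lemma C1c_comp : continuous T' -> T 0 = 0 -> C1c f -> C1c (T \o f).
Proof.
move=> cT' T0 [df cf [M sf]]; split.
- by move=> z; exact: differentiable_comp3.
- move=> i; have -> : partial i (T \o f) = fun z => T' (f z) * partial i f z.
    by apply/funext => z; exact: partial_comp.
  move=> z; apply: cvgM; last exact: cf.
  apply: (@continuous_comp T3 R R f T' z); last exact: cT'.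
  exact: differentiable_continuous.
- by exists M => z Mz /=; rewrite sf.
Qed.

End comp.

Lemma partialM i f g z : differentiable f z -> differentiable g z ->
  partial i (fun z => f z * g z) z = f z * partial i g z + g z * partial i f z.
Proof.
move=> df dg; have := @deriveM R T3 f g z (evec R i) (diff_derivable df) (diff_derivable dg).
by rewrite /partial => ->.
Qed.

Lemma partialB i f g z : differentiable f z -> differentiable g z ->
  partial i (fun z => f z - g z) z = partial i f z - partial i g z.
Proof.
move=> df dg; have := @deriveB R T3 R f g z (evec R i) (diff_derivable df) (diff_derivable dg).
by rewrite /partial => ->.
Qed.

Lemma C1c_mulr f g : (forall z, differentiable f z) -> (forall i, continuous (partial i f)) ->
  C1c g -> C1c (fun z => f z * g z).
Proof.
move=> df cf [dg cg [M sg]]; split.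
- by move=> z; exact: differentiableM.
- move=> i; have -> : partial i (fun z => f z * g z) =
     fun z => f z * partial i g z + g z * partial i f z.
    by apply/funext => z; exact: partialM.
  move=> z; apply: cvgD; apply: cvgM; [|exact: cg| |exact: cf];
  exact: differentiable_continuous.
- by exists M => z Mz /=; rewrite sg ?mulr0.
Qed.

Lemma C1cB f g : C1c f -> C1c g -> C1c (fun z => f z - g z).
Proof.
move=> [df cf /compact_support3P[M M0 sf]] [dg cg /compact_support3P[N N0 sg]]; split.
- by move=> z; exact: differentiableB.
- move=> i; have -> : partial i (fun z => f z - g z) = fun z => partial i f z - partial i g z.
    by apply/funext => z; exact: partialB.
  by move=> z; apply: cvgB; [exact: cf|exact: cg].
- by exists (M + N) => z Mz; rewrite sf ?sg ?subrr //; lra.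
Qed.

Lemma smooth3_C1 f : smooth3 f ->
  (forall z, differentiable f z) /\ (forall i, continuous (partial i f)).
Proof.
move=> sf; split; first exact: (sf [::]).
by move=> i; apply: differentiable_continuous3; exact: (sf [:: i]).
Qed.

Lemma test_fun3_C1c f : test_fun3 f -> C1c f.
Proof. by move=> [/smooth3_C1 [df cf] sf]. Qed.

(** * Marginals along a coordinate axis and integration by parts *)

Definition ins (i : 'I_3) (w : R * R) (s : R) : T3 :=
  if val i == 0%N then ((s, w.1), w.2)
  else if val i == 1%N then ((w.1, s), w.2) else (w, s).

Definition del (i : 'I_3) (z : T3) : R * R :=
  if val i == 0%N then (z.1.2, z.2)
  else if val i == 1%N then (z.1.1, z.2) else z.1.

Lemma ins_line i w s : ins i w s = line i (ins i w 0) s.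
Proof. by case: w => x y; case: i => [[|[|[|//]]] hi]. Qed.

Lemma ins_del i z : exists s, z = line i (ins i (del i z) 0) s.
Proof.
case: z => [[x y] z]; case: i => [[|[|[|//]]] hi].
- by exists x.
- by exists y.
- by exists z.
Qed.

Lemma measurable_ins i : meas (fun p : (R * R) * R => ins i p.1 p.2).
Proof. by case: i => [[|[|[|//]]] hi]; rewrite /ins /=; mpair. Qed.

Lemma norm_ins_ge i w s : [/\ `|w.1| <= `|ins i w s|, `|w.2| <= `|ins i w s| & `|s| <= `|ins i w s|].
Proof.
by case: i => [[|[|[|//]]] hi]; rewrite /ins /=; split; rewrite !prod_normE /= !le_max lexx ?orbT.
Qed.

Section slice.
Variables (i : 'I_3) (g : T3 -> R) (C M : R).
Hypotheses (cg : continuous g) (C0 : 0 <= C) (M0 : 0 < M)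
  (gC : forall z, 0 <= g z <= C) (g0 : forall z : T3, M < `|z| -> g z = 0).

Definition slice : R * R -> R := pint (fun p => g (ins i p.1 p.2)).

Let gge0 z : 0 <= g z. Proof. by have /andP[] := gC z. Qed.

Let gsec w : continuous (fun s => g (ins i w s)).
Proof.
have -> : (fun s => g (ins i w s)) = g \o line i (ins i w 0).
  by apply/funext => s; rewrite /= ins_line.
move=> s; apply: (@continuous_comp R T3 R (line i (ins i w 0)) g s); last exact: cg.
exact: line_continuous.
Qed.

Let secb w : (\int[lam]_s (g (ins i w s))%:E <= (C * (M + M))%:E)%E.
Proof.
apply: (@integral_bounded_support (fun s => g (ins i w s)) C M) => //.
  exact: continuous_measurable_fun.
move=> r Mr; apply: g0; apply: lt_le_trans Mr _.
by have [] := norm_ins_ge i w r.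
Qed.

Lemma sliceE w : ((slice w)%:E = \int[lam]_s (g (ins i w s))%:E)%E.
Proof.
rewrite /slice (@pintE _ _ _ (fun p => g (ins i p.1 p.2)) w) //=.
by apply: le_lt_trans (secb w) _; rewrite ltry.
Qed.

Lemma slice_ge0 w : 0 <= slice w. Proof. by apply: pint_ge0. Qed.

Lemma measurable_slice : meas slice.
Proof.
apply: measurable_pint => //; apply: (measurableT_comp (continuous_measurable3 cg)).
exact: measurable_ins.
Qed.

Lemma slice_int_lty t : (\int[lam]_r (slice (t, r))%:E < +oo)%E.
Proof.
apply: (@le_lt_trans _ _ (C * (M + M) * (M + M))%:E); last by rewrite ltry.
apply: (@integral_bounded_support (fun r => slice (t, r)) (C * (M + M)) M) => //.
- by apply: (measurableT_comp measurable_slice); exact: measurable_pair_fst.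
- by rewrite mulr_ge0 // addr_ge0 // ltW.
- by move=> r; rewrite slice_ge0 /= -lee_fin sliceE.
- move=> r Mr; apply: EFin_inj; rewrite sliceE; apply: integral0_eq => s _.
  by rewrite g0 //; apply: lt_le_trans Mr _; have [] := norm_ins_ge i (t, r) s.
Qed.

Lemma slice_int : (\int[lam]_t (pint slice t)%:E = \I_z (g z))%E.
Proof.
have mg := continuous_measurable3 cg.
transitivity (\int[lam]_t \int[lam]_r \int[lam]_s (g (ins i (t, r) s))%:E)%E.
  apply: eq_integral => t _; rewrite pintE; last exact: slice_int_lty.
    by apply: eq_integral => r _; rewrite sliceE.
  exact: slice_ge0.
case: i => [[|[|[|//]]] hi]; rewrite /ins /=.
- by rewrite tonelli3_yzx.
- by rewrite tonelli3_xzy.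
- by rewrite tonelli3_xyz.
Qed.

End slice.

(** Turns an identity about the integral of a difference into one between integrals of nonnegative
    functions, so that Tonelli's theorem can be used for signed integrands. *)
Lemma integral_diff_eq0 d (T : measurableType d) (mu : {measure set T -> \bar R})
    (a b : T -> R) : meas a -> meas b ->
  (forall t, 0 <= a t) -> (forall t, 0 <= b t) ->
  (\int[mu]_t (a t)%:E < +oo)%E -> (\int[mu]_t (b t)%:E < +oo)%E ->
  (\int[mu]_t (a t)%:E = \int[mu]_t (b t)%:E <-> \int[mu]_t (a t - b t)%:E = 0)%E.
Proof.
move=> ma mb a0 b0 aoo boo.
have ia : mu.-integrable setT (EFin \o a).
  by apply: (le_integrable_real ma ma) => // t; rewrite ger0_norm.
have ib : mu.-integrable setT (EFin \o b).
  by apply: (le_integrable_real mb mb) => // t; rewrite ger0_norm.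
have -> : (\int[mu]_t (a t - b t)%:E = \int[mu]_t (a t)%:E - \int[mu]_t (b t)%:E)%E.
  by rewrite -(integralB measurableT ia ib).
have fa : (\int[mu]_t (a t)%:E \is a fin_num)%E by apply: (integrable_fin_num _ ia).
have fb : (\int[mu]_t (b t)%:E \is a fin_num)%E by apply: (integrable_fin_num _ ib).
split=> [->|/eqP]; first by rewrite subee.
by rewrite sube_eq ?fin_num_adde_defl // add0e => /eqP.
Qed.

Lemma integral_diff_eq0_1 (a b : R -> R) : meas a -> meas b ->
  (forall t, 0 <= a t) -> (forall t, 0 <= b t) ->
  (\int[lam]_t (a t)%:E < +oo)%E -> (\int[lam]_t (b t)%:E < +oo)%E ->
  (\int[lam]_t (a t)%:E = \int[lam]_t (b t)%:E <-> \int[lam]_t (a t - b t)%:E = 0)%E.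
Proof. exact: (@integral_diff_eq0 _ _ lam). Qed.

Lemma integral_diff_eq0_3 (a b : T3 -> R) : meas a -> meas b ->
  (forall t, 0 <= a t) -> (forall t, 0 <= b t) ->
  (\int[mu3]_t (a t)%:E < +oo)%E -> (\int[mu3]_t (b t)%:E < +oo)%E ->
  (\int[mu3]_t (a t)%:E = \int[mu3]_t (b t)%:E <-> \int[mu3]_t (a t - b t)%:E = 0)%E.
Proof. exact: (@integral_diff_eq0 _ _ mu3). Qed.

(** The derivative is split into its positive and negative parts. Its integral over every line in
    direction [i] vanishes, so the two parts have the same marginals along that axis, and hence the
    same integral. *)
Lemma integral_partial0 i f : C1c f -> (\I_z (partial i f z) = 0)%E.
Proof.
move=> cf; have [M M0 [_ h0]] := C1c_supports cf.
have [df /(_ i) ch _] := cf.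
have [C C0 hC] := bounded_compact_support3 ch (C1c_partial_support cf i).
set h := partial i f in ch hC *.
pose a z := (`|h z| + h z) / 2; pose b z := (`|h z| - h z) / 2.
have hE z : h z = a z - b z by rewrite /a /b; field.
have ca : continuous a.
  move=> z; apply: cvgMl; apply: cvgD; last exact: ch.
  by apply: (@continuous_comp T3 R R h Num.norm z); [exact: ch|exact: norm_continuous].
have cb : continuous b.
  move=> z; apply: cvgMl; apply: cvgB; last exact: ch.
  by apply: (@continuous_comp T3 R R h Num.norm z); [exact: ch|exact: norm_continuous].
have aC z : 0 <= a z <= C by have := hC z; have := ler_norm (h z); have := ler_norm (- h z); rewrite normrN /a; lra.
have bC z : 0 <= b z <= C by have := hC z; have := ler_norm (h z); have := ler_norm (- h z); rewrite normrN /b; lra.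
have a0 z : M < `|z| -> a z = 0 by move=> /h0 e; rewrite /a /h e normr0; lra.
have b0 z : M < `|z| -> b z = 0 by move=> /h0 e; rewrite /b /h e normr0; lra.
have ia : mu3.-integrable setT (EFin \o a).
  by apply: integrable_compact_support3 => //; exists M.
have ib : mu3.-integrable setT (EFin \o b).
  by apply: integrable_compact_support3 => //; exists M.
have age z : 0 <= a z by have /andP[] := aC z.
have bge z : 0 <= b z by have /andP[] := bC z.
have ma := continuous_measurable3 ca; have mb := continuous_measurable3 cb.
have C0' := ltW C0.
have sab : slice i a = slice i b.
  apply/funext => w; apply: EFin_inj.
  rewrite (sliceE i ca C0' M0 aC a0) (sliceE i cb C0' M0 bC b0).
  have msec (k : T3 -> R) : meas k -> meas (fun s : R => k (ins i w s)).
    move=> mk.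
    have mp : meas (fun s : R => (w, s)) by exact: pair1_measurable.
    exact: (measurableT_comp mk (measurableT_comp (measurable_ins i) mp)).
  apply: (integral_diff_eq0_1 (msec a ma) (msec b mb) _ _ _ _).2 => //.
  - by rewrite -(sliceE i ca C0' M0 aC a0) ltry.
  - by rewrite -(sliceE i cb C0' M0 bC b0) ltry.
  have [] := C1c_line cf i (ins i w 0); rewrite -/h => e _; rewrite -[RHS]e.
  by apply: eq_integral => s _; rewrite ins_line hE.
under eq_integral do rewrite hE.
apply: (integral_diff_eq0_3 ma mb age bge _ _).1.
- by have /integrableP[_] := ia; under eq_integral do rewrite /= ger0_norm //.
- by have /integrableP[_] := ib; under eq_integral do rewrite /= ger0_norm //.
by rewrite -(slice_int i ca C0' M0 aC a0) -(slice_int i cb C0' M0 bC b0) sab.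
Qed.

(** * Integrals over space and the Dirichlet energy *)

Lemma le_integral3 f g : meas f -> meas g ->
  (forall z, 0 <= f z) -> (forall z, f z <= g z) ->
  (\I_z (f z) <= \I_z (g z))%E.
Proof. exact: (@ge0_le_integralr _ _ R mu3). Qed.

Lemma integral3Z f c : meas f -> 0 <= c -> (forall z, 0 <= f z) ->
  (\I_z (c * f z) = c%:E * \I_z (f z))%E.
Proof. exact: (@ge0_integralrZ _ _ R mu3). Qed.

Lemma integral3D f g : meas f -> meas g ->
  (forall z, 0 <= f z) -> (forall z, 0 <= g z) ->
  (\I_z (f z + g z) = \I_z (f z) + \I_z (g z))%E.
Proof. exact: (@ge0_integralrD _ _ R mu3). Qed.

Lemma le_integrable3 f g : meas f -> meas g ->
  (forall z, `|f z| <= g z) -> (\I_z (g z) < +oo)%E ->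
  mu3.-integrable setT (EFin \o f).
Proof. exact: (@le_integrable_real _ _ R mu3). Qed.

Lemma measurable_lincomb f g (a b : R) : meas f -> meas g ->
  meas (fun z => a * f z + b * g z).
Proof.
move=> mf mg; apply: measurable_funD; apply: measurable_funM => //; exact: measurable_cst.
Qed.

Lemma lincomb_ge0 f g (a b : R) : 0 <= a -> 0 <= b -> (forall z, 0 <= f z) ->
  (forall z, 0 <= g z) -> forall z, 0 <= a * f z + b * g z.
Proof. by move=> a0 b0 f0 g0 z; apply: addr_ge0; exact: mulr_ge0. Qed.

Lemma integral3_lincomb_le f g (a b x y : R) : meas f -> meas g ->
  (forall z, 0 <= f z) -> (forall z, 0 <= g z) -> 0 <= a -> 0 <= b ->
  (\I_z (f z) <= x%:E)%E -> (\I_z (g z) <= y%:E)%E ->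
  (\I_z (a * f z + b * g z) <= (a * x + b * y)%:E)%E.
Proof.
move=> mf mg f0 g0 a0 b0 fx gy; rewrite integral3D.
- by rewrite !integral3Z // EFinD !EFinM; apply: leeD; apply: lee_wpmul2l; rewrite ?lee_fin.
- exact: measurable_funM (measurable_cst _) mf.
- exact: measurable_funM (measurable_cst _) mg.
- by move=> z; exact: mulr_ge0.
- by move=> z; exact: mulr_ge0.
Qed.

Lemma integral3_fin f : meas f -> (forall z, 0 <= f z) ->
  (\I_z (f z) < +oo)%E ->
  exists2 r : R, 0 <= r & (\I_z (f z) = r%:E)%E.
Proof.
move=> mf f0 foo; have i0 : (0 <= \I_z (f z))%E.
  by apply: integral_ge0 => z _; rewrite lee_fin.
exists (fine (\I_z (f z))%E); first exact: fine_ge0.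
by rewrite fineK // ge0_fin_numE.
Qed.

Definition dirichlet f : \bar R := (\I_z (\sum_(i < 3) (partial i f z) ^+ 2))%E.

Lemma C1c_measurable_partial f i : C1c f -> meas (partial i f).
Proof. by case=> _ /(_ i) cf _; exact: continuous_measurable3. Qed.

Lemma C1c_measurable f : C1c f -> meas f.
Proof. by move=> /C1c_continuous; exact: continuous_measurable3. Qed.

Lemma measurable_sqr_sum (h : 'I_3 -> T3 -> R) : (forall i, meas (h i)) ->
  meas (fun z => \sum_(i < 3) (h i z) ^+ 2).
Proof. by move=> mh; apply: measurable_sum => i; exact: measurable_funX. Qed.

Lemma sqr_le_sqr_sum (h : 'I_3 -> R) i : h i ^+ 2 <= \sum_(j < 3) h j ^+ 2.
Proof.
by rewrite (bigD1 i) //= lerDl; apply: sumr_ge0 => j _; rewrite sqr_ge0.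
Qed.

Lemma partial_le_dirichlet f i (d : R) : C1c f -> (dirichlet f <= d%:E)%E ->
  (\I_z (partial i f z ^+ 2) <= d%:E)%E.
Proof.
move=> cf; apply: le_trans; apply: le_integral3.
- by apply: measurable_funX; exact: C1c_measurable_partial.
- by apply: measurable_sqr_sum => j; exact: C1c_measurable_partial.
- by move=> z; rewrite sqr_ge0.
- by move=> z; exact: (sqr_le_sqr_sum (fun i => partial i f z)).
Qed.

(** * Sobolev inequality *)

(** Resolves the implicit bound met in Sobolev's inequality. With [s^2 = S] and [r^2 = d], squaring
    gives [s^4 <= 64 s^3 r^3], and [s^3] cancels. *)
Lemma sqrt_ler_cube (S d : R) : 0 <= S -> 0 <= d ->
  S <= Num.sqrt (4 * (Num.sqrt S * Num.sqrt d)) ^+ 3 -> S <= (64 * Num.sqrt d ^+ 3) ^+ 2.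
Proof.
move=> S0 d0 h.
set s := Num.sqrt S in h; set r := Num.sqrt d in h.
have s0 : 0 <= s by exact: sqrtr_ge0.
have r0 : 0 <= r by exact: sqrtr_ge0.
have sS : s ^+ 2 = S by rewrite sqr_sqrtr.
rewrite -sS in h *.
set t := Num.sqrt _ in h.
have t0 : 0 <= t by exact: sqrtr_ge0.
have tt : t ^+ 2 = 4 * (s * r) by rewrite sqr_sqrtr // !mulr_ge0.
have h2 : (s ^+ 2) ^+ 2 <= (t ^+ 3) ^+ 2 by rewrite lerXn2r // nnegrE ?exprn_ge0.
have h3 : s ^+ 3 * s <= s ^+ 3 * (64 * r ^+ 3).
  have -> : s ^+ 3 * s = (s ^+ 2) ^+ 2 by ring.
  have -> : s ^+ 3 * (64 * r ^+ 3) = (4 * (s * r)) ^+ 3 by ring.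
  have -> : (4 * (s * r)) ^+ 3 = (t ^+ 3) ^+ 2 by rewrite -tt; ring.
  exact: h2.
have [->|sn0] := eqVneq s 0; first by rewrite expr0n /= sqr_ge0.
have h4 : s <= 64 * r ^+ 3.
  by move: h3; rewrite ler_pM2l // exprn_gt0 // lt_neqAle eq_sym sn0.
by apply: lerXn2r; rewrite // nnegrE // (le_trans s0 h4).
Qed.

(** Gagliardo's argument for [F = f^4]. Each point value of [|F|] is at most the marginal of
    [|d_i F|] along each axis, so [f^6 = |F|^(3/2)] is at most a product of three square roots to
    which Loomis-Whitney applies. The exponent 4 is chosen so that [d_i F] contains [f^3], whose
    square is again [f^6]. *)
Theorem sobolev f (d : R) : C1c f -> 0 <= d -> (dirichlet f <= d%:E)%E ->
  (\I_z (f z ^+ 6) <= ((64 * Num.sqrt d ^+ 3) ^+ 2)%:E)%E.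
Proof.
move=> cf d0 fd.
pose i0 : 'I_3 := Ordinal (isT : (0 < 3)%N).
pose i1 : 'I_3 := Ordinal (isT : (1 < 3)%N).
pose i2 : 'I_3 := Ordinal (isT : (2 < 3)%N).
pose F z := f z ^+ 4.
have cF : C1c F.
  apply: (C1c_comp (is_derive_exprnS 3)) => //; last by rewrite expr0n.
  by move=> s; apply: cvgMr; exact: exprn_continuous.
have FE i z : partial i F z = 4 * f z ^+ 3 * partial i f z.
  by apply: (partial_comp (is_derive_exprnS 3)); have [] := cf.
have [M M0 [sF sdF]] := C1c_supports cF.
have mf := C1c_measurable cf.
(* The integral appears on both sides of the final estimate, so it must be finite before it is
   cancelled. *)
have [S S0 SE] : exists2 S : R, 0 <= S & (\I_z (f z ^+ 6) = S%:E)%E.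
  apply: integral3_fin; first exact: measurable_funX.
    by move=> z; rewrite exprn_even_ge0.
  have c6 : C1c (fun z => f z ^+ 6).
    apply: (C1c_comp (is_derive_exprnS 5)) => //; last by rewrite expr0n.
    by move=> s; apply: cvgMr; exact: exprn_continuous.
  have [_ _ s6] := c6.
  have /integrableP[_] := integrable_compact_support3 (C1c_continuous c6) s6.
  by under eq_integral do rewrite /= ger0_norm ?exprn_even_ge0 //.
pose g (i : 'I_3) (z : T3) : R := `|partial i F z|.
have [_ cpF _] := cF.
have cg i : continuous (g i).
  move=> z; apply: (@continuous_comp T3 R R (partial i F) Num.norm z).
    exact: cpF.
  exact: norm_continuous.
have [C C0 hC] : exists2 C : R, 0 <= C & forall i z, 0 <= g i z <= C.
  have h i := bounded_compact_support3 (cpF i) (C1c_partial_support cF i).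
  have [C0 C00 h0] := h i0; have [C1 C10 h1] := h i1; have [C2 C20 h2] := h i2.
  exists (C0 + C1 + C2); first by rewrite !addr_ge0 // ltW.
  move=> i z; rewrite normr_ge0 /=.
  have : i = i0 \/ i = i1 \/ i = i2.
    by case: i => [[|[|[|//]]] hi]; [left|right; left|right; right]; apply/val_inj.
  case=> [->|[->|->]]; [apply: le_trans (h0 z) _|apply: le_trans (h1 z) _|apply: le_trans (h2 z) _]; lra.
have g0 i (z : T3) : M < `|z| -> g i z = 0 by move=> Mz; rewrite /g sdF // normr0.
have Ig i : (\I_z (g i z) <= (4 * (Num.sqrt S * Num.sqrt d))%:E)%E.
  under eq_integral do rewrite /g FE -mulrA normrM normrM (ger0_norm (x := 4)) //.
  have m3 : meas (fun z => `|f z ^+ 3|).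
    by apply: (measurableT_comp (@normr_measurable _ setT)); exact: measurable_funX.
  have mp : meas (fun z => `|partial i f z|).
    by apply: (measurableT_comp (@normr_measurable _ setT)); exact: C1c_measurable_partial.
  rewrite integral3Z; [|exact: measurable_funM|by rewrite ler0n|by move=> z; rewrite mulr_ge0].
  rewrite EFinM lee_wpmul2l ?lee_fin ?ler0n //.
  apply: cauchy_schwarz3 => //.
  - rewrite -SE le_eqVlt; apply/orP; left; apply/eqP/eq_integral => z _.
    by rewrite -normrX -exprM ger0_norm // exprn_even_ge0.
  - under eq_integral do rewrite -normrX ger0_norm ?sqr_ge0 //.
    exact: partial_le_dirichlet.
have al0 : 0 <= 4 * (Num.sqrt S * Num.sqrt d) by rewrite !mulr_ge0 // sqrtr_ge0.
have msl i := measurable_slice i (cg i) (hC i).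
have gsl i w : 0 <= slice i (g i) w by apply: slice_ge0.
have Fsl i z : `|F z| <= slice i (g i) (del i z).
  rewrite -lee_fin (sliceE i (cg i) C0 M0 (hC i) (@g0 i)).
  have [s zE] := ins_del i z; have [_ /(_ s)] := C1c_line cF i (ins i (del i z) 0).
  rewrite -zE => /le_trans; apply; rewrite le_eqVlt; apply/orP; left; apply/eqP.
  by apply: eq_integral => r _; rewrite (ins_line i (del i z) r).
have soo i t := slice_int_lty i (cg i) C0 M0 (hC i) (@g0 i) t.
have sI i : (\int[lam]_t (pint (slice i (g i)) t)%:E <= (4 * (Num.sqrt S * Num.sqrt d))%:E)%E.
  by rewrite (slice_int i (cg i) C0 M0 (hC i) (@g0 i)).
have LW := loomis_whitney (msl i0) (msl i1) (msl i2) (gsl i0) (gsl i1) (gsl i2)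
  (soo i0) (soo i1) (soo i2) al0 al0 al0 (sI i0) (sI i1) (sI i2).
rewrite SE lee_fin; apply: sqrt_ler_cube => //.
rewrite -lee_fin -SE exprSr expr2; apply: le_trans LW.
have f2 i z : f z ^+ 2 <= Num.sqrt (slice i (g i) (del i z)).
  have -> : f z ^+ 2 = Num.sqrt (f z ^+ 4).
    by rewrite (exprM (f z) 2 2) sqrtr_sqr ger0_norm // sqr_ge0.
  by apply: ler_wsqrtr; exact: le_trans (ler_norm _) (Fsl i z).
apply: le_integral3.
- exact: measurable_funX.
- apply: measurable_funM; first apply: measurable_funM; apply: measurable_sqrt.
  + by apply: (measurableT_comp (msl i0)); mpair.
  + by apply: (measurableT_comp (msl i1)); mpair.
  + by apply: (measurableT_comp (msl i2)); mpair.
- by move=> z; rewrite exprn_even_ge0.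
- move=> z; have -> : f z ^+ 6 = f z ^+ 2 * f z ^+ 2 * f z ^+ 2 by ring.
  have p0 := sqr_ge0 (f z).
  apply: ler_pM; [exact: mulr_ge0|exact: p0| |exact: (f2 i2 z)].
  by apply: ler_pM; [exact: p0|exact: p0|exact: (f2 i0 z)|exact: (f2 i1 z)].
Qed.

(** * Cylindrical weights and the Hardy-Sobolev inequality *)

Lemma continuous_sqr_powR (a : R) : 0 < a -> continuous (fun s : R => (s ^+ 2) `^ a).
Proof.
move=> a0 s; have [->|s0] := eqVneq s 0.
  rewrite /continuous_at expr0n /= powR0 ?gt_eqF //.
  apply/cvgrPdist_lt => e e0; near=> x.
  rewrite sub0r normrN ger0_norm ?powR_ge0 //.
  rewrite [ltRHS](_ : e = (e `^ a^-1) `^ a); last first.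
    by rewrite -powRrM mulVf ?gt_eqF // powRr1 // ltW.
  apply: gt0_ltr_powR => //; rewrite ?nnegrE ?sqr_ge0 ?powR_ge0 //.
  rewrite -real_normK ?num_real // -[ltRHS]sqr_sqrtr ?powR_ge0 //.
  rewrite ltrXn2r // ?nnegrE ?sqrtr_ge0 //.
  near: x.
  have := @cvgr_norm_lt R R R (nbhs (0 : R)) _ id 0 cvg_id (Num.sqrt (e `^ a^-1)).
  by rewrite normr0 sqrtr_gt0 powR_gt0 //; apply.
apply: differentiable_continuous; apply/derivable1_diffP.
have s2 : 0 < s ^+ 2 by rewrite exprn_even_gt0.
have := @is_derive1_comp R (fun x => x `^ a) (fun x => x ^+ 2) s _ _
   (is_derive1_powR a s2) (is_derive_exprnS 1 s).
by case.
Unshelve. all: by end_near. Qed.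

(** Writing [|s|^(2a)] as a power of [s^2] keeps the base nonnegative. Away from 0 this is the chain
    rule; at 0 the difference quotient equals [h (h^2)^(a-1)], which tends to 0 since [a > 1]. *)
Lemma is_derive_sqr_powR (a s : R) : 1 < a ->
  is_derive s (1 : R) (fun s : R => (s ^+ 2) `^ a) (2 * a * s * (s ^+ 2) `^ (a - 1)).
Proof.
move=> a1; have [->|s0] := eqVneq s 0; last first.
  have s2 : 0 < s ^+ 2 by rewrite exprn_even_gt0.
  have := @is_derive1_comp R (fun x => x `^ a) (fun x => x ^+ 2) s _ _
     (is_derive1_powR a s2) (is_derive_exprnS 1 s).
  rewrite expr1 (_ : _ * _ = 2 * a * s * (s ^+ 2) `^ (a - 1)) //.
  by ring.
have H : h^-1 *: (((h *: 1 + 0) ^+ 2) `^ a - (0 ^+ 2) `^ a) @[h --> 0^'] --> (0 : R).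
  rewrite expr0n /= powR0; last by rewrite gt_eqF //; lra.
  have c := @continuous_sqr_powR (a - 1) ltac:(lra) (0 : R).
  have : (fun h : R => h * (h ^+ 2) `^ (a - 1)) h @[h --> 0^'] --> (0 * (0 ^+ 2) `^ (a - 1) : R).
    apply: cvg_within_filter; apply: cvgM; [exact: cvg_id|exact: c].
  rewrite mul0r; apply: cvg_trans; apply: near_eq_cvg.
  near=> h.
  have h0 : h != 0 by near: h; exact: nbhs_dnbhs_neq.
  have h2 : 0 < h ^+ 2 by rewrite exprn_even_gt0.
  rewrite subr0 addr0 [h *: 1]mulr1 -[_ *: _]/(h^-1 * _).
  rewrite -(@mulr_powRB1 _ (h ^+ 2) a) ?ltW //; last lra.
  by field.
rewrite mulr0 mul0r; split; first by apply/cvg_ex; exists 0.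
exact: cvg_lim H.
Unshelve. all: by end_near. Qed.

Definition C1 f := (forall z, differentiable f z) /\ (forall i, continuous (partial i f)).

Lemma C1_continuous f : C1 f -> continuous f.
Proof. by move=> [df _]; exact: differentiable_continuous3. Qed.

Lemma C1M f g : C1 f -> C1 g -> C1 (fun z => f z * g z).
Proof.
move=> [df cf] [dg cg]; split; first by move=> z; exact: differentiableM.
move=> i; have -> : partial i (fun z => f z * g z) =
   fun z => f z * partial i g z + g z * partial i f z.
  by apply/funext => z; exact: partialM.
move=> z; apply: cvgD; apply: cvgM; [|exact: cg| |exact: cf];
exact: differentiable_continuous.
Qed.

Lemma linear_C1 f : linear f -> continuous f ->
  C1 f /\ forall i z, partial i f z = f (evec R i).
Proof.
move=> lf cf.
pose mf := GRing.isLinear.Build R T3 R _ f lf.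
pose F : {linear T3 -> R} := HB.pack f mf.
have df z : differentiable f z by exact: (@linear_differentiable _ _ _ F z cf).
have pf i z : partial i f z = f (evec R i).
  by rewrite /partial deriveE // (@diff_lin _ _ _ F z cf).
split=> //; split=> // i; rewrite (_ : partial i f = cst (f (evec R i))).
  by move=> z; exact: cvg_cst.
by apply/funext => z; rewrite pf.
Qed.

Definition coord (i : 'I_3) (z : T3) : R :=
  if val i == 0%N then z.1.1 else if val i == 1%N then z.1.2 else z.2.

Lemma coord_C1 i : C1 (coord i) /\
  forall j z, partial j (coord i) z = (i == j)%:R.
Proof.
have [||h1 h2] := @linear_C1 (coord i).
- by move=> a x y; case: i => [[|[|[|//]]] hi].
- move=> z; case: i => [[|[|[|//]]] hi]; rewrite /coord /=.
  + apply: (@continuous_comp T3 (R * R)%type R fst fst z); exact: cvg_fst.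
  + by apply: (@continuous_comp T3 (R * R)%type R fst snd z); [exact: cvg_fst|exact: cvg_snd].
  + exact: cvg_snd.
split=> // j z; rewrite h2 /coord /evec.
by case: i {h1 h2} => [[|[|[|//]]] hi]; case: j => [[|[|[|//]]] hj].
Qed.

Definition i0 : 'I_3 := Ordinal (isT : (0 < 3)%N).
Definition i1 : 'I_3 := Ordinal (isT : (1 < 3)%N).
Definition i2 : 'I_3 := Ordinal (isT : (2 < 3)%N).

Lemma I3P (P : 'I_3 -> Prop) : P i0 -> P i1 -> P i2 -> forall i, P i.
Proof.
move=> h0 h1 h2 [[|[|[|//]]] hi].
- by rewrite (_ : Ordinal hi = i0) //; exact: val_inj.
- by rewrite (_ : Ordinal hi = i1) //; exact: val_inj.
- by rewrite (_ : Ordinal hi = i2) //; exact: val_inj.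
Qed.

Lemma sum_I3 (F : 'I_3 -> R) : \sum_(i < 3) F i = F i0 + F i1 + F i2.
Proof.
rewrite !big_ord_recl big_ord0 addr0 addrA.
by congr (F _ + F _ + F _); exact: val_inj.
Qed.

Definition rho (z : T3) : R := 1 + z.1.1 ^+ 2 + z.1.2 ^+ 2.

Lemma rho_ge1 z : 1 <= rho z.
Proof. by rewrite /rho; have := sqr_ge0 z.1.1; have := sqr_ge0 z.1.2; lra. Qed.

Lemma rho_gt0 z : 0 < rho z.
Proof. by have := rho_ge1 z; lra. Qed.

Lemma rho_C1 : C1 rho /\ forall i z, partial i rho z = if i == i2 then 0 else 2 * coord i z.
Proof.
have [[d0 c0] p0] := coord_C1 i0; have [[d1 c1] p1] := coord_C1 i1.
have dM k z : differentiable (coord k) z -> differentiable (fun z => coord k z * coord k z) z.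
  by move=> h; exact: differentiableM.
have rhoE : rho = fun z => 1 + (coord i0 z * coord i0 z + coord i1 z * coord i1 z).
  by apply/funext => z; rewrite /rho /coord /=; ring.
have dr z : differentiable rho z.
  rewrite rhoE; apply: differentiableD; first exact: differentiable_cst.
  by apply: differentiableD; exact: dM.
have pr i z : partial i rho z = if i == i2 then 0 else 2 * coord i z.
  have -> : partial i rho z = 2 * coord i0 z * (i0 == i)%:R + 2 * coord i1 z * (i1 == i)%:R.
    rewrite rhoE /partial deriveD; [|exact: derivable_cst|].
      rewrite derive_cst add0r deriveD; [|exact: diff_derivable (dM _ _ (d0 z))|exact: diff_derivable (dM _ _ (d1 z))].
      by rewrite -!/(partial _ _ _) (partialM _ (d0 z) (d0 z)) (partialM _ (d1 z) (d1 z)) !p0 !p1; ring.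
    by apply: derivableD; [exact: diff_derivable (dM _ _ (d0 z))|exact: diff_derivable (dM _ _ (d1 z))].
  by move: i; apply: I3P; rewrite /= ?mulr0 ?mulr1 ?addr0 ?add0r.
split=> //; split=> // i.
have -> : partial i rho = fun z => if i == i2 then 0 else 2 * coord i z by apply/funext => z.
case: (i == i2) => z; first exact: cvg_cst.
by apply: cvgMr; apply: C1_continuous; have [] := coord_C1 i.
Qed.

Definition wt (gam : R) (z : T3) : R := rho z `^ (- (gam / 2)).

Lemma wt_gt0 gam z : 0 < wt gam z.
Proof. by rewrite powR_gt0 // rho_gt0. Qed.

Lemma wt_ge0 gam z : 0 <= wt gam z.
Proof. by rewrite ltW // wt_gt0. Qed.

Lemma wt_le1 gam z : 0 <= gam -> wt gam z <= 1.
Proof.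
move=> g0; rewrite -[leRHS](powRr0 (rho z)) /wt; apply: ler_powR; first exact: rho_ge1.
by rewrite oppr_le0 divr_ge0.
Qed.

Lemma wtD a b z : wt (a + b) z = wt a z * wt b z.
Proof.
rewrite /wt -powRD; last by rewrite (gt_eqF (rho_gt0 z)) implybT.
by congr (_ `^ _); ring.
Qed.

Lemma wt_rho gam z : wt (gam + 2) z * rho z = wt gam z.
Proof.
rewrite wtD -mulrA (_ : wt 2 z * rho z = 1) ?mulr1 //.
rewrite /wt (_ : - (2 / 2) = -1); last by field.
by rewrite powR_inv1 ?mulVf ?gt_eqF ?rho_gt0 // ltW // rho_gt0.
Qed.

Lemma wt_C1 gam : C1 (wt gam) /\
  forall i z, partial i (wt gam) z = - (gam / 2) * wt (gam + 2) z * partial i rho z.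
Proof.
have [[dr cr] _] := rho_C1.
have D (b : R) z := is_derive1_powR (- (b / 2)) (rho_gt0 z).
have dw (b : R) z : differentiable (wt b) z by exact: differentiable_comp_at (dr z) (D b z).
have pw (b : R) i z : partial i (wt b) z = - (b / 2) * wt (b + 2) z * partial i rho z.
  by rewrite (partial_comp_at i (dr z) (D b z)) /wt; congr (_ * _ `^ _ * _); field.
split; last exact: pw.
split; [exact: dw|move=> i].
have -> : partial i (wt gam) = fun z => - (gam / 2) * wt (gam + 2) z * partial i rho z by apply/funext.
move=> z; apply: cvgM; last exact: cr.
by apply: cvgMr; apply: differentiable_continuous.
Qed.

Lemma measurable_wt gam : meas (wt gam).
Proof. by apply: continuous_measurable3; apply: C1_continuous; have [] := wt_C1 gam. Qed.

Lemma measurable_powRf f (a : R) : meas f ->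
  meas (fun z => f z `^ a).
Proof. exact: (measurableT_comp (@measurable_powR R a)). Qed.

(** The Hardy-Sobolev inequality with weight index [gam], normalised to energy at most 1. Other
    energies follow by homogeneity in [weighted_scale]. *)
Definition weighted (gam C : R) := forall f, C1c f -> (dirichlet f <= 1%:E)%E ->
  (\I_z (wt gam z * (f z ^+ 2) `^ (3 - gam)) <= C%:E)%E.

Lemma continuous_dsqr_powR (a : R) : 1 < a ->
  continuous (fun s : R => 2 * a * s * (s ^+ 2) `^ (a - 1)).
Proof.
move=> a1 s; apply: cvgM; last by apply: continuous_sqr_powR; lra.
by apply: cvgMr; exact: cvg_id.
Qed.

Lemma C1c_sqr_powR f (a : R) : 1 < a -> C1c f -> C1c (fun z => (f z ^+ 2) `^ a).
Proof.
move=> a1 cf; apply: (C1c_comp (fun s => is_derive_sqr_powR s a1)) => //.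
  exact: continuous_dsqr_powR.
by rewrite expr0n /= powR0 // gt_eqF //; lra.
Qed.

Lemma C1c_integrable f : C1c f -> mu3.-integrable setT (EFin \o f).
Proof.
by move=> cf; apply: integrable_compact_support3; [exact: C1c_continuous|case: cf].
Qed.

Lemma norm_sqr_powR (s a : R) : 1 < a -> `|s| * (s ^+ 2) `^ (a - 1) = (s ^+ 2) `^ (a - 2^-1).
Proof.
move=> a1; rewrite -sqrtr_sqr -powR12_sqrt ?sqr_ge0 // -powRD; last first.
  by apply/implyP => /eqP; lra.
by congr (_ `^ _); lra.
Qed.

(** The horizontal vector [(x_0, x_1)] has length at most [rho^(1/2)], and this factor lowers the
    index of the weight by one. *)
Lemma weighted_div_bound gam f z : 1 < 3 - gam -> 0 <= gam -> (forall z, differentiable f z) ->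
  `|coord i0 z * wt gam z * partial i0 (fun z => (f z ^+ 2) `^ (3 - gam)) z +
    coord i1 z * wt gam z * partial i1 (fun z => (f z ^+ 2) `^ (3 - gam)) z| <=
  2 * (3 - gam) * (wt (gam - 1) z * (f z ^+ 2) `^ (3 - gam - 2^-1) *
    Num.sqrt (\sum_(i < 3) (partial i f z) ^+ 2)).
Proof.
move=> p1 g0 df; set p := 3 - gam.
have pF i : partial i (fun z => (f z ^+ 2) `^ p) z =
    2 * p * f z * (f z ^+ 2) `^ (p - 1) * partial i f z.
  exact: (@partial_comp (fun s => (s ^+ 2) `^ p) _ f (fun s => is_derive_sqr_powR s p1) i z (df z)).
rewrite !pF; set x := coord i0 z; set y := coord i1 z; set w := wt gam z.
set A := (f z ^+ 2) `^ (p - 1).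
have alg (x' w' p' s' A' a' y' b' : R) : x' * w' * (2 * p' * s' * A' * a') + y' * w' * (2 * p' * s' * A' * b') =
  2 * p' * (w' * (s' * A') * (x' * a' + y' * b')) by ring.
rewrite alg {alg}.
rewrite normrM (ger0_norm (x := 2 * p)); last by rewrite mulr_ge0 // /p; lra.
rewrite ler_wpM2l //; first by rewrite mulr_ge0 // /p; lra.
rewrite !normrM (ger0_norm (wt_ge0 _ _)) (ger0_norm (powR_ge0 _ _)) norm_sqr_powR //.
set B := (f z ^+ 2) `^ (p - 2^-1).
set S := \sum_(i < 3) _.
have SE : S = partial i0 f z ^+ 2 + partial i1 f z ^+ 2 + partial i2 f z ^+ 2 by rewrite /S sum_I3.
have xy : `|x * partial i0 f z + y * partial i1 f z| <= Num.sqrt (rho z) * Num.sqrt S.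
  rewrite -sqrtrM; last by rewrite ltW ?rho_gt0.
  rewrite -sqrtr_sqr; apply: ler_wsqrtr; rewrite SE.
  have -> : rho z = 1 + x ^+ 2 + y ^+ 2 by [].
  set a := partial i0 f z; set b := partial i1 f z; set c := partial i2 f z.
  rewrite -subr_ge0.
  (* Lagrange's identity in the two horizontal variables exhibits the difference as a sum of
     squares. *)
  have -> : (1 + x ^+ 2 + y ^+ 2) * (a ^+ 2 + b ^+ 2 + c ^+ 2) - (x * a + y * b) ^+ 2 =
    a ^+ 2 + b ^+ 2 + c ^+ 2 + (x * b - y * a) ^+ 2 + (x * c) ^+ 2 + (y * c) ^+ 2 by ring.
  by rewrite !addr_ge0 // sqr_ge0.
have wE : w = wt (gam - 1) z * wt 1 z by rewrite -wtD subrK.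
have r1 : wt 1 z * Num.sqrt (rho z) = 1.
  rewrite /wt powRN div1r powR12_sqrt ?mulVf // ?ltW ?rho_gt0 //.
  by rewrite gt_eqF // sqrtr_gt0 rho_gt0.
apply: (le_trans (ler_wpM2l _ xy)); first by rewrite mulr_ge0 ?wt_ge0 ?powR_ge0.
have alg (a' b' c' d' e' : R) : a' * b' * c' * (d' * e') = (b' * d') * (a' * c' * e') by ring.
by rewrite -/w wE alg r1 mul1r.
Qed.

(** The horizontal field [X = wt gam * (x_0, x_1)] has divergence at least [(2 - gam) wt gam].
    Integrating by parts against [F = |f|^(2p)] leaves [2p] times the integral of
    [wt (gam - 1) |f|^(2p-1) |grad f|], and Cauchy-Schwarz separates the energy from the integral
    with index [2 gam - 2]. *)
Lemma weighted_step (gam C : R) : 1 <= gam -> gam < 2 -> 0 <= C ->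
  weighted (2 * gam - 2) C ->
  weighted gam (2 * (3 - gam) * (2 - gam)^-1 * Num.sqrt C).
Proof.
move=> g1 g2 C0 W f cf fd; set p := 3 - gam.
have p1 : 1 < p by rewrite /p; lra.
pose F z := (f z ^+ 2) `^ p.
have cF : C1c F by exact: C1c_sqr_powR.
have F0 z : 0 <= F z by exact: powR_ge0.
have [df _ _] := cf; have [dF cpF [M sF]] := cF.
have cX i : C1 (fun z => coord i z * wt gam z).
  by apply: C1M; [have [] := coord_C1 i|have [] := wt_C1 gam].
have cXF i : C1c (fun z => coord i z * wt gam z * F z).
  by have [d c] := cX i; exact: C1c_mulr.
(* Here [P = F div X], [Q = X . grad F] and [E = div (F X)]; the integral of [E] is zero. *)
pose P z := F z * (2 * wt gam z - gam * wt (gam + 2) z * (coord i0 z ^+ 2 + coord i1 z ^+ 2)).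
pose Q z := coord i0 z * wt gam z * partial i0 F z + coord i1 z * wt gam z * partial i1 F z.
pose E z := partial i0 (fun z => coord i0 z * wt gam z * F z) z +
            partial i1 (fun z => coord i1 z * wt gam z * F z) z.
have PE z : P z = E z - Q z.
  have [_ /(_ i0 z) p0] := coord_C1 i0; have [_ /(_ i1 z) p1'] := coord_C1 i1.
  have [_ pw] := wt_C1 gam; have [_ pr] := rho_C1.
  have dc i : differentiable (coord i) z by have [[]] := coord_C1 i.
  have dw : differentiable (wt gam) z by have [[]] := wt_C1 gam.
  have [dX0 _] := cX i0; have [dX1 _] := cX i1.
  rewrite /P /E /Q (partialM _ (dX0 z) (dF z)) (partialM _ (dX1 z) (dF z)).
  rewrite (partialM _ (dc i0) dw) (partialM _ (dc i1) dw) p0 p1' !pw !pr /= {pw pr dc dw dX0 dX1 p0 p1'}.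
  move: (F z) (wt gam z) (wt (gam + 2) z) (coord i0 z) (coord i1 z) (partial i0 F z) (partial i1 F z).
  move=> Fz w w2 x y a b.
  by clear; field.
have intE i : mu3.-integrable setT (EFin \o partial i (fun z => coord i z * wt gam z * F z)).
  apply: integrable_compact_support3; last exact: C1c_partial_support.
  by have [_ c _] := cXF i.
have cQ : continuous Q.
  move=> z; apply: cvgD; apply: cvgM; [|exact: cpF| |exact: cpF]; apply: C1_continuous; exact: cX.
have intQ : mu3.-integrable setT (EFin \o Q).
  apply: integrable_compact_support3 => //.
  by exists M => z Mz; rewrite /Q (partial_support i0 sF Mz) (partial_support i1 sF Mz) !mulr0 addr0.
have Q0 : (\I_z (P z) = - \I_z (Q z))%E.
  transitivity (\int[mu3]_z ((E z)%:E - (Q z)%:E))%E.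
    by apply: eq_integral => z _; rewrite PE EFinB.
  rewrite integralB //; last exact: (integrableD measurableT (intE i0) (intE i1)).
  rewrite (_ : (\I_z (E z) = 0)%E) ?sub0e //.
  rewrite (integralD_EFin measurableT (intE i0) (intE i1)).
  by rewrite !integral_partial0 ?adde0.
have mF := C1c_measurable cF.
have mw b := @measurable_wt b.
have mf := C1c_measurable cf.
have PF z : (2 - gam) * (wt gam z * F z) <= P z.
  have h := wt_rho gam z.
  have hr : rho z = 1 + (coord i0 z ^+ 2 + coord i1 z ^+ 2) by rewrite /rho addrA.
  have w2 := wt_ge0 (gam + 2) z.
  rewrite /P -h hr; set w := wt (gam + 2) z in w2 *; set r := _ + _ ^+ 2.
  rewrite (_ : _ * (_ * F z) = F z * ((2 - gam) * (w * (1 + r)))); last by ring.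
  rewrite ler_wpM2l //.
  rewrite -subr_ge0 (_ : _ - _ = gam * w); last by ring.
  by rewrite mulr_ge0 //; lra.
have mP : meas P.
  rewrite (_ : P = fun z => E z - Q z); last by apply/funext.
  apply: measurable_funB; last exact: continuous_measurable3.
  apply: measurable_funD; apply: continuous_measurable3; [have [_ c _] := cXF i0|have [_ c _] := cXF i1]; exact: c.
have mwF : meas (fun z => wt gam z * F z) by exact: measurable_funM.
have wF0 z : 0 <= wt gam z * F z by rewrite mulr_ge0 // wt_ge0.
pose S z := \sum_(i < 3) (partial i f z) ^+ 2.
have S0 z : 0 <= S z by apply: sumr_ge0 => i _; rewrite sqr_ge0.
have mS : meas S by apply: measurable_sqr_sum => i; exact: C1c_measurable_partial.
pose B z := wt (gam - 1) z * (f z ^+ 2) `^ (p - 2^-1).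
have B0 z : 0 <= B z by rewrite mulr_ge0 // ?wt_ge0 ?powR_ge0.
have mB : meas B.
  by apply: measurable_funM => //; apply: measurable_powRf; exact: measurable_funX.
have mBS : meas (fun z => B z * Num.sqrt (S z)).
  by apply: measurable_funM => //; exact: measurable_sqrt.
have key : ((2 - gam)%:E * \I_z (wt gam z * F z) <= (2 * p * (Num.sqrt C * Num.sqrt 1))%:E)%E.
  rewrite -integral3Z //; last lra.
  apply: (@le_trans _ _ (\I_z (P z))%E).
    by apply: le_integral3 => //; [exact: measurable_funM|move=> z; rewrite mulr_ge0 //; lra].
  rewrite Q0; apply: (@le_trans _ _ `| \I_z (Q z) |%E).
    by rewrite -abseN lee_abs.
  apply: (le_trans (le_abse_integral _ _ _)) => //; first exact: measurable_int intQ.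
  apply: (@le_trans _ _ (\I_z (2 * p * (B z * Num.sqrt (S z))))%E).
    apply: (@le_integral3 (fun z => `|Q z|)).
    - by apply: (measurableT_comp (@normr_measurable _ setT)); exact: continuous_measurable3.
    - by apply: measurable_funM.
    - by [].
    - by move=> z; apply: weighted_div_bound => //; lra.
  rewrite integral3Z //; last 2 first.
  - by rewrite mulr_ge0 //; lra.
  - by move=> z; rewrite mulr_ge0 // sqrtr_ge0.
  rewrite [leRHS]EFinM lee_wpmul2l ?lee_fin //; first by rewrite mulr_ge0 //; lra.
  apply: cauchy_schwarz3 => //.
  - exact: measurable_sqrt.
  (* The exponents match: squaring doubles [gam - 1] and [p - 1/2], and
     [2p - 1 = 3 - (2 gam - 2)]. *)
  - apply: le_trans (W f cf fd); rewrite le_eqVlt; apply/orP; left; apply/eqP.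
    apply: eq_integral => z _; rewrite /B exprMn; congr (_ * _)%:E.
      by rewrite expr2 -wtD; congr (wt _ _); ring.
    rewrite -(powR_mulrn 2 (powR_ge0 (f z ^+ 2) (p - 2^-1))) -powRrM; congr (_ `^ _).
    by rewrite /p; field.
  - by under eq_integral do rewrite sqr_sqrtr //.
move: key; rewrite sqrtr1 mulr1.
have g20 : 0 < 2 - gam by lra.
rewrite -lee_pdivlMl // => /le_trans; apply.
by rewrite -EFinM lee_fin le_eqVlt; apply/orP; left; apply/eqP; rewrite -/p; ring.
Qed.

Lemma weighted0 : exists2 C : R, 0 <= C & weighted 0 C.
Proof.
exists ((64 * Num.sqrt 1 ^+ 3) ^+ 2); first exact: sqr_ge0.
move=> f cf fd; apply: le_trans (sobolev cf ler01 fd).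
rewrite le_eqVlt; apply/orP; left; apply/eqP/eq_integral => z _; congr EFin.
by rewrite /wt mul0r oppr0 powRr0 mul1r addr0 powR_mulrn ?sqr_ge0 // -exprM.
Qed.

(** The orbit of 0 under [gam -> 1 + gam/2], the inverse of the map [gam -> 2 gam - 2] of
    [weighted_step]. *)
Definition dyadic (k : nat) : R := 2 - 2 * (2^-1) ^+ k.

Lemma weighted_dyadic k : exists2 C : R, 0 <= C & weighted (dyadic k) C.
Proof.
elim: k => [|k [C C0 W]].
  by rewrite /dyadic expr0 mulr1 subrr; exact: weighted0.
have e0 : 0 < (2^-1 : R) ^+ k by rewrite exprn_gt0 // invr_gt0.
have e1 : (2^-1 : R) ^+ k <= 1 by rewrite exprn_ile1 //; lra.
have dE : dyadic k.+1 = 2 - (2^-1) ^+ k.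
  by rewrite /dyadic exprS; move: (_ ^+ k) => x; field.
have d1 : 1 <= dyadic k.+1 by rewrite dE; lra.
have d2 : dyadic k.+1 < 2 by rewrite dE; lra.
exists (2 * (3 - dyadic k.+1) * (2 - dyadic k.+1)^-1 * Num.sqrt C).
  by rewrite mulr_ge0 ?sqrtr_ge0 // mulr_ge0 // ?invr_ge0; lra.
apply: weighted_step; [exact: d1|exact: d2|exact: C0|]; rewrite (_ : 2 * _ - 2 = dyadic k) //.
by rewrite dE /dyadic; ring.
Qed.

(** Where [f] is nonzero the integrand of index [a] is [f^6 b^a] with [b = wt 1 / f^2]. A power of
    [b] is monotone in its exponent, increasing or decreasing according to the position of [b]
    relative to 1, so the intermediate integrand is at most the sum of the two extreme ones. *)
Lemma weighted_interp (gam gam1 C0 C1 : R) : 0 <= gam -> gam <= gam1 -> gam1 < 2 ->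
  weighted 0 C0 -> weighted gam1 C1 -> weighted gam (C0 + C1).
Proof.
move=> g0 g1 g2 W0 W1 f cf fd.
have mf := C1c_measurable cf.
have mw a : meas (fun z => wt a z * (f z ^+ 2) `^ (3 - a)).
  apply: measurable_funM; first exact: measurable_wt.
  by apply: measurable_powRf; exact: measurable_funX.
have w0 a z : 0 <= wt a z * (f z ^+ 2) `^ (3 - a) by rewrite mulr_ge0 ?wt_ge0 ?powR_ge0.
apply: (@le_trans _ _ (\I_z ((wt 0 z * (f z ^+ 2) `^ (3 - 0)) + wt gam1 z * (f z ^+ 2) `^ (3 - gam1)))%E).
  apply: le_integral3 => //; first exact: measurable_funD.
  move=> z; have [fz|fz] := eqVneq (f z ^+ 2) 0.
    by rewrite {1}fz powR0 ?mulr0 ?addr_ge0 // gt_eqF //; lra.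
  have f2 : 0 < f z ^+ 2 by rewrite lt_neqAle eq_sym fz sqr_ge0.
  pose b := wt 1 z / f z ^+ 2.
  have b0 : 0 < b by rewrite divr_gt0 ?wt_gt0.
  have bE a : wt a z * (f z ^+ 2) `^ (3 - a) = (f z ^+ 2) ^+ 3 * b `^ a.
    rewrite /b powRM ?wt_ge0 ?invr_ge0 ?sqr_ge0 //.
    rewrite powRD; last by rewrite fz implybT.
    rewrite powR_mulrn ?sqr_ge0 // mulrCA; congr (_ * (_ * _)).
      by rewrite /wt -powRrM; congr (_ `^ _); field.
    by rewrite -powR_inv1 ?sqr_ge0 // -powRrM mulN1r.
  rewrite !bE -mulrDr; apply: ler_wpM2l; first by apply: exprn_ge0; exact: sqr_ge0.
  have [b1|b1] := leP 1 b.
    have h : b `^ gam <= b `^ gam1 by exact: ler_powR.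
    by apply: (le_trans h); rewrite lerDr powR_ge0.
  rewrite powRr0; apply: (@le_trans _ _ 1); last by rewrite lerDl powR_ge0.
  have h : b `^ gam <= 1 `^ gam by apply: (ge0_ler_powR g0 _ _ (ltW b1)); rewrite nnegrE ?ler01 ?ltW.
  by rewrite powR1 in h.
rewrite integral3D // EFinD; exact: leeD (W0 f cf fd) (W1 f cf fd).
Qed.

Lemma dyadic_cofinal (gam : R) : gam < 2 -> exists2 k, gam <= dyadic k & dyadic k < 2.
Proof.
move=> g2; have e0 : 0 < (2 - gam) / 2 by lra.
have [k hk] : exists k, (2^-1 : R) ^+ k <= (2 - gam) / 2.
  pose n := (Num.trunc ((2 - gam) / 2)^-1).+1; exists n.
  have hn : ((2 - gam) / 2)^-1 < n%:R by exact: truncnS_gt.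
  rewrite exprVn -[leRHS]invrK lef_pV2 ?posrE ?exprn_gt0 ?invr_gt0 //.
  apply: (le_trans (ltW hn)); rewrite -natrX ler_nat ltnW //.
  exact: ltn_expl.
exists k; rewrite /dyadic; first lra.
have : 0 < (2^-1 : R) ^+ k by rewrite exprn_gt0 // invr_gt0.
lra.
Qed.

Theorem mazya (gam : R) : 0 <= gam -> gam < 2 -> exists2 C : R, 0 <= C & weighted gam C.
Proof.
move=> g0 g2; have [k gk k2] := dyadic_cofinal g2.
have [C0 C00 W0] := weighted0; have [C1 C10 W1] := weighted_dyadic k.
by exists (C0 + C1); [exact: addr_ge0|exact: weighted_interp gk k2 W0 W1].
Qed.

Lemma weighted_scale (gam C : R) : weighted gam C ->
  forall f (N : R), C1c f -> 0 < N -> (dirichlet f <= (N ^+ 2)%:E)%E ->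
  (\I_z (wt gam z * (f z ^+ 2) `^ (3 - gam)) <= (C * (N ^+ 2) `^ (3 - gam))%:E)%E.
Proof.
move=> W f N cf N0 fd.
have N20 : 0 < N ^+ 2 by rewrite exprn_gt0.
have mf := C1c_measurable cf.
have dM (s : R) : is_derive s (1 : R) (fun s => N^-1 * s) N^-1.
  have := @is_deriveZ R R R id N^-1 s 1 1 (is_derive_id s 1).
  by rewrite [_ *: 1]mulr1.
have cfN : C1c (fun z => N^-1 * f z).
  apply: (C1c_comp dM) => //; last by rewrite mulr0.
  by move=> s; exact: cvg_cst.
have dfN : (dirichlet (fun z => (N^-1 * f z)%R) <= 1%:E)%E.
  have [df _ _] := cf.
  rewrite (_ : dirichlet _ = ((N ^+ 2)^-1)%:E * dirichlet f)%E.
    by rewrite lee_pdivrMl // mule1.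
  rewrite /dirichlet -integral3Z.
  - apply: eq_integral => z _; congr EFin; rewrite mulr_sumr; apply: eq_bigr => i _.
    rewrite (@partial_comp (fun s => N^-1 * s) (fun=> N^-1) f dM i z (df z)).
    by rewrite exprMn exprVn.
  - by apply: measurable_sqr_sum => j; exact: C1c_measurable_partial.
  - by rewrite invr_ge0 ltW.
  - by move=> z; apply: sumr_ge0 => i _; rewrite sqr_ge0.
have := W _ cfN dfN.
have -> : (\I_z (wt gam z * ((N^-1 * f z) ^+ 2) `^ (3 - gam)) =
   (((N ^+ 2) `^ (3 - gam))^-1)%:E * \I_z (wt gam z * (f z ^+ 2) `^ (3 - gam)))%E.
  rewrite -integral3Z.
  - apply: eq_integral => z _; congr EFin.
    rewrite exprMn exprVn powRM ?invr_ge0 ?sqr_ge0 //.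
    rewrite -[in LHS]powR_inv1 ?sqr_ge0 // -powRrM mulN1r powRN.
    by rewrite mulrCA.
  - apply: measurable_funM; first exact: measurable_wt.
    by apply: measurable_powRf; exact: measurable_funX.
  - by rewrite invr_ge0 powR_ge0.
  - by move=> z; rewrite mulr_ge0 ?wt_ge0 ?powR_ge0.
by rewrite lee_pdivrMl ?powR_gt0 // -EFinM [X in _ -> (_ <= X%:E)%E]mulrC.
Qed.

(** * Smooth test functions *)

Section smooth_closure.
Implicit Types (T : R -> R).

(** Recursion on the innermost derivative, whereas [smooth3] unfolds from the outermost one. In this
    form the product and chain rules are proved by induction on the order. *)
Fixpoint Cn (n : nat) f : Prop :=
  (forall z, differentiable f z) /\
  if n is m.+1 then forall i, Cn m (partial i f) else True.

Lemma iter_partial_rcons l i f : iter_partial (rcons l i) f = iter_partial l (partial i f).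
Proof. by elim: l => //= j l ->. Qed.

Lemma smooth3P f : smooth3 f <-> forall n, Cn n f.
Proof.
split.
  move=> sf n; elim: n f sf => [|n IH] f sf /=; split => //; try exact: (sf [::]).
  by move=> i; apply: IH => l z; have := sf (rcons l i) z; rewrite iter_partial_rcons.
move=> cf l; elim/last_ind: l f cf => [|l i IH] f cf z; first exact: (cf 0%N).1.
by rewrite iter_partial_rcons; apply: IH => n; have [_] := cf n.+1; apply.
Qed.

Lemma Cn_diff n f : Cn n f -> forall z, differentiable f z.
Proof. by case: n => [|n] []. Qed.

Lemma Cn_pred n f : Cn n.+1 f -> Cn n f.
Proof.
elim: n f => [|n IH] f [df pf]; split => //.
by move=> i; apply: IH; exact: pf.
Qed.

Lemma Cn_cst n (c : R) : Cn n (cst c : T3 -> R).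
Proof.
elim: n c => [|n IH] c; split => //; try by move=> z; exact: differentiable_cst.
move=> i; rewrite (_ : partial i (cst c) = cst 0) //.
by apply/funext => z; rewrite /partial derive_cst.
Qed.

Lemma partialD i f g z : differentiable f z -> differentiable g z ->
  partial i (fun z => f z + g z) z = partial i f z + partial i g z.
Proof.
move=> df dg; have := @deriveD R T3 R f g z (evec R i) (diff_derivable df) (diff_derivable dg).
by rewrite /partial => ->.
Qed.

Lemma CnD n f g : Cn n f -> Cn n g -> Cn n (fun z => f z + g z).
Proof.
elim: n f g => [|n IH] f g [df pf] [dg pg]; split => //;
  try by move=> z; exact: differentiableD.
move=> i; rewrite (_ : partial i _ = fun z => partial i f z + partial i g z).
  by apply: IH; [exact: pf|exact: pg].
by apply/funext => z; exact: partialD.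
Qed.

Lemma CnM n f g : Cn n f -> Cn n g -> Cn n (fun z => f z * g z).
Proof.
elim: n f g => [|n IH] f g cf cg.
  by case: cf cg => df _ [dg _]; split => // z; exact: differentiableM.
have cf' := Cn_pred cf; have cg' := Cn_pred cg.
case: cf cg => df pf [dg pg]; split => [z|i]; first exact: differentiableM.
rewrite (_ : partial i _ = fun z => f z * partial i g z + g z * partial i f z).
  by apply: CnD; apply: IH => //; [exact: pg|exact: pf].
by apply/funext => z; exact: partialM.
Qed.

Lemma Cn_coord n i : Cn n (@coord i).
Proof.
have [[d _] p] := coord_C1 i; case: n => [|n]; split => // j.
by rewrite (_ : partial j _ = cst (i == j)%:R); [exact: Cn_cst|apply/funext].
Qed.

(** The one-variable counterpart of [Cn]; the derivative is a witness, so each closure property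
    exhibits it by formula. *)
Fixpoint D1 (n : nat) T : Prop := exists T' : R -> R,
  (forall s : R, is_derive s (1 : R) T (T' s)) /\ if n is m.+1 then D1 m T' else True.

Lemma D1_pred n T : D1 n.+1 T -> D1 n T.
Proof.
elim: n T => [|n IH] T [T' [dT h]]; exists T'; split => //.
exact: IH.
Qed.

Lemma D1_cst n (c : R) : D1 n (cst c).
Proof.
elim: n c => [|n IH] c; exists (cst 0); split => //; move=> s; exact: is_derive_cst.
Qed.

Lemma D1_id n : D1 n id.
Proof.
case: n => [|n]; exists (cst 1); split => //; try (move=> s; exact: is_derive_id).
exact: D1_cst.
Qed.

Lemma is_deriveD1 (f g : R -> R) (s a b : R) : is_derive s (1 : R) f a ->
  is_derive s (1 : R) g b -> is_derive s (1 : R) (fun s => f s + g s) (a + b).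
Proof. by move=> df dg; exact: (@is_deriveD R R R f g s 1 a b df dg). Qed.

Lemma is_deriveM1 (f g : R -> R) (s a b : R) : is_derive s (1 : R) f a ->
  is_derive s (1 : R) g b -> is_derive s (1 : R) (fun s => f s * g s) (f s * b + g s * a).
Proof. by move=> df dg; exact: (@is_deriveM R R f g s 1 a b df dg). Qed.

Lemma D1D n S T : D1 n S -> D1 n T -> D1 n (fun s => S s + T s).
Proof.
elim: n S T => [|n IH] S T [S' [dS hS]] [T' [dT hT]];
  exists (fun s => S' s + T' s); split => //; try (by move=> s; exact: is_deriveD1).
exact: IH.
Qed.

Lemma D1M n S T : D1 n S -> D1 n T -> D1 n (fun s => S s * T s).
Proof.
elim: n S T => [|n IH] S T cS cT.
  case: cS cT => [S' [dS _]] [T' [dT _]]; exists (fun s => S s * T' s + T s * S' s).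
  by split => // s; exact: is_deriveM1.
have cS' := D1_pred cS; have cT' := D1_pred cT.
case: cS cT => [S' [dS hS]] [T' [dT hT]]; exists (fun s => S s * T' s + T s * S' s).
split; first by move=> s; exact: is_deriveM1.
by apply: D1D; exact: IH.
Qed.

Lemma D1_comp n S T : D1 n S -> D1 n T -> D1 n (fun s => S (T s)).
Proof.
elim: n S T => [|n IH] S T cS cT.
  case: cS cT => [S' [dS _]] [T' [dT _]]; exists (fun s => S' (T s) * T' s).
  by split => // s; exact: is_derive1_comp.
have cT' := D1_pred cT.
case: cS cT => [S' [dS hS]] [T' [dT hT]]; exists (fun s => S' (T s) * T' s).
split; first by move=> s; exact: is_derive1_comp.
by apply: D1M => //; exact: IH.
Qed.

Lemma Cn_comp n T f : D1 n T -> Cn n f -> Cn n (fun z => T (f z)).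
Proof.
elim: n T f => [|n IH] T f cT cf.
  case: cT cf => [T' [dT _]] [df _]; split => // z.
  exact: (differentiable_comp3 dT (df z)).
have cf' := Cn_pred cf.
case: cT cf => [T' [dT hT]] [df pf]; split => [z|i].
  exact: (differentiable_comp3 dT (df z)).
rewrite (_ : partial i _ = fun z => T' (f z) * partial i f z).
  by apply: CnM; [exact: IH|exact: pf].
by apply/funext => z; exact: (@partial_comp T T' f dT i z (df z)).
Qed.

Lemma is_derive_regular_power (e nu s : R) : 0 < e ->
  is_derive s (1 : R) (fun s => (e + s ^+ 2) `^ nu) (nu * (e + s ^+ 2) `^ (nu - 1) * (2 * s)).
Proof.
move=> e0; have p : 0 < e + s ^+ 2 by rewrite ltr_wpDr // sqr_ge0.
have di : is_derive s (1 : R) (fun s => e + s ^+ 2) (0 + 2 * s ^+ 1).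
  exact: (is_deriveD1 (is_derive_cst e s 1) (is_derive_exprnS 1 s)).
have := @is_derive1_comp R (fun x => x `^ nu) (fun s => e + s ^+ 2) s _ _
  (is_derive1_powR nu p) di.
by rewrite add0r expr1.
Qed.

Lemma D1_regular_power n (e nu : R) : 0 < e -> D1 n (fun s => (e + s ^+ 2) `^ nu).
Proof.
move=> e0; have d (b s : R) := is_derive_regular_power b s e0.
elim: n nu => [|n IH] nu; exists (fun s => nu * (e + s ^+ 2) `^ (nu - 1) * (2 * s)); split => //.
apply: D1M; last by apply: D1M; [exact: D1_cst|exact: D1_id].
by apply: D1M; [exact: D1_cst|exact: IH].
Qed.

(** * Flat functions and bumps *)

Lemma is_derive_near (f g : R -> R) (s d : R) : {near s, f =1 g} ->
  is_derive s (1 : R) f d -> is_derive s (1 : R) g d.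
Proof.
move=> fg [df Df]; split; first exact: near_eq_derivable df.
by rewrite -Df; apply: near_eq_derive; apply: filterS fg.
Qed.

Lemma is_derive0_quadratic (f : R -> R) (C : R) : (forall s, `|f s| <= C * s ^+ 2) ->
  is_derive (0 : R) (1 : R) f 0.
Proof.
move=> fC; have f0 : f 0 = 0.
  by apply/eqP; rewrite -normr_le0; apply: le_trans (fC 0) _; rewrite expr0n /= mulr0.
have H : h^-1 *: (f (h *: 1 + 0) - f 0) @[h --> 0^'] --> (0 : R).
  apply/cvgrPdist_le => e e0; near=> h.
  have h0 : h != 0 by near: h; exact: nbhs_dnbhs_neq.
  have hp : 0 < `|h| by rewrite normr_gt0.
  rewrite sub0r normrN f0 subr0 addr0 [h *: 1]mulr1 normrM normfV ler_pdivrMl //.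
  apply: (le_trans (fC h)); rewrite -real_normK ?num_real // expr2 mulrA mulrC.
  rewrite ler_pM2l //; apply: (@le_trans _ _ ((`|C| + 1) * `|h|)).
    by rewrite ler_wpM2r // (le_trans (ler_norm _)) // lerDl.
  rewrite -ler_pdivlMl; last by rewrite ltr_wpDl.
  near: h; apply: dnbhs0_le.
  by rewrite mulr_gt0 // invr_gt0 ltr_wpDl.
split; first by apply/cvg_ex; exists 0.
exact: cvg_lim H.
Unshelve. all: by end_near. Qed.

(** The flat function [exp(-k/s)] is the case [j = 0]. The powers of [1/s] make the family stable
    under differentiation, the derivative of the member [j] combining the members [j + 1] and
    [j + 2]. *)
Definition ebump (k : R) (j : nat) (s : R) : R :=
  if 0 < s then s^-1 ^+ j * expR (- (k * s^-1)) else 0.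

Lemma ebump_ge0 k j s : 0 <= ebump k j s.
Proof.
rewrite /ebump; case: ifP => // s0.
by rewrite mulr_ge0 ?expR_ge0 // exprn_ge0 // invr_ge0 ltW.
Qed.

(** The exponential of [k/s] dominates the term of order [j + 2] of its series, which beats the
    factor [s^-j] by [s^2]. This is what gives differentiability at 0. *)
Lemma ebump_quadratic k j s : 0 < k ->
  `|ebump k j s| <= (j.+2)`!%:R / k ^+ j.+2 * s ^+ 2.
Proof.
move=> k0; rewrite /ebump; case: ifP => s0; last first.
  by rewrite normr0 mulr_ge0 ?sqr_ge0 // divr_ge0 // exprn_ge0 // ltW.
have fp : (0 : R) < (j.+2)`!%:R by rewrite ltr0n fact_gt0.
have v0 : 0 < s^-1 by rewrite invr_gt0.
rewrite ger0_norm; last by rewrite mulr_ge0 ?expR_ge0 // exprn_ge0 // ltW.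
have h := @expR_ge1Dxn R (k * s^-1) j.+1 (mulr_ge0 (ltW k0) (ltW v0)).
have h2 : (k * s^-1) ^+ j.+2 / (j.+2)`!%:R <= expR (k * s^-1).
  by apply: le_trans h; rewrite lerDr.
have p0 : 0 < (k * s^-1) ^+ j.+2 / (j.+2)`!%:R by rewrite divr_gt0 // exprn_gt0 // mulr_gt0.
rewrite expRN; apply: (@le_trans _ _ (s^-1 ^+ j * ((k * s^-1) ^+ j.+2 / (j.+2)`!%:R)^-1)).
  rewrite ler_wpM2l //; first by rewrite exprn_ge0 // ltW.
  by rewrite lef_pV2 // posrE expR_gt0.
have s1 : s^-1 ^+ j != 0 by rewrite expf_neq0 // gt_eqF.
have k1 : k ^+ j.+2 != 0 by rewrite expf_neq0 // gt_eqF.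
have -> : (k * s^-1) ^+ j.+2 = k ^+ j.+2 * (s^-1 ^+ j * s^-1 ^+ 2).
  by rewrite exprMn -(exprD _ j 2) addn2.
move: (gt_eqF fp) (gt_eqF s0) s1 k1.
move: (s^-1 ^+ j) (k ^+ j.+2) (_`!%:R) => a b c hc hs ha hb.
rewrite le_eqVlt; apply/orP; left; apply/eqP; clear - ha hb hc hs.
by field; rewrite ha hb hs hc.
Qed.

Lemma is_derive_ebump k j (s : R) : 0 < k ->
  is_derive s (1 : R) (ebump k j) (- j%:R * ebump k j.+1 s + k * ebump k j.+2 s).
Proof.
move=> k0; have [s0|s0|<-] := ltgtP 0 s.
- have dV : is_derive s (1 : R) (fun s => s^-1) (- s^-1 ^+ 2).
    split; first by apply: (@derivableV R R id s 1); [exact: lt0r_neq0|exact: derivable_id].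
    rewrite (@deriveV R R id s 1 (lt0r_neq0 s0)); last exact: derivable_id.
    by rewrite derive_id [_ *: 1]mulr1 exprVn.
  have dE : is_derive s (1 : R) (fun s => expR (- k * s^-1)) (expR (- k * s^-1) * (- k * - s^-1 ^+ 2)).
    have dkV : is_derive s (1 : R) (fun s => - k * s^-1) (- k * - s^-1 ^+ 2).
      exact: (@is_deriveZ R R R (fun s => s^-1) (- k) s 1 _ dV).
    exact: (@is_derive1_comp R expR (fun s => - k * s^-1) s _ _ (is_derive_expR _) dkV).
  have dX : is_derive s (1 : R) (fun s => s^-1 ^+ j) (- j%:R * s^-1 ^+ j.+1).
    case: j => [|j].
      by rewrite oppr0 mul0r; have := is_derive_cst (1 : R) s (1 : R).
    have := @is_derive1_comp R (fun x => x ^+ j.+1) (fun s => s^-1) s _ _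
      (is_derive_exprnS j _) dV.
    by rewrite mulrN mulNr -mulrA -exprD addn2.
  have := is_deriveM1 dX dE.
  rewrite (_ : _ + _ = - j%:R * ebump k j.+1 s + k * ebump k j.+2 s); last first.
    have ek : - (k * s^-1) = - k * s^-1 by rewrite mulNr.
    rewrite /ebump s0 !exprS ek {ek}; move: (s^-1 ^+ j) (s^-1) (expR _) (j%:R).
    by clear => a b c d; ring.
  apply: is_derive_near; near=> t.
  have t0 : 0 < t by near: t; exact: lt_nbhsr.
  by rewrite /ebump t0 mulNr.
- rewrite /ebump !(lt_gtF s0) !mulr0 addr0.
  have := is_derive_cst (0 : R) s (1 : R).
  apply: is_derive_near; near=> t.
  have t0 : t < 0 by near: t; exact: lt_nbhsl.
  by rewrite /= (lt_gtF t0).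
- rewrite /ebump ltxx !mulr0 addr0.
  by apply: is_derive0_quadratic => s'; exact: ebump_quadratic.
Unshelve. all: by end_near. Qed.

Lemma D1_ebump n k j : 0 < k -> D1 n (ebump k j).
Proof.
move=> k0; elim: n j => [|n IH] j; exists (fun s => - j%:R * ebump k j.+1 s + k * ebump k j.+2 s);
  split => //; try (by move=> s; exact: is_derive_ebump).
by apply: D1D; apply: D1M; first [exact: D1_cst|exact: IH].
Qed.

End smooth_closure.

(** Smooth, and bounded by the indicator of the open interval, to which it converges as [k] tends to
    0. It thus gives access to indicators of boxes through test functions. *)
Definition bump (k al be s : R) : R := ebump k 0 (s - al) * ebump k 0 (be - s).

Lemma D1_affine n (c d : R) : D1 n (fun s => c * s + d).
Proof. by apply: D1D; [apply: D1M; [exact: D1_cst|exact: D1_id]|exact: D1_cst]. Qed.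

Lemma D1_bump n k al be : 0 < k -> D1 n (bump k al be).
Proof.
move=> k0; apply: D1M.
  have -> : (fun s => ebump k 0 (s - al)) = fun s => ebump k 0 (1 * s + - al).
    by apply/funext => s; rewrite mul1r.
  by apply: (@D1_comp n _ (fun s => 1 * s + - al)); [exact: D1_ebump|exact: D1_affine].
have -> : (fun s => ebump k 0 (be - s)) = fun s => ebump k 0 (-1 * s + be).
  by apply/funext => s; rewrite mulN1r addrC.
by apply: (@D1_comp n _ (fun s => -1 * s + be)); [exact: D1_ebump|exact: D1_affine].
Qed.

Lemma ebump0_le1 (k s : R) : 0 < k -> ebump k 0 s <= 1.
Proof.
move=> k0; rewrite /ebump; case: ifP => // s0.
by rewrite expr0 mul1r -[leRHS]expR0 ler_expR oppr_le0 mulr_ge0 // ?invr_ge0 ltW.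
Qed.

Lemma bump_ge0 (k al be s : R) : 0 <= bump k al be s.
Proof. by rewrite mulr_ge0 // ebump_ge0. Qed.

Lemma bump_le1 (k al be s : R) : 0 < k -> bump k al be s <= 1.
Proof. by move=> k0; rewrite mulr_ile1 // ?ebump_ge0 ?ebump0_le1. Qed.

Lemma bump_out (k al be s : R) : ~~ (al < s < be) -> bump k al be s = 0.
Proof.
rewrite negb_and -!leNgt => /orP[h|h]; rewrite /bump /ebump.
  by rewrite (_ : 0 < s - al = false) ?mul0r // subr_gt0 ltNge h.
by rewrite (_ : 0 < be - s = false) ?mulr0 // subr_gt0 ltNge h.
Qed.

Lemma D1_continuous T : D1 0 T -> continuous (T : R -> R).
Proof.
move=> [T' [dT _]] s; apply: differentiable_continuous; apply/derivable1_diffP.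
by have [] := dT s.
Qed.

Lemma bump_continuous (k al be : R) : 0 < k -> continuous (bump k al be).
Proof. by move=> k0; apply: D1_continuous; exact: D1_bump. Qed.

Lemma ebump0_cvg (s : R) : 0 < s -> (fun m : nat => ebump m.+1%:R^-1 0 s) @ \oo --> (1 : R).
Proof.
move=> s0; rewrite /ebump s0.
have c : (fun m : nat => - (m.+1%:R^-1 * s^-1)) @ \oo --> (0 : R).
  rewrite -oppr0 -(mul0r s^-1); apply: cvgN; apply: cvgMl.
  exact: cvg_harmonic.
have := cvg_comp _ _ c (@continuous_expR R 0).
rewrite expR0; apply: cvg_trans; apply: near_eq_cvg.
by near=> m; rewrite /= expr0 mul1r.
Unshelve. all: by end_near. Qed.

Lemma bump_cvg (al be s : R) :
  (fun m : nat => bump m.+1%:R^-1 al be s) @ \oo --> ((al < s < be)%R%:R : R).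
Proof.
have [/andP[h1 h2]|h] := boolP (al < s < be).
  rewrite -[(true%:R : R)]mulr1; apply: cvgM; apply: ebump0_cvg; lra.
rewrite (_ : (fun m : nat => _) = cst 0); first exact: cvg_cst.
by apply/funext => m; rewrite bump_out.
Qed.

(** The antiderivative has no compact support, but it is constant on either side, so the difference
    of two of its translates has. *)
Lemma antiderivative (a : R -> R) (al be : R) : continuous a ->
  (forall s, ~~ (al < s < be) -> a s = 0) ->
  exists A : R -> R, [/\ forall s : R, is_derive s (1 : R) A (a s),
    forall s, s <= al -> A s = 0 & exists c, forall s, be <= s -> A s = c].
Proof.
move=> ca a0.
have ma : meas a by exact: continuous_measurable_fun.
have iab : lam.-integrable `[al, be] (EFin \o a).
  by apply: continuous_compact_integrable; [exact: segment_compact|exact: continuous_subspaceT].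
have ia : lam.-integrable setT (EFin \o a).
  have h : lam.-integrable (setT `&` `[al, be]) (EFin \o a) by rewrite setTI.
  have := (integrable_restrict lam (measurable_itv `[al, be]) measurableT (EFin \o a)).1 h.
  rewrite (_ : (EFin \o a) \_ `[al, be] = EFin \o a) //; apply/funext => t.
  rewrite patchE; case: ifPn => // /negP; rewrite inE /= in_itv /= => tab.
  by rewrite a0 //; apply/negP => /andP[t1 t2]; apply: tab; rewrite !ltW.
have iu u : lam.-integrable `]-oo, u] (EFin \o a) by apply: integrableS ia.
pose A x := (\int[lam]_(t in `]-oo, x]) a t)%R.
exists A; split.
- have ltNy_ (x : R) : (-oo%O < BRight x)%E by rewrite ltNyr.
  move=> s; have s1 : s < s + 1 by rewrite ltrDl.
  have [dA] := @continuous_FTC1 R a -oo%O s (s + 1) s1 (iu _) (ltNy_ s) (ca s).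
  by rewrite derive1E => eA; split.
- move=> s sa; rewrite /A /Rintegral integral0_eq // => t /=; rewrite in_itv /= => ts.
  by rewrite a0 // negb_and -!leNgt (le_trans ts sa).
exists (A be) => s bs; rewrite /A /Rintegral; congr fine.
rewrite integral_mkcond [RHS]integral_mkcond; apply: eq_integral => t _.
have memE (c : R) : (t \in `]-oo, c]%classic) = (t <= c).
  by apply/idP/idP; rewrite inE /= in_itv.
rewrite !patchE !memE.
have [tb|tb] := leP t be; first by rewrite (le_trans tb bs).
by rewrite a0 ?if_same // negb_and -!leNgt (ltW tb) orbT.
Qed.

(** On a set of finite volume the first term is charged to the volume and the second to the [L^6]
    norm. This makes [L^6] functions locally integrable, with a free small parameter. *)
Lemma young6 (eta x : R) : 0 < eta -> `|x| <= eta + (eta ^+ 5)^-1 * x ^+ 6.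
Proof.
move=> e0; have e5 : 0 < eta ^+ 5 by rewrite exprn_gt0.
have x6 : 0 <= x ^+ 6 by rewrite exprn_even_ge0.
have [xe|ex] := leP `|x| eta.
  by apply: (le_trans xe); rewrite lerDl mulr_ge0 // invr_ge0 ltW.
apply: (@le_trans _ _ ((eta ^+ 5)^-1 * x ^+ 6)); last by rewrite lerDr ltW.
rewrite ler_pdivlMl // -(ger0_norm x6) normrX [leRHS]exprSr ler_wpM2r //.
by rewrite lerXn2r // ?nnegrE ltW.
Qed.

Definition prod3 (a b c : R -> R) (z : T3) : R := a z.1.1 * (b z.1.2 * c z.2).

Lemma prod3_test (a a' b c : R -> R) (K : R) :
  (forall n, D1 n a) -> (forall n, D1 n b) -> (forall n, D1 n c) ->
  (forall s : R, is_derive s (1 : R) a (a' s)) ->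
  (forall s, K < `|s| -> [/\ a s = 0, b s = 0 & c s = 0]) ->
  test_fun3 (prod3 a b c) /\
  forall z, partial i0 (prod3 a b c) z = prod3 a' b c z.
Proof.
move=> da db dc daa' h0.
have pE : prod3 a b c = fun z => a (coord i0 z) * (b (coord i1 z) * c (coord i2 z)) by [].
have Cb n : Cn n (fun z : T3 => b (coord i1 z)).
  by apply: (@Cn_comp n b (coord i1)) => //; exact: Cn_coord.
have Cc n : Cn n (fun z : T3 => c (coord i2 z)).
  by apply: (@Cn_comp n c (coord i2)) => //; exact: Cn_coord.
have Ca n : Cn n (fun z : T3 => a (coord i0 z)).
  by apply: (@Cn_comp n a (coord i0)) => //; exact: Cn_coord.
split; first split.
- apply/smooth3P => n; rewrite pE; apply: (CnM (Ca n)); exact: CnM (Cb n) (Cc n).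
- exists K => -[[x y] z]; rewrite /prod3 /= !prod_normE /= !lt_max => /orP[/orP[]|] h.
  + by have [-> _ _] := h0 _ h; rewrite mul0r.
  + by have [_ -> _] := h0 _ h; rewrite mul0r mulr0.
  + by have [_ _ ->] := h0 _ h; rewrite !mulr0.
move=> z; rewrite pE.
have dz := Cn_diff (Ca 0%N) z; have dy := Cn_diff (Cb 0%N) z; have dw := Cn_diff (Cc 0%N) z.
have dyw : differentiable (fun z : T3 => b (coord i1 z) * c (coord i2 z)) z by exact: differentiableM.
rewrite (partialM _ dz dyw) (partialM _ dy dw).
have pc (T : R -> R) i : (forall n, D1 n T) -> exists T' : R, partial i0 (fun z : T3 => T (coord i z)) z = T' * (i == i0)%:R.
  move=> /(_ 0%N) [T' [dT _]]; exists (T' (coord i z)).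
  have [[d _] p] := coord_C1 i.
  by rewrite (@partial_comp T T' (coord i) dT i0 z (d z)) p.
have [b' ->] := pc b i1 db; have [c' ->] := pc c i2 dc.
have [[d0 _] p0] := coord_C1 i0.
rewrite (@partial_comp a a' (coord i0) daa' i0 z (d0 z)) p0 /= /prod3 /coord /=.
by move: (a' _) (a _) (b _) (c _) => p1 p2 p3 p4; clear; ring.
Qed.

(** * Pairing an [L^6] function with bumps and their translates *)

Section w.
Variables (w : T3 -> R).
Hypotheses (mw : meas w) (w6 : (\I_z (w z ^+ 6) < +oo)%E).

Let mw6 : meas (fun z => w z ^+ 6). Proof. exact: measurable_funX. Qed.
Let w60 z : 0 <= w z ^+ 6. Proof. by rewrite exprn_even_ge0. Qed.

Lemma integral_norm_mul_le (k : T3 -> R) (B : set T3) (eta : R) : 0 < eta ->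
  meas k -> measurable B -> (forall z, `|k z| <= \1_B z) ->
  (\int[mu3]_z `|w z * k z|%:E <= eta%:E * mu3 B +
     ((eta ^+ 5)^-1)%:E * \I_z (w z ^+ 6 * \1_B z))%E.
Proof.
move=> e0 mk mB kB.
have e5 : 0 <= (eta ^+ 5)^-1 by rewrite invr_ge0 exprn_ge0 // ltW.
have m1 : meas (\1_B : T3 -> R) by exact: measurable_indic.
have b0 z : 0 <= (\1_B z : R) by rewrite indicE.
have mwB : meas (fun z => w z ^+ 6 * \1_B z) by exact: measurable_funM.
have -> : (mu3 B = \I_z (\1_B z))%E by rewrite integral_indic // setIT.
rewrite -integral3Z //; last exact: ltW.
rewrite -integral3Z //; last by move=> z; rewrite mulr_ge0.
have hm1 : meas (fun z => eta * \1_B z : R) by apply: measurable_funM.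
have hm2 : meas (fun z => (eta ^+ 5)^-1 * (w z ^+ 6 * \1_B z)) by apply: measurable_funM.
have hp1 z : 0 <= eta * \1_B z by rewrite mulr_ge0 // ltW.
have hp2 z : 0 <= (eta ^+ 5)^-1 * (w z ^+ 6 * \1_B z) by rewrite mulr_ge0 // mulr_ge0.
rewrite -(integral3D hm1 hm2 hp1 hp2).
apply: (@le_integral3 (fun z => `|w z * k z|)).
- apply: (measurableT_comp (@normr_measurable _ setT)); exact: measurable_funM.
- exact: measurable_funD.
- by [].
- move=> z; rewrite normrM; apply: (le_trans (ler_wpM2l (normr_ge0 _) (kB z))).
  rewrite mulrA -mulrDl ler_wpM2r //; exact: young6.
Qed.

Lemma integrable_mul_bounded (k : T3 -> R) (M C : R) : 0 <= C ->
  meas k -> (forall z, `|k z| <= C) ->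
  (forall z : T3, M < `|z| -> k z = 0) ->
  mu3.-integrable setT (EFin \o (fun z => w z * k z)).
Proof.
move=> C0 mk kC k0.
have mB := measurable_cube M.
have m1 : meas (\1_(cube M) : T3 -> R) by exact: measurable_indic.
have b0 z : 0 <= (\1_(cube M) z : R) by rewrite indicE.
apply: (@le_integrable3 _ (fun z => C * (\1_(cube M) z + w z ^+ 6))).
- exact: measurable_funM.
- by apply: measurable_funM => //; exact: measurable_funD.
- move=> z /=; rewrite normrM.
  have [zM|zM] := leP `|z| M.
    rewrite indicE mem_set /=; last exact/cubeP.
    have := @young6 1 (w z) ltr01; rewrite expr1n invr1 mul1r => h.
    by rewrite mulrC; apply: ler_pM.
  by rewrite k0 // normr0 mulr0 mulr_ge0 // addr_ge0.
rewrite integral3Z //; [|exact: measurable_funD|by move=> z; rewrite addr_ge0].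
rewrite integral3D // integral_indic // setIT.
rewrite lte_mul_pinfty ?lee_fin //.
by rewrite lte_add_pinfty // cube_lty.
Qed.

Definition box (a1 b1 a2 b2 a3 b3 : R) : set T3 := (`]a1, b1[ `*` `]a2, b2[) `*` `]a3, b3[.

Lemma measurable_box a1 b1 a2 b2 a3 b3 : measurable (box a1 b1 a2 b2 a3 b3).
Proof. by apply: measurableX => //; exact: measurableX. Qed.

Lemma box_volume a1 b1 a2 b2 a3 b3 : exists2 V : R, 0 <= V &
  forall t : R, mu3 (box (a1 + t) (b1 + t) a2 b2 a3 b3) = V%:E.
Proof.
have I (a b : R) : lam `]a, b[ = (Num.max 0 (b - a))%:E.
  rewrite lebesgue_measure_itv /= lte_fin; case: ltP => ab.
    by rewrite -EFinB max_r // subr_ge0 ltW.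
  by rewrite max_l // subr_le0.
exists (Num.max 0 (b1 - a1) * Num.max 0 (b2 - a2) * Num.max 0 (b3 - a3)).
  by rewrite !mulr_ge0 // le_max lexx.
move=> t.
have h2 : ((lam \x lam) (`](a1 + t)%R, (b1 + t)%R[ `*` `]a2, b2[) =
    lam `](a1 + t)%R, (b1 + t)%R[ * lam `]a2, b2[)%E by exact: product_measure1E.
have -> : (mu3 (box (a1 + t) (b1 + t) a2 b2 a3 b3) =
    lam `](a1 + t)%R, (b1 + t)%R[ * lam `]a2, b2[ * lam `]a3, b3[)%E.
  by rewrite -h2; apply: product_measure1E => //; exact: measurableX.
by rewrite !I -!EFinM (_ : b1 + t - (a1 + t) = b1 - a1) //; lra.
Qed.

Hypothesis Hw : forall psi, test_fun3 psi ->
  (\I_z (w z * partial i0 psi z) = 0)%E.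

Lemma sube0_fin_eq (x y : \bar R) : x \is a fin_num -> y \is a fin_num ->
  (x - y = 0)%E -> x = y.
Proof. by case: x y => [x||] [y||] //= _ _ [] /eqP; rewrite subr_eq0 => /eqP ->. Qed.

Lemma eq_integral_of_sub0 f g : mu3.-integrable setT (EFin \o f) ->
  mu3.-integrable setT (EFin \o g) -> (\I_z (f z - g z) = 0)%E ->
  (\I_z (f z) = \I_z (g z))%E.
Proof.
move=> i1 i2 h; have f1 := integrable_fin_num measurableT i1.
have f2 := integrable_fin_num measurableT i2.
apply: (sube0_fin_eq f1 f2); rewrite -[RHS]h.
exact: (esym (integralB measurableT i1 i2)).
Qed.

Lemma cvge0_exists_le (t : nat -> \bar R) (e : R) : t @ \oo --> 0%E -> 0 < e ->
  exists n, (t n <= e%:E)%E.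
Proof.
move=> t0 e0; apply: contrapT => /forallNP h.
have h' : \forall n \near \oo, (e%:E <= t n)%E.
  by apply: nearW => n; rewrite leNgt; apply/negP => /ltW; exact: h.
have h2 : (e%:E <= 0)%E by exact: (cvge_to_ge t0 h').
by move: h2; rewrite lee_fin leNgt e0.
Qed.

Lemma le0_all_eta (x V : R) : 0 <= V -> (forall eta, 0 < eta -> `|x| <= eta * V) -> x = 0.
Proof.
move=> V0 h; apply/eqP; rewrite -normr_le0 leNgt; apply/negP => x0.
have V1 : 0 < V + 1 by lra.
have := h (`|x| / (V + 1)) (divr_gt0 x0 V1).
rewrite mulrAC ler_pdivlMr // ler_pM2l //; lra.
Qed.

(** The difference between the bump and its translate by [n] along the first axis is a partial
    derivative of a test function, so both have the same integral against [w]. The translates live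
    in boxes of fixed volume that escape to infinity, where the [L^6] mass of [w] tends to 0. *)
Lemma integral_translate0 (a1 b1 a2 b2 a3 b3 k : R) : 0 < k ->
  (\I_z (w z * prod3 (bump k a1 b1) (bump k a2 b2) (bump k a3 b3) z) = 0)%E.
Proof.
move=> k0; set a := bump k a1 b1; set b := bump k a2 b2; set c := bump k a3 b3.
have ca : continuous a by exact: bump_continuous.
have cb : continuous b by exact: bump_continuous.
have cc : continuous c by exact: bump_continuous.
have a_out s : ~~ (a1 < s < b1) -> a s = 0 by exact: bump_out.
have b_out s : ~~ (a2 < s < b2) -> b s = 0 by exact: bump_out.
have c_out s : ~~ (a3 < s < b3) -> c s = 0 by exact: bump_out.
have [A [dA A0 [cA A1]]] := antiderivative ca a_out.
have DA m : D1 m A by apply: D1_pred; exists a; split => //; exact: D1_bump.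
pose a_ (n : nat) s := a (s + - n%:R).
have ca_ n : continuous (a_ n).
  apply: D1_continuous; apply: (@D1_comp 0 a (fun s => s + - n%:R)); first exact: D1_bump.
  by apply: D1D; [exact: D1_id|exact: D1_cst].
pose N : R := `|a1| + `|b1| + `|a2| + `|b2| + `|a3| + `|b3|.
have bnd (s x y e : R) : `|x| + `|y| + e <= `|s| -> 0 < e -> ~~ (x < s < y).
  move=> h e0; apply/negP => /andP[xs sy].
  have := ler_norm y; have := ler_norm (- x); rewrite normrN.
  by case: (lerP 0 s) => s0; [move: h; rewrite (ger0_norm s0)|move: h; rewrite (ltr0_norm s0)];
    have := normr_ge0 x; have := normr_ge0 y; lra.
have sup (s t : R) : 0 <= t -> N + t + 1 <= `|s| -> [/\ a (s - t) = 0, a s = 0, b s = 0 & c s = 0].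
  move=> t0 h.
  have h' : N + 1 <= `|s - t|.
    by have := ler_normD (s - t) t; rewrite subrK (ger0_norm t0); lra.
  have h'' : N + 1 <= `|s| by lra.
  move: h' h''; rewrite /N => h1 h2; have := normr_ge0 a1; have := normr_ge0 b1;
  have := normr_ge0 a2; have := normr_ge0 b2; have := normr_ge0 a3; have := normr_ge0 b3.
  move=> p1 p2 p3 p4 p5 p6; split; [apply: a_out|apply: a_out|apply: b_out|apply: c_out];
  apply: (bnd _ _ _ 1) => //; lra.
have cp (a' : R -> R) : continuous a' -> continuous (prod3 a' b c).
  move=> ca'.
  have k1 (h : R -> R) i : continuous h -> continuous (fun z => h (coord i z) : R).
    move=> ch z; apply: (@continuous_comp T3 R R (coord i) h z); last exact: ch.
    by apply: C1_continuous; have [] := coord_C1 i.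
  move=> z; apply: cvgM; first exact: (k1 a' i0 ca' z).
  by apply: cvgM; [exact: (k1 b i1 cb z)|exact: (k1 c i2 cc z)].
have le1 (x y z : R) : 0 <= x <= 1 -> 0 <= y <= 1 -> 0 <= z <= 1 -> 0 <= x * (y * z) <= 1.
  move=> /andP[x0 x1] /andP[y0 y1] /andP[z0 z1].
  by rewrite !mulr_ge0 // mulr_ile1 ?mulr_ge0 // mulr_ile1.
have r01 x y s : 0 <= bump k x y s <= 1 by rewrite bump_ge0 bump_le1.
have pint n : mu3.-integrable setT (EFin \o (fun z => w z * prod3 (a_ n) b c z)).
  apply: (@integrable_mul_bounded _ (N + n%:R + 1) 1) => //.
  - by apply: continuous_measurable3; exact: cp.
  - move=> z; have /andP[h1 h2] := le1 _ _ _ (r01 a1 b1 (z.1.1 + - n%:R)) (r01 a2 b2 z.1.2) (r01 a3 b3 z.2).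
    by rewrite ger0_norm.
  - move=> [[x y] z] Mz; have [h|h|h] : [\/ N + n%:R + 1 <= `|x|, N + n%:R + 1 <= `|y| | N + n%:R + 1 <= `|z|].
      move: Mz; rewrite !prod_normE /= !lt_max => /orP[/orP[]|] /ltW h;
      [exact: Or31|exact: Or32|exact: Or33].
    + by have [h0 _ _ _] := sup x n%:R (ler0n _ _) h; rewrite /prod3 /a_ /= h0 mul0r.
    + by have [_ _ h0 _] := sup y n%:R (ler0n _ _) h; rewrite /prod3 /= h0 mul0r mulr0.
    + by have [_ _ _ h0] := sup z n%:R (ler0n _ _) h; rewrite /prod3 /= h0 !mulr0.
have a0E : a_ 0%N = a by apply/funext => s; rewrite /a_ oppr0 addr0.
have Jn n : (\I_z (w z * prod3 a b c z) = \I_z (w z * prod3 (a_ n) b c z))%E.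
  (* Far to the left both terms vanish and far to the right they cancel, so [th] has compact
     support. *)
  pose th s := A s + -1 * A (s + - n%:R).
  have Dsh m (h : R -> R) : D1 m h -> D1 m (fun s => h (s + - n%:R)).
    move=> dh; apply: (@D1_comp m h (fun s => s + - n%:R)) => //.
    by apply: D1D; [exact: D1_id|exact: D1_cst].
  have Dth m : D1 m th by apply: D1D => //; apply: D1M; [exact: D1_cst|exact: Dsh].
  have dsh (s : R) : is_derive s (1 : R) (fun s => A (s + - n%:R)) (a_ n s).
    have ds : is_derive s (1 : R) (fun s => s + - n%:R) (1 + 0).
      exact: (is_deriveD1 (is_derive_id s 1) (is_derive_cst _ s 1)).
    have := @is_derive1_comp R A (fun s => s + - n%:R) s _ _ (dA _) ds.
    by rewrite addr0 mulr1.
  have dth (s : R) : is_derive s (1 : R) th (a s + - a_ n s).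
    have := is_deriveD1 (dA s) (is_deriveM1 (is_derive_cst (-1 : R) s (1 : R)) (dsh s)).
    by rewrite mulr0 addr0 mulN1r.
  have th0 s : N + n%:R + 1 < `|s| -> [/\ th s = 0, b s = 0 & c s = 0].
    move=> h; have [_ _ h2 h3] := sup s n%:R (ler0n _ _) (ltW h); split=> //.
    have n0 : (0 : R) <= n%:R by exact: ler0n.
    move: h; rewrite /N; have := ler_norm a1; have := ler_norm b1.
    have := ler_norm (- a1); have := ler_norm (- b1); rewrite !normrN.
    have := normr_ge0 a2; have := normr_ge0 b2; have := normr_ge0 a3; have := normr_ge0 b3.
    move=> p1 p2 p3 p4 p5 p6 p7 p8; rewrite /th.
    have [s0|s0] := leP 0 s.
      by rewrite (ger0_norm s0) => h; rewrite !A1 ?mulN1r ?subrr //; lra.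
    by rewrite (ltr0_norm s0) => h; rewrite !A0 ?mulr0 ?addr0 //; lra.
  have [tst pE] := prod3_test Dth (fun m => D1_bump m a2 b2 k0) (fun m => D1_bump m a3 b3 k0) dth th0.
  have := Hw tst; under eq_integral do rewrite pE.
  move=> h; have i1 := pint 0%N; have i2 := pint n; rewrite a0E in i1.
  apply: (eq_integral_of_sub0 i1 i2); rewrite -[RHS]h; apply: eq_integral => z _; congr EFin.
  rewrite /prod3 -/b -/c; cbn beta.
  by move: (w z) (a_ n z.1.1) (a z.1.1) (b z.1.2) (c z.2) => x1 x2 x3 x4 x5; clear; ring.
have i1 := pint 0%N; rewrite a0E in i1.
have Jf := integrable_fin_num measurableT i1.
rewrite -[LHS]fineK //; set J := fine _.
have JE : J%:E = (\I_z (w z * prod3 a b c z))%E by rewrite fineK.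
congr EFin; have [V V0 VE] := box_volume a1 b1 a2 b2 a3 b3.
pose B n := box (a1 + n%:R) (b1 + n%:R) a2 b2 a3 b3.
have mB n : measurable (B n) by exact: measurable_box.
have tcvg : (fun n => \I_z (w z ^+ 6 * \1_(B n) z))%E @ \oo --> (\int[mu3]_z (cst 0%E z))%E.
  apply: (@dominated_cvg _ _ _ mu3 setT measurableT (fun n z => (w z ^+ 6 * \1_(B n) z)%:E)
    (cst 0%E) (fun z => (w z ^+ 6)%:E)).
  - move=> n; apply/measurable_EFinP; apply: measurable_funM => //; exact: measurable_indic (mB n).
  - move=> z _; apply: cvg_near_cst.
    exists (Num.trunc (z.1.1 - a1)).+1 => // n /= hn.
    have : z.1.1 - a1 < n%:R.
      by apply: (lt_le_trans (truncnS_gt _)); rewrite ler_nat.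
    move=> zn; rewrite indicE memNset ?mulr0 //.
    by rewrite /B /box /= => -[[]]; rewrite !in_itv /= => /andP[h _] _ _; lra.
  - by [].
  - apply: (@le_integrable3 (fun z => w z ^+ 6) (fun z => w z ^+ 6)) => // z.
    by rewrite ger0_norm.
  - move=> n z _ /=; rewrite lee_fin.
    have i01 : 0 <= (\1_(B n) z : R) <= 1 by rewrite indicE ler0n lern1 leq_b1.
    have /andP[i0' i1'] := i01.
    by rewrite ger0_norm; [exact: ler_piMr (w60 z) i1'|exact: mulr_ge0 (w60 z) i0'].
rewrite integral0 in tcvg.
apply: (@le0_all_eta _ (V + 1)); first lra.
move=> eta e0.
(* The mass is taken below [eta^6] to compensate the factor [eta^-5] of [young6]; with the volume
   term the total is [eta (V + 1)]. *)
have [n tn] := cvge0_exists_le tcvg (exprn_gt0 6 e0).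
have : (`|J|%:E <= \int[mu3]_z `|w z * prod3 (a_ n) b c z|%:E)%E.
  rewrite -[(`|J|%:E)%E]/(`|J%:E|)%E JE (Jn n).
  apply: (le_trans (le_abse_integral _ _ _)) => //.
  exact: measurable_int (pint n).
have kB z : `|prod3 (a_ n) b c z| <= \1_(B n) z.
  have /andP[h1 h2] := le1 _ _ _ (r01 a1 b1 (z.1.1 + - n%:R)) (r01 a2 b2 z.1.2) (r01 a3 b3 z.2).
  rewrite indicE; case: (boolP (z \in B n)) => zB; first by rewrite ger0_norm.
  rewrite (_ : prod3 _ _ _ z = 0) ?normr0 //.
  have [x1|x1] := boolP (a1 < z.1.1 + - n%:R < b1); last by rewrite /prod3 /a_ a_out ?mul0r.
  have [x2|x2] := boolP (a2 < z.1.2 < b2); last by rewrite /prod3 b_out ?mul0r ?mulr0.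
  have [x3|x3] := boolP (a3 < z.2 < b3); last by rewrite /prod3 c_out ?mulr0.
  case/negP: zB; apply/mem_set; rewrite /B /box /= !in_itv /= x2 x3; split=> //; split=> //.
  by move: x1 => /andP[x11 x12]; apply/andP; split; lra.
move=> /le_trans /(_ (integral_norm_mul_le e0 (continuous_measurable3 (cp _ (ca_ n))) (mB n) kB)).
rewrite VE => h; rewrite -lee_fin; apply: (le_trans h).
rewrite mulrDr mulr1 EFinD EFinM; apply: leeD => //.
apply: (@le_trans _ _ (((eta ^+ 5)^-1)%:E * (eta ^+ 6)%:E)%E).
  by rewrite lee_wpmul2l // lee_fin invr_ge0 exprn_ge0 // ltW.
by rewrite -EFinM lee_fin (exprSr _ 5) mulrA mulVf ?mul1r // expf_neq0 // gt_eqF.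
Qed.

End w.
(** * Functions with vanishing weak derivative *)

Section boxes.
Variables (w : T3 -> R).
Hypotheses (mw : meas w) (w6 : (\I_z (w z ^+ 6) < +oo)%E).
Hypothesis Hw : forall psi, test_fun3 psi ->
  (\I_z (w z * partial i0 psi z) = 0)%E.

(** Dominated convergence along bumps with parameter [1/(m+1)], dominated by the indicator of the
    box. *)
Lemma box_integral0 (a1 b1 a2 b2 a3 b3 : R) :
  (\I_z (w z * \1_(box a1 b1 a2 b2 a3 b3) z) = 0)%E.
Proof.
pose N : R := `|a1| + `|b1| + `|a2| + `|b2| + `|a3| + `|b3|.
set B := box _ _ _ _ _ _.
have mB : measurable B by exact: measurable_box.
have m1 : meas (\1_B : T3 -> R) by exact: measurable_indic mB.
have BN z : B z -> `|z| <= N.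
  have side (s x y : R) : x < s < y -> `|s| <= `|x| + `|y|.
    move=> /andP[xs sy]; have := ler_norm y; have := ler_norm (- x); rewrite normrN.
    have := normr_ge0 x; have := normr_ge0 y => p1 p2 p3 p4.
    by rewrite ler_norml; apply/andP; split; lra.
  case: z => [[x y] z]; rewrite /B /box /= !in_itv /= => -[[/side h1 /side h2] /side h3].
  rewrite !prod_normE /= !ge_max /N; have := normr_ge0 a1; have := normr_ge0 b1.
  have := normr_ge0 a2; have := normr_ge0 b2; have := normr_ge0 a3; have := normr_ge0 b3.
  by move=> p1 p2 p3 p4 p5 p6; apply/andP; split; [apply/andP; split|]; lra.
have intB : mu3.-integrable setT (EFin \o (fun z => w z * \1_B z)).
  apply: (@integrable_mul_bounded w mw w6 _ N 1) => //.
  - by move=> z; rewrite ger0_norm indicE ?ler0n // lern1 leq_b1.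
  - by move=> z Nz; rewrite indicE memNset // => /BN; rewrite leNgt Nz.
pose k (m : nat) : R := m.+1%:R^-1.
have k0 m : 0 < k m by rewrite invr_gt0 ltr0n.
pose f (m : nat) z := w z * prod3 (bump (k m) a1 b1) (bump (k m) a2 b2) (bump (k m) a3 b3) z.
have fz m : (\I_z (f m z) = 0)%E by exact: integral_translate0.
have mbump m i (a b : R) : meas (fun z : T3 => bump (k m) a b (coord i z)).
  apply: continuous_measurable3 => z; apply: (@continuous_comp T3 R R (coord i) (bump (k m) a b) z).
    by apply: C1_continuous; have [] := coord_C1 i.
  exact: bump_continuous.
have mf m : meas (f m).
  have -> : f m = fun z => w z * (bump (k m) a1 b1 (coord i0 z) *
    (bump (k m) a2 b2 (coord i1 z) * bump (k m) a3 b3 (coord i2 z))) by [].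
  apply: (measurable_funM mw); apply: (measurable_funM (mbump m i0 a1 b1)).
  exact: (measurable_funM (mbump m i1 a2 b2) (mbump m i2 a3 b3)).
have Bind z : (\1_B z : R) = (a1 < z.1.1 < b1)%R%:R * ((a2 < z.1.2 < b2)%R%:R * (a3 < z.2 < b3)%R%:R).
  rewrite -!natrM !mulnb indicE; congr (_ %:R); congr nat_of_bool.
  apply/idP/idP; first by move=> /set_mem; rewrite /B /box /= !in_itv /= => -[[-> ->] ->].
  by move=> /and3P[h1 h2 h3]; apply/mem_set; rewrite /B /box /= !in_itv /=.
have c : (fun m => \I_z (f m z))%E @ \oo --> (\I_z (w z * \1_B z))%E.
  apply: (@dominated_cvg _ _ _ mu3 setT measurableT (fun m z => (f m z)%:E)
    (fun z => (w z * \1_B z)%:E) (fun z => `|w z * \1_B z|%:E)).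
  - by move=> m; apply/measurable_EFinP; exact: mf.
  - move=> z _; apply: cvg_EFin; first by near=> m.
    by rewrite Bind; apply: cvgMr; apply: cvgM; [exact: bump_cvg|apply: cvgM; exact: bump_cvg].
  - by [].
  - exact: integrable_abse intB.
  - move=> m z _; rewrite abse_EFin lee_fin.
    have bb a b s : `|bump (k m) a b s| <= `|(a < s < b)%R%:R : R|.
      case: (boolP (a < s < b)) => h; last by rewrite bump_out.
      by rewrite normr1 ger0_norm ?bump_ge0 ?bump_le1.
    have -> : f m z = w z * (bump (k m) a1 b1 z.1.1 *
      (bump (k m) a2 b2 z.1.2 * bump (k m) a3 b3 z.2)) by [].
    rewrite Bind; move: (bb a1 b1 z.1.1) (bb a2 b2 z.1.2) (bb a3 b3 z.2).
    move: (bump _ a1 _ _) (bump _ a2 _ _) (bump _ a3 _ _) => x1 x2 x3 h1 h2 h3.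
    rewrite !normrM; apply: ler_wpM2l => //.
    by apply: ler_pM; [exact: normr_ge0|exact: mulr_ge0|exact: h1|apply: ler_pM].
have c0 : (fun m => \I_z (f m z))%E @ \oo --> (0 : \bar R)%E.
  by rewrite (_ : (fun m => _) = cst 0%E); [exact: cvg_cst|apply/funext].
exact: (cvg_unique _ c c0).
Unshelve. all: by end_near. Qed.

End boxes.

Section uniqueness.
Variables (w : T3 -> R).
Hypotheses (mw : meas w) (w6 : (\I_z (w z ^+ 6) < +oo)%E).
Hypothesis Hw : forall psi, test_fun3 psi ->
  (\I_z (w z * partial i0 psi z) = 0)%E.

(** * From boxes to all measurable subsets of a cube *)

Section truncation.
Variable M : R.
Let Q := box (- M) M (- M) M (- M) M.
Let f (z : T3) : \bar R := (w z * \1_Q z)%:E.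
Let I (A B C : set R) := (\int[mu3]_(z in ((A `*` B) `*` C)) f z = 0)%E.
Let G := @RGenOpens.G R.
(** The whole line is the starting set in [dynkin_integral0] but is no interval with real endpoints.
    Intersecting with the side of [Q] makes it one, so it may be adjoined to the generators. *)
Let GT (A : set R) := G A \/ A = setT.

Let GT_itv (A : set R) : GT A -> exists x y, A `&` `]- M, M[ = `]x, y[%classic.
Proof.
case=> [[x [y ->]]|->]; last by exists (- M), M; rewrite setTI.
exists (Num.max x (- M)), (Num.min y M).
apply/seteqP; split=> t /=; rewrite !in_itv /= gt_max lt_min.
  by move=> [/andP[-> ->] /andP[-> ->]].
by move=> /andP[/andP[-> ->] /andP[-> ->]].
Qed.

Let f_int : mu3.-integrable setT f.
Proof.
have mQ : measurable Q by exact: measurable_box.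
apply: (@integrable_mul_bounded w mw w6 (\1_Q) `|M| 1) => //.
- by move=> z; rewrite ger0_norm indicE ?ler0n // lern1 leq_b1.
- move=> z Mz; rewrite indicE memNset // /Q /box.
  case: z Mz => [[x y] z] Mz /=; rewrite !in_itv /= -!ltr_norml => -[[h1 h2] h3].
  have : `|((x, y), z)| <= `|M|.
    by rewrite !prod_normE /= !ge_max !(le_trans (ltW _) (ler_norm M)).
  by rewrite leNgt Mz.
Qed.

Let base A B C : GT A -> GT B -> GT C -> I A B C.
Proof.
move=> /GT_itv[x [x' hx]] /GT_itv[y [y' hy]] /GT_itv[t [t' ht]].
rewrite /I integral_mkcond -[RHS](box_integral0 mw w6 Hw x x' y y' t t').
apply: eq_integral => z _; rewrite patchE /f.
have E : box x x' y y' t t' = ((A `*` B) `*` C) `&` Q.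
  rewrite /box -hx -hy -ht /Q /box.
  by apply/seteqP; split=> -[[p q] r] /=; tauto.
rewrite E !indicE; case: ifPn => h.
  congr (w z * _%:R)%:E; congr nat_of_bool; apply/idP/idP => h'.
    by apply/mem_set; split; [exact: set_mem|exact: set_mem].
  by move: h' => /set_mem [_ h']; exact: mem_set.
by rewrite memNset ?mulr0 // => -[h' _]; move/negP: h; apply; exact: mem_set.
Qed.

Let GE : @measurable _ R = <<s G >>. Proof. exact: RGenOpens.measurableE. Qed.
Let GI : setI_closed G.
Proof.
move=> _ _ [x [y ->]] [x' [y' ->]]; exists (Num.max x x'), (Num.min y y').
apply/seteqP; split=> t /=; rewrite !in_itv /= gt_max lt_min.
  by move=> [/andP[-> ->] /andP[-> ->]].
by move=> /andP[/andP[-> ->] /andP[-> ->]].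
Qed.

Let GTm A : GT A -> measurable A.
Proof. by case=> [[x [y ->]]|->] //. Qed.

Let m11 : meas (fun z : T3 => z.1.1).
Proof. exact: (measurableT_comp measurable_fst measurable_fst). Qed.
Let m12 : meas (fun z : T3 => z.1.2).
Proof. exact: (measurableT_comp measurable_snd measurable_fst). Qed.
Let m2 : meas (fun z : T3 => z.2).
Proof. exact: measurable_snd. Qed.

Let mprod (A B C : set R) : measurable A -> measurable B -> measurable C ->
  measurable (((A `*` B) `*` C) : set T3).
Proof. by move=> mA mB mC; apply: measurableX => //; exact: measurableX. Qed.

(** One factor at a time is enlarged from intervals to Borel sets, the other two being kept
    fixed. *)
Let st1 A B C : measurable A -> GT B -> GT C -> I A B C.
Proof.
move=> mA gB gC; have E A' : ((A' `*` B) `*` C : set T3) =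
    ((setT `*` B) `*` C) `&` (fun z : T3 => z.1.1) @^-1` A'.
  by apply/seteqP; split=> -[[p q] r] /=; tauto.
rewrite /I E; apply: (@dynkin_integral0 _ _ R mu3 _ R G _ ((setT `*` B) `*` C) f GE GI m11 _ f_int) => //.
- by apply: mprod => //; exact: GTm.
- by apply: base => //; right.
- by move=> A' gA'; rewrite -E; apply: base => //; left.
Qed.

Let st2 A B C : measurable A -> measurable B -> GT C -> I A B C.
Proof.
move=> mA mB gC; have E B' : ((A `*` B') `*` C : set T3) =
    ((A `*` setT) `*` C) `&` (fun z : T3 => z.1.2) @^-1` B'.
  by apply/seteqP; split=> -[[p q] r] /=; tauto.
rewrite /I E; apply: (@dynkin_integral0 _ _ R mu3 _ R G _ ((A `*` setT) `*` C) f GE GI m12 _ f_int) => //.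
- by apply: mprod => //; exact: GTm.
- by apply: st1 => //; right.
- by move=> B' gB'; rewrite -E; apply: st1 => //; left.
Qed.

Let st3 A B C : measurable A -> measurable B -> measurable C -> I A B C.
Proof.
move=> mA mB mC; have E C' : ((A `*` B) `*` C' : set T3) =
    ((A `*` B) `*` setT) `&` (fun z : T3 => z.2) @^-1` C'.
  by apply/seteqP; split=> -[[p q] r] /=; tauto.
rewrite /I E; apply: (@dynkin_integral0 _ _ R mu3 _ R G _ ((A `*` B) `*` setT) f GE GI m2 _ f_int) => //.
- exact: mprod.
- by apply: st2 => //; right.
- by move=> C' gC'; rewrite -E; apply: st2 => //; left.
Qed.

(** The same principle with rectangles as generators passes from products of Borel sets to
    measurable sets of the plane, and then, in the next lemma, of space. *)
Let st4 (X : set (R * R)) C : measurable X -> measurable C ->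
  (\int[mu3]_(z in (X `*` C)) f z = 0)%E.
Proof.
move=> mX mC; have E X' : (X' `*` C : set T3) =
    (setT `*` C) `&` (fun z : T3 => z.1) @^-1` X'.
  by apply/seteqP; split=> -[p r] /=; tauto.
have GI' : setI_closed [set A `*` B | A in @measurable _ R & B in @measurable _ R].
  move=> _ _ [A1 mA1 [A2 mA2 <-]] [B1 mB1 [B2 mB2 <-]].
  exists (A1 `&` B1); first exact: measurableI.
  exists (A2 `&` B2); first exact: measurableI.
  by rewrite setXI.
rewrite E; apply: (@dynkin_integral0 _ _ R mu3 _ (R * R)%type _ _ (setT `*` C) f (measurable_prod_measurableType R R) GI' measurable_fst _ f_int) => //.
- exact: measurableX.
- by rewrite -setXTT; exact: st3.
- by move=> _ [A1 mA1 [A2 mA2 <-]]; rewrite -E; exact: st3.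
Qed.

Lemma truncation_integral0 (Y : set T3) : measurable Y -> (\int[mu3]_(z in Y) f z = 0)%E.
Proof.
move=> mY.
have GI' : setI_closed [set A `*` B | A in @measurable _ (R * R)%type & B in @measurable _ R].
  move=> _ _ [A1 mA1 [A2 mA2 <-]] [B1 mB1 [B2 mB2 <-]].
  exists (A1 `&` B1); first exact: measurableI.
  exists (A2 `&` B2); first exact: measurableI.
  by rewrite setXI.
rewrite -(setTI Y) -[Y in setT `&` Y](preimage_id Y).
apply: (@dynkin_integral0 _ _ R mu3 _ T3 _ id setT f (measurable_prod_measurableType (R * R)%type R) GI' _ _ f_int) => //.
- by rewrite -setXTT; exact: st4.
- by move=> _ [A1 mA1 [A2 mA2 <-]]; rewrite setTI preimage_id; exact: st4.
Qed.

Lemma truncation_ae0 : {ae mu3, forall z, Q z -> w z = 0}.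
Proof.
have H : ae_eq mu3 setT f (cst 0%E).
  apply: (integral_ae_eq measurableT f_int (measurable_cst _)) => E _ mE.
  by rewrite truncation_integral0 // integral0.
apply: filterS H => z /= /(_ Logic.I) /eqP.
rewrite eqe mulf_eq0 indicE => /orP[/eqP //|] h Qz.
by move: h; rewrite mem_set // oner_eq0.
Qed.

End truncation.

Theorem dubois_reymond : {ae mu3, forall z, w z = 0}.
Proof.
have := ae_foralln (fun n => truncation_ae0 n%:R).
apply: filterS => z h.
apply: (h (Num.trunc `|z|).+1).
have : `|z| < (Num.trunc `|z|).+1%:R by exact: truncnS_gt.
move: _.+1 => n; case: z {h} => [[x y] z]; rewrite !prod_normE /= !gt_max => /andP[/andP[h1 h2] h3].
by rewrite /box /= !in_itv /= -!ltr_norml.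
Qed.

End uniqueness.

(** * Limits of fast Cauchy sequences in [L^6] *)

Lemma fatou_le (f_ : nat -> T3 -> R) f (e : \bar R) :
  (forall n, meas (f_ n)) -> meas f ->
  (forall n z, 0 <= f_ n z) ->
  {ae mu3, forall z, f_ ^~ z @ \oo --> f z} ->
  (\forall n \near \oo, (\I_z (f_ n z) <= e)%E) ->
  (\I_z (f z) <= e)%E.
Proof.
move=> mf_ mf f0 fcv fe.
have mEf_ n : meas (fun z => (f_ n z)%:E) by exact/measurable_EFinP.
have Ef0 n z : setT z -> (0 <= (f_ n z)%:E)%E by rewrite lee_fin.
have -> : (\I_z (f z) = \int[mu3]_z (limn_einf (fun n => (f_ n z)%:E)))%E.
  apply: ae_eq_integral.
  - exact: measurableT.
  - exact/measurable_EFinP.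
  - apply: (emeasurable_fun_cvg (fun n z => einfs (fun m => (f_ m z)%:E) n)).
      by move=> n; exact: measurable_fun_einfs.
    by move=> z _; rewrite limn_einf_lim; exact: is_cvg_einfs.
  - move: fcv; apply: (@filterS _ _ (ae_filter_ringOfSetsType mu3)) => z h _; apply/esym.
    have h' : (fun n => (f_ n z)%:E) @ \oo --> (f z)%:E by apply: cvg_EFin => //; exact: nearW.
    by rewrite (cvg_limn_einf_sup h').
apply: (le_trans (@fatou _ _ _ mu3 _ measurableT _ mEf_ Ef0)).
rewrite limn_einf_lim; apply: lime_le; first exact: is_cvg_einfs.
apply: filterS fe => n; apply: le_trans.
by apply: ereal_inf_lbound; exists n => /=.
Qed.

Lemma half_pow_le (e : R) : 0 < e -> exists k, (2^-1 : R) ^+ k <= e.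
Proof.
move=> e0; pose n := (Num.trunc e^-1).+1; exists n.
have hn : e^-1 < n%:R by exact: truncnS_gt.
rewrite exprVn -[leRHS]invrK lef_pV2 ?posrE ?exprn_gt0 ?invr_gt0 //.
apply: (le_trans (ltW hn)); rewrite -natrX ler_nat ltnW //.
exact: ltn_expl.
Qed.

(** The common rate of all approximations. Squared gradient distances of order [tk^4] become,
    through Sobolev's inequality, sixth powers of order [tk^12]. *)
Definition tk (k : nat) : R := 2^-1 ^+ k.

Lemma tk_gt0 k : 0 < tk k.
Proof. by rewrite exprn_gt0 // invr_gt0. Qed.

Lemma tk_le1 k : tk k <= 1.
Proof. by rewrite exprn_ile1 //; lra. Qed.

Lemma tk_expn_le n k : tk k ^+ n.+1 <= tk k.
Proof. by rewrite exprS ler_piMr ?(ltW (tk_gt0 k)) // exprn_ile1 ?tk_le1 ?(ltW (tk_gt0 k)). Qed.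

Lemma tk_le j k : (k <= j)%N -> tk j <= tk k.
Proof.
by move=> kj; rewrite /tk -(subnK kj) exprD ler_piMl ?(ltW (tk_gt0 _)) ?tk_le1.
Qed.

Lemma sum_tk n : \sum_(0 <= k < n) tk k <= 2.
Proof.
have -> : \sum_(0 <= k < n) tk k = 2 - 2 * tk n.
  elim: n => [|n IH]; first by rewrite big_geq // /tk expr0; lra.
  by rewrite big_nat_recr //= IH /tk exprS; move: (2^-1 ^+ n) => x; field.
by have := tk_gt0 n; lra.
Qed.

Lemma cvg_of_summable_steps (x : nat -> R) (s : R) :
  (forall k, `|x k.+1 - x k| <= s * tk k) -> cvgn x.
Proof.
move=> xs.
have s0 : 0 <= s by have := le_trans (normr_ge0 _) (xs 0%N); rewrite /tk expr0 mulr1.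
have -> : x = fun n => x 0%N + series (telescope x) n.
  by apply/funext => n; rewrite telescopeK /= addrC subrK.
apply: is_cvgD; first exact: is_cvg_cst.
apply: normed_cvg; apply: (@series_le_cvg R _ (geometric s 2^-1)) => //=.
- by move=> n; rewrite mulr_ge0 // ltW // tk_gt0.
- by apply: is_cvg_geometric_series; rewrite ger0_norm; lra.
Qed.

Section fast_cauchy.
Variables (psi : nat -> T3 -> R) (C : R).
Hypotheses (mpsi : forall n, meas (psi n)) (C0 : 0 <= C)
  (psiC : forall j k, (k <= j)%N ->
    (\I_z ((psi j z - psi k z) ^+ 6) <= (C * (tk k) ^+ 12)%:E)%E).

(** The increments are divided by [tk k] before summation. The rate [tk^12] leaves the series [S]
    integrable, while at each point where [S] is finite the increments are of order [tk k], hence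
    summable. *)
Let d k z := (tk k)^-1 ^+ 6 * (psi k.+1 z - psi k z) ^+ 6.
Let d0 k z : 0 <= d k z.
Proof.
by rewrite mulr_ge0 // exprn_even_ge0.
Qed.
Let md k : meas (d k).
Proof.
apply: measurable_funM; first exact: measurable_cst.
by apply: measurable_funX; exact: measurable_funB.
Qed.

Let S z := (\sum_(0 <= k <oo) (d k z)%:E)%E.

Let mS : meas S.
Proof.
by apply: ge0_emeasurable_sum => // k; [move=> z _ _; rewrite lee_fin|move=> _; exact/measurable_EFinP].
Qed.

Let S0 z : (0 <= S z)%E. Proof. by apply: nneseries_ge0 => k _ _; rewrite lee_fin. Qed.

Let intS : (\int[mu3]_z S z <= (C * 2)%:E)%E.
Proof.
rewrite integral_nneseries //; last 2 first.
- by move=> k; apply/measurable_EFinP; exact: md.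
- by move=> k z _; rewrite lee_fin.
apply: lime_le.
  by apply: is_cvg_nneseries => k _ _; apply: integral_ge0 => z _; rewrite lee_fin.
apply: nearW => n.
apply: (@le_trans _ _ (\sum_(0 <= k < n) (C * tk k)%:E)%E).
  apply: lee_sum => k _; rewrite integral3Z //.
  - apply: (@le_trans _ _ (((tk k)^-1 ^+ 6)%:E * (C * tk k ^+ 12)%:E)%E).
      by rewrite lee_wpmul2l ?lee_fin ?exprn_even_ge0 //; exact: psiC.
    rewrite -EFinM lee_fin.
    have t0 := tk_gt0 k.
    have -> : (tk k)^-1 ^+ 6 * (C * tk k ^+ 12) = C * tk k ^+ 6.
      by move: (tk k) t0 => t t0; field; rewrite gt_eqF.
    by rewrite ler_wpM2l // tk_expn_le.
  - by apply: measurable_funX; exact: measurable_funB.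
  - by rewrite exprn_even_ge0.
  - by move=> z; rewrite exprn_even_ge0.
by rewrite sumEFin lee_fin -mulr_sumr ler_wpM2l // sum_tk.
Qed.

Let Sae : {ae mu3, forall z, (S z < +oo)%E}.
Proof.
have iS : mu3.-integrable setT S.
  apply/integrableP; split => //.
  under eq_integral do rewrite gee0_abs //.
  by apply: le_lt_trans intS _; rewrite ltry.
have := integrable_ae measurableT iS.
by apply: filterS => z /(_ I); rewrite ge0_fin_numE.
Qed.

Let pcv z : (S z < +oo)%E -> cvgn (psi ^~ z).
Proof.
move=> Sz; pose s := fine (S z).
have sE : S z = s%:E by rewrite fineK // ge0_fin_numE.
have s0 : 0 <= s by exact: fine_ge0.
apply: (@cvg_of_summable_steps _ (1 + s)) => k.
have dk : d k z <= s.
  rewrite -lee_fin -sE.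
  apply: (le_trans _ (nneseries_lim_ge k.+1 _)); last by move=> n _ _; rewrite lee_fin.
  rewrite big_nat_recr //= leeDr //; apply: sume_ge0 => n _; rewrite lee_fin; exact: d0.
have tp := tk_gt0 k.
rewrite -ler_pdivrMr // mulrC.
have -> : (tk k)^-1 * `|psi k.+1 z - psi k z| = `|(tk k)^-1 * (psi k.+1 z - psi k z)|.
  by rewrite normrM ger0_norm // invr_ge0 ltW.
move: dk; rewrite /d -exprMn; set y := _ * _ => dk.
have := @young6 1 y ltr01; rewrite expr1n invr1 mul1r => /le_trans; apply.
by rewrite lerD2l.
Qed.

Lemma L6_limit : exists v : T3 -> R, [/\ meas v,
  {ae mu3, forall z, psi ^~ z @ \oo --> v z} &
  forall k, (\I_z ((psi k z - v z) ^+ 6) <= (C * (tk k) ^+ 12)%:E)%E].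
Proof.
pose N := [set z | (S z < +oo)%E].
have mN : measurable N.
  by rewrite -[N]setTI; apply: emeasurable_fun_infty_o.
(* Cutting off outside [N] gives convergence at every point, so that the limit is measurable. *)
pose psi' n z := psi n z * \1_N z.
have m1 : meas (\1_N : T3 -> R) by exact: measurable_indic.
have cv z : cvgn (psi' ^~ z).
  rewrite /psi' indicE; case: (boolP (z \in N)) => zN.
    by apply: is_cvgMl; apply: pcv; exact: set_mem.
  rewrite (_ : (fun n => _) = cst 0); first exact: is_cvg_cst.
  by apply/funext => n; rewrite mulr0.
pose v z := limn (psi' ^~ z).
have mv : meas v.
  apply: (@measurable_fun_cvg _ _ _ _ psi') => [n|z _]; first exact: measurable_funM.
  exact: cv.
have aev : {ae mu3, forall z, psi ^~ z @ \oo --> v z}.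
  move: Sae; apply: (@filterS _ _ (ae_filter_ringOfSetsType mu3)) => z Sz; rewrite /v.
  have -> : psi' ^~ z = psi ^~ z.
    by apply/funext => n; rewrite /psi' indicE mem_set // mulr1.
  exact: pcv.
exists v; split => // k.
apply: (@fatou_le (fun j z => (psi k z - psi j z) ^+ 6)).
- by move=> n; apply: measurable_funX; exact: measurable_funB.
- by apply: measurable_funX; exact: measurable_funB.
- by move=> n z; rewrite exprn_even_ge0.
- move: aev; apply: (@filterS _ _ (ae_filter_ringOfSetsType mu3)) => z h.
  apply: (@cvg_comp _ _ _ (fun n => psi k z - psi n z) (fun x => x ^+ 6) _ (nbhs (psi k z - v z))).
    by apply: cvgB => //; exact: cvg_cst.
  exact: exprn_continuous.
- exists k => // j /= kj; apply: le_trans (psiC kj).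
  rewrite le_eqVlt; apply/orP; left; apply/eqP/eq_integral => z _; congr EFin.
  by rewrite -[in LHS]opprB -[LHS]/(_ ^+ 6); rewrite (exprM _ 2 3) sqrrN -exprM.
Qed.

End fast_cauchy.
(** * Smooth approximation in D^{1,2} *)

Lemma pow6B (a b : R) : (a - b) ^+ 6 <= 64 * (a ^+ 6 + b ^+ 6).
Proof.
have h (x y : R) : `|x| <= `|y| -> (x - y) ^+ 6 <= 64 * y ^+ 6.
  move=> xy; have : `|x - y| <= 2 * `|y| by have := ler_normB x y; lra.
  move=> h; have -> : 64 * y ^+ 6 = (2 * `|y|) ^+ 6.
    rewrite exprMn -normrX (ger0_norm (x := y ^+ 6)) ?exprn_even_ge0 //.
    by congr (_ * _); rewrite -natrX.
  have -> : (x - y) ^+ 6 = `|x - y| ^+ 6 by rewrite -normrX ger0_norm // exprn_even_ge0.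
  by rewrite lerXn2r // nnegrE // mulr_ge0.
have a6 : 0 <= a ^+ 6 by rewrite exprn_even_ge0.
have b6 : 0 <= b ^+ 6 by rewrite exprn_even_ge0.
have [ab|/ltW ba] := leP `|a| `|b|.
  by apply: (le_trans (h a b ab)); lra.
have -> : (a - b) ^+ 6 = (b - a) ^+ 6.
  by rewrite -[in LHS]opprB (exprM (- (b - a)) 2 3) sqrrN -exprM.
by apply: (le_trans (h b a ba)); lra.
Qed.

Lemma L6_sub (a b : T3 -> R) : meas a -> meas b ->
  (\I_z (a z ^+ 6) < +oo)%E -> (\I_z (b z ^+ 6) < +oo)%E ->
  (\I_z ((a z - b z) ^+ 6) < +oo)%E.
Proof.
move=> ma mb ia ib.
have ma6 : meas (fun z => a z ^+ 6) by exact: measurable_funX.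
have mb6 : meas (fun z => b z ^+ 6) by exact: measurable_funX.
have p6 (f : T3 -> R) z : 0 <= f z ^+ 6 by rewrite exprn_even_ge0.
have [x _ ax] := integral3_fin ma6 (p6 a) ia; have [y _ by_] := integral3_fin mb6 (p6 b) ib.
apply: (@le_lt_trans _ _ (64 * x + 64 * y)%:E); last by rewrite ltry.
apply: (@le_trans _ _ (\I_z (64 * a z ^+ 6 + 64 * b z ^+ 6))%E).
  apply: le_integral3.
  - by apply: measurable_funX; exact: measurable_funB.
  - exact: measurable_lincomb.
  - by move=> z; exact: (p6 (fun z => a z - b z)).
  - by move=> z; rewrite -mulrDr; exact: pow6B.
by apply: integral3_lincomb_le => //; rewrite ?ax ?by_.
Qed.

Lemma C1c_L6 f : C1c f -> (\I_z (f z ^+ 6) < +oo)%E.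
Proof.
move=> cf; have c6 : C1c (fun z => f z ^+ 6).
  apply: (C1c_comp (is_derive_exprnS 5)) => //; last by rewrite expr0n.
  by move=> s; apply: cvgMr; exact: exprn_continuous.
have /integrableP[_] := C1c_integrable c6.
by under eq_integral do rewrite /= ger0_norm ?exprn_even_ge0 //.
Qed.

Lemma measurable_grad_dist2 f (g : 'I_3 -> T3 -> R) : C1c f ->
  (forall i, meas (g i)) -> meas (grad_dist2 f g).
Proof.
move=> cf mg; apply: measurable_sqr_sum => i.
by apply: measurable_funB => //; exact: C1c_measurable_partial.
Qed.

Lemma grad_dist2_ge0 f (g : 'I_3 -> T3 -> R) z : 0 <= grad_dist2 f g z.
Proof. by apply: sumr_ge0 => i _; rewrite sqr_ge0. Qed.

Lemma dirichlet_sub (f1 f2 : T3 -> R) (g : 'I_3 -> T3 -> R) (r1 r2 : R) :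
  C1c f1 -> C1c f2 -> (forall i, meas (g i)) ->
  (\I_z (grad_dist2 f1 g z) <= r1%:E)%E ->
  (\I_z (grad_dist2 f2 g z) <= r2%:E)%E ->
  (dirichlet (fun z => (f1 z - f2 z)%R) <= (2 * (r1 + r2))%:E)%E.
Proof.
move=> c1 c2 mg h1 h2.
have m1 := measurable_grad_dist2 c1 mg; have m2 := measurable_grad_dist2 c2 mg.
have p1 := grad_dist2_ge0 f1 g; have p2 := grad_dist2_ge0 f2 g.
apply: (@le_trans _ _ (\I_z (2 * grad_dist2 f1 g z + 2 * grad_dist2 f2 g z))%E).
  apply: le_integral3.
  - by apply: measurable_sqr_sum => i; exact: C1c_measurable_partial (C1cB c1 c2).
  - exact: measurable_lincomb.
  - by move=> z; apply: sumr_ge0 => i _; rewrite sqr_ge0.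
  - move=> z; rewrite /grad_dist2 -mulrDr -big_split /= mulr_sumr; apply: ler_sum => i _.
    have [d1 _ _] := c1; have [d2 _ _] := c2.
    rewrite (partialB i (d1 z) (d2 z)).
    move: (partial i f1 z) (partial i f2 z) (g i z) => x y t.
    rewrite -subr_ge0 (_ : _ - _ = (x + y - 2 * t) ^+ 2) ?sqr_ge0 //; clear; ring.
by rewrite mulrDr; exact: integral3_lincomb_le.
Qed.

Lemma integral_parts f (psi : T3 -> R) i : C1c f -> C1c psi ->
  (\I_z (f z * partial i psi z + psi z * partial i f z) = 0)%E.
Proof.
move=> cf cp; have [df pf _] := cf; have [dp _ _] := cp.
have := integral_partial0 i (C1c_mulr df pf cp).
by under eq_integral do rewrite (partialM i (df _) (dp _)).
Qed.

(** Sobolev's bound at energy [2^2]. The difference of two terms of the fast sequence has energy at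
    most [(2 tk^2)^2], which gives [C12 tk^12]. *)
Definition C12 : R := (64 * 2 ^+ 3) ^+ 2.

Lemma D12_L6 (u : T3 -> R) (g : 'I_3 -> T3 -> R) : D12 u g ->
  exists2 U6 : R, 0 <= U6 & (\I_z (u z ^+ 6) = U6%:E)%E.
Proof.
move=> [mu [h _]]; apply: integral3_fin; first exact: measurable_funX.
  by move=> z; rewrite exprn_even_ge0.
move: h; congr (_ < _)%E; apply: eq_integral => z _.
by rewrite -normrX ger0_norm // exprn_even_ge0.
Qed.

Section approx.
Variables (u : T3 -> R) (g : 'I_3 -> T3 -> R).
Hypothesis Hu : D12 u g.

Let mu_ : meas u. Proof. by case: Hu. Qed.
Let mg i : meas (g i). Proof. by case: Hu => _ [_ [[h _] _]]. Qed.
Let u6 : (\I_z (u z ^+ 6) < +oo)%E.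
Proof. by have [x _ ->] := D12_L6 Hu; rewrite ltry. Qed.

Lemma D12_fast_sequence : exists psi : nat -> T3 -> R, (forall k, test_fun3 (psi k)) /\
  forall k, (\I_z (grad_dist2 (psi k) g z) <= (tk k ^+ 4)%:E)%E.
Proof.
case: Hu => _ [_ [_ [_ [psi [tpsi cpsi]]]]].
have h k := cvge0_exists_le cpsi (exprn_gt0 4 (tk_gt0 k)).
have [n hn] := choice h.
by exists (fun k => psi (n k)); split.
Qed.

Lemma fast_sequence_cauchy (psi : nat -> T3 -> R) : (forall k, test_fun3 (psi k)) ->
  (forall k, (\I_z (grad_dist2 (psi k) g z) <= (tk k ^+ 4)%:E)%E) ->
  forall j k, (k <= j)%N ->
  (\I_z ((psi j z - psi k z) ^+ 6) <= (C12 * (tk k) ^+ 12)%:E)%E.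
Proof.
move=> tpsi gpsi j k kj.
have c n := test_fun3_C1c (tpsi n).
have t0 := tk_gt0 k; have tj0 := tk_gt0 j.
have h := dirichlet_sub (c j) (c k) mg (gpsi j) (gpsi k).
have d : (dirichlet (fun z => (psi j z - psi k z)%R) <= ((2 * tk k ^+ 2) ^+ 2)%:E)%E.
  apply: (le_trans h); rewrite lee_fin.
  have : tk j ^+ 4 <= tk k ^+ 4 by apply: lerXn2r; rewrite ?nnegrE ?(ltW tj0) ?(ltW t0) // tk_le.
  have -> : (2 * tk k ^+ 2) ^+ 2 = 4 * tk k ^+ 4 by move: (tk k) => t; clear; ring.
  by lra.
have := sobolev (C1cB (c j) (c k)) (sqr_ge0 _) d.
rewrite sqrtr_sqr ger0_norm; last by rewrite mulr_ge0 // sqr_ge0.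
rewrite (_ : (64 * (2 * tk k ^+ 2) ^+ 3) ^+ 2 = C12 * tk k ^+ 12) //.
by rewrite /C12; move: (tk k) => t; clear; ring.
Qed.

Section limit.
Variables (psi : nat -> T3 -> R) (v : T3 -> R).
Hypothesis tpsi : forall k, test_fun3 (psi k).
Hypothesis gpsi : forall k, (\I_z (grad_dist2 (psi k) g z) <= (tk k ^+ 4)%:E)%E.
Hypothesis mv : meas v.
Hypothesis vpsi : forall k, (\I_z ((psi k z - v z) ^+ 6) <= (C12 * tk k ^+ 12)%:E)%E.

Let cpsi k : C1c (psi k). Proof. exact: test_fun3_C1c. Qed.

Lemma L6_limit_fin : (\I_z (v z ^+ 6) < +oo)%E.
Proof.
have mp := C1c_measurable (cpsi 0).
have h : (\I_z ((psi 0%N z - v z) ^+ 6) < +oo)%E.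
  by apply: (le_lt_trans (vpsi 0)); rewrite ltry.
have := L6_sub mp (measurable_funB mp mv) (C1c_L6 (cpsi 0)) h.
by under eq_integral do rewrite subKr.
Qed.

(** Integration by parts for [psi k] and the weak gradient identity of [u] both have total integral
    0. Adding their difference to the integrand on the left rewrites it as
    [(d psi_k - g) rh + (psi_k - v) d rh], where each term contains a convergent difference. *)
Lemma weak_defect_le rh k : test_fun3 rh ->
  (`|\int[mu3]_z ((u z - v z) * partial i0 rh z)%:E| <=
   \I_z (`|partial i0 (psi k) z - g i0 z| * `|rh z|) +
   \int[mu3]_z `|(psi k z - v z) * partial i0 rh z|%:E)%E.
Proof.
move=> trh; have crh := test_fun3_C1c trh.
have [drh prh [M hM]] := crh; have [dps pps _] := cpsi k.
set D := partial i0 rh; set E := partial i0 (psi k).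
have mD : meas D by exact: C1c_measurable_partial.
have mE : meas E by exact: C1c_measurable_partial.
have mrh : meas rh by exact: C1c_measurable.
have mps : meas (psi k) by exact: C1c_measurable.
have sD : compact_support3 D.
  by exists M => z Mz; exact: (partial_support i0 hM Mz).
have [C C0 hC] := bounded_compact_support3 (prh i0) sD.
have [_ [_ [[_ wg] _]]] := Hu.
have [J1 [J2 e12]] := wg rh trh i0.
have cD := prh i0; have crh0 := C1c_continuous crh; have cps := C1c_continuous (cpsi k).
have J3 : mu3.-integrable setT (EFin \o (fun z => psi k z * D z)).
  apply: integrable_compact_support3.
    by move=> z; apply: continuousM; [exact: cps|exact: cD].
  by exists M => z Mz; rewrite /D (partial_support i0 hM Mz) mulr0.
have J4 : mu3.-integrable setT (EFin \o (fun z => rh z * E z)).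
  apply: integrable_compact_support3.
    by move=> z; apply: continuousM; [exact: crh0|exact: pps].
  by exists M => z Mz; rewrite (hM _ Mz) mul0r.
have J5 : mu3.-integrable setT (EFin \o (fun z => v z * D z)).
  apply: (integrable_mul_bounded mv L6_limit_fin (ltW C0) mD hC (M := M)).
  by move=> z Mz; exact: (partial_support i0 hM Mz).
have J12 : mu3.-integrable setT (EFin \o (fun z => u z * D z + g i0 z * rh z)).
  exact: (integrableD measurableT J1 J2).
have e1 : (\I_z (u z * D z + g i0 z * rh z) = 0)%E.
  transitivity (\int[mu3]_z ((u z * D z)%:E + (g i0 z * rh z)%:E))%E; first by [].
  rewrite (integralD measurableT J1 J2) e12 addeC subee //.
  exact: integrable_fin_num J2.
have J34 : mu3.-integrable setT (EFin \o (fun z => psi k z * D z + rh z * E z)).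
  exact: (integrableD measurableT J3 J4).
have e2 : (\I_z (psi k z * D z + rh z * E z) = 0)%E by exact: integral_parts.
pose h z := (psi k z * D z + rh z * E z) - (u z * D z + g i0 z * rh z).
have Jh : mu3.-integrable setT (EFin \o h) by exact: (integrableB measurableT J34 J12).
have eh : (\I_z (h z) = 0)%E.
  transitivity (\int[mu3]_z ((psi k z * D z + rh z * E z)%:E - (u z * D z + g i0 z * rh z)%:E))%E; first by [].
  by rewrite (integralB measurableT J34 J12) e1 e2 sube0.
have Jf : mu3.-integrable setT (EFin \o (fun z => (u z - v z) * D z)).
  have := integrableB measurableT J1 J5.
  by apply: eq_integrable => // z _; rewrite /= mulrBl.
have -> : (\I_z ((u z - v z) * D z) = \I_z ((u z - v z) * D z + h z))%E.
  transitivity (\int[mu3]_z (((u z - v z) * D z)%:E + (h z)%:E))%E; last by [].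
  by rewrite (integralD measurableT Jf Jh) eh adde0.
have mh : meas (fun z => (u z - v z) * D z + h z).
  by apply/measurable_EFinP; exact: measurable_int (integrableD measurableT Jf Jh).
apply: (le_trans (le_abse_integral mu3 measurableT _)); first exact/measurable_EFinP.
rewrite -integral3D.
- apply: le_integral3.
  + exact: measurableT_comp.
  + apply: measurable_funD.
      by apply: measurable_funM; apply: measurableT_comp => //; exact: measurable_funB.
    by apply: measurableT_comp => //; apply: measurable_funM => //; exact: measurable_funB.
  + by [].
  + move=> z; rewrite /h -normrM.
    rewrite (_ : _ + _ = (E z - g i0 z) * rh z + (psi k z - v z) * D z); first exact: ler_normD.
    by move: (u z) (v z) (D z) (psi k z) (rh z) (E z) (g i0 z); clear => *; ring.
- by apply: measurable_funM; apply: measurableT_comp => //; exact: measurable_funB.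
- by apply: measurableT_comp => //; apply: measurable_funM => //; exact: measurable_funB.
- by [].
- by [].
Qed.

(** It remains to make the defect arbitrarily small: the gradient term by Cauchy-Schwarz against
    [rh], the other by Young's inequality on the support of [rh]. Here [eta] is fixed first and [k]
    chosen afterwards, to beat [eta^-5]. *)
Lemma D12_limit_eq : {ae mu3, forall z, u z - v z = 0}.
Proof.
apply: dubois_reymond.
- exact: measurable_funB.
- exact: (L6_sub mu_ mv u6 L6_limit_fin).
move=> rh trh; have crh := test_fun3_C1c trh.
have [drh prh srh] := crh; have [M M0 hM] := compact_support3P srh.
set X := (\int[mu3]_z _)%E.
have sD : compact_support3 (partial i0 rh).
  by exists M => z Mz; exact: (partial_support i0 hM Mz).
have [C C0 hC] := bounded_compact_support3 (prh i0) sD.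
have mrh : meas rh by exact: C1c_measurable.
have mD : meas (partial i0 rh) by exact: C1c_measurable_partial.
have [S S0 hS] : exists2 S : R, 0 <= S & (\I_z (`|rh z| ^+ 2) <= S%:E)%E.
  have cr2 : C1c (fun z => rh z * rh z) by exact: C1c_mulr.
  have /integrable_fin_num h := C1c_integrable cr2.
  exists (fine (\I_z (rh z * rh z))%E).
    by apply: fine_ge0; apply: integral_ge0 => z _; rewrite lee_fin -expr2 sqr_ge0.
  rewrite fineK; last exact: h.
  by under eq_integral do rewrite real_normK ?num_real // expr2.
have mB := measurable_cube M.
pose V := fine (mu3 (cube M)).
have VE : mu3 (cube M) = V%:E by rewrite /V fineK // ge0_fin_numE // cube_lty.
have V0 : 0 <= V by rewrite /V fine_ge0.
have C12_0 : 0 <= C12 by rewrite /C12 sqr_ge0.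
have bound k eta : 0 < eta ->
    (`|X| <= (tk k ^+ 2 * Num.sqrt S + C * (eta * V + (eta ^+ 5)^-1 * (C12 * tk k ^+ 12)))%:E)%E.
  move=> e0; apply: (le_trans (weak_defect_le k trh)); rewrite EFinD; apply: leeD.
    have -> : tk k ^+ 2 = Num.sqrt (tk k ^+ 4).
      by rewrite (exprM _ 2 2) sqrtr_sqr ger0_norm // sqr_ge0.
    apply: (@cauchy_schwarz3 (fun z => `|partial i0 (psi k) z - g i0 z|) (fun z => `|rh z|)) => //.
    - apply: measurableT_comp => //; apply: measurable_funB => //.
      exact: C1c_measurable_partial.
    - exact: measurableT_comp.
    - by rewrite exprn_ge0 // ltW // tk_gt0.
    apply: (le_trans _ (gpsi k)); apply: le_integral3.
    - apply: measurable_funX; apply: measurableT_comp => //; apply: measurable_funB => //.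
      exact: C1c_measurable_partial.
    - exact: measurable_grad_dist2.
    - by move=> z; rewrite sqr_ge0.
    - move=> z; rewrite real_normK ?num_real //.
      exact: (sqr_le_sqr_sum (fun i => partial i (psi k) z - g i z)).
  have mw : meas (fun z => psi k z - v z).
    by apply: measurable_funB => //; exact: C1c_measurable.
  have mk : meas (fun z => C^-1 * partial i0 rh z).
    exact: measurable_funM (measurable_cst _) mD.
  (* Division by the bound [C] of the derivative gives a multiplier dominated by the indicator of
     the cube, as [integral_norm_mul_le] requires. *)
  have -> : (\int[mu3]_z `|(psi k z - v z) * partial i0 rh z|%:E =
      \I_z (C * `|(psi k z - v z) * (C^-1 * partial i0 rh z)|))%E.
    apply: eq_integral => z _; congr (_%:E).
    rewrite mulrCA [in RHS]normrM (@gtr0_norm _ C^-1) ?invr_gt0 // mulVKf //.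
    by rewrite gt_eqF.
  rewrite integral3Z.
  - rewrite EFinM; apply: lee_wpmul2l; first by rewrite lee_fin ltW.
    apply: (le_trans (integral_norm_mul_le mw e0 mk mB _)).
      move=> z; rewrite indicE; case: (boolP (z \in cube M)) => hz.
        rewrite normrM gtr0_norm ?invr_gt0 // mulrC ler_pdivrMr // mul1r; exact: hC.
      have Mz : M < `|z|.
        by rewrite ltNge; apply/negP => /cubeP h; move/negP: hz; apply; rewrite inE.
      by rewrite (partial_support i0 hM Mz) mulr0 normr0.
    rewrite EFinD VE EFinM; apply: leeD => //.
    rewrite EFinM; apply: lee_wpmul2l; first by rewrite lee_fin invr_ge0 exprn_ge0 // ltW.
    apply: (le_trans _ (vpsi k)); apply: le_integral3.
    + apply: measurable_funM; [exact: measurable_funX|exact: measurable_indic].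
    + exact: measurable_funX.
    + by move=> z; rewrite mulr_ge0 // exprn_even_ge0.
    + by move=> z; rewrite ler_piMr ?exprn_even_ge0 // indicE; case: (_ \in _).
  - by apply: measurableT_comp => //; exact: measurable_funM.
  - exact: ltW.
  - by [] .
have Xfin : X \is a fin_num.
  by rewrite fin_num_abs; apply: (le_lt_trans (bound 0%N 1 ltr01)); rewrite ltry.
rewrite -(fineK Xfin); congr (_%:E).
apply: (@le0_all_eta _ (C * V + 1)) => [|eta e0].
  by rewrite addr_ge0 // mulr_ge0 // ltW.
(* [W] collects the coefficients of the terms that vanish with [k]; the index is then taken so that
   [tk k * W <= eta]. *)
pose W := Num.sqrt S + C * ((eta ^+ 5)^-1 * C12) + 1.
have W0 : 0 < W.
  rewrite ltr_wpDl // addr_ge0 ?sqrtr_ge0 // mulr_ge0 ?(ltW C0) // mulr_ge0 //.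
  by rewrite invr_ge0 exprn_ge0 // ltW.
have [k hk] := half_pow_le (divr_gt0 e0 W0).
have : `|fine X| <= tk k ^+ 2 * Num.sqrt S + C * (eta * V + (eta ^+ 5)^-1 * (C12 * tk k ^+ 12)).
  by rewrite -lee_fin -abse_EFin (fineK Xfin); exact: bound.
move=> /le_trans; apply.
have t0 := tk_gt0 k.
have a1 : tk k ^+ 2 * Num.sqrt S <= tk k * Num.sqrt S by rewrite ler_wpM2r ?sqrtr_ge0 ?tk_expn_le.
have a2 : C * ((eta ^+ 5)^-1 * (C12 * tk k ^+ 12)) <= C * ((eta ^+ 5)^-1 * C12) * tk k.
  rewrite -(mulrA C) -(mulrA _ C12); apply: ler_wpM2l; first exact: ltW.
  apply: ler_wpM2l; first by rewrite invr_ge0 exprn_ge0 // ltW.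
  by apply: (ler_wpM2l C12_0); exact: tk_expn_le.
have a3 : tk k * W <= eta by rewrite -ler_pdivlMr.
move: a1 a2 a3; rewrite /W !mulrDr mulr1.
move: (C * ((eta ^+ 5)^-1 * C12)) (C * ((eta ^+ 5)^-1 * (C12 * tk k ^+ 12))) => a b.
rewrite (mulrC _ a) (mulrCA eta C V).
move: (a * tk k) (tk k * Num.sqrt S) (tk k ^+ 2 * Num.sqrt S) (C * (eta * V)) => x y s r.
by lra.
Qed.

End limit.

Lemma D12_approx : exists psi : nat -> T3 -> R, [/\ (forall k, test_fun3 (psi k)),
  (forall k, (\I_z (grad_dist2 (psi k) g z) <= (tk k ^+ 4)%:E)%E),
  (forall k, (\I_z ((psi k z - u z) ^+ 6) <= (C12 * tk k ^+ 12)%:E)%E) &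
  {ae mu3, forall z, psi ^~ z @ \oo --> u z}].
Proof.
have [psi [tpsi gpsi]] := D12_fast_sequence.
have mpsi k : meas (psi k) by exact: C1c_measurable (test_fun3_C1c (tpsi k)).
have C12_0 : 0 <= C12 by rewrite /C12 sqr_ge0.
have [v [mv cv bv]] := L6_limit mpsi C12_0 (fast_sequence_cauchy tpsi gpsi).
have uv := D12_limit_eq tpsi gpsi mv bv.
exists psi; split=> //.
  move=> k; apply: (le_trans _ (bv k)); rewrite le_eqVlt; apply/orP; left; apply/eqP.
  apply: ae_eq_integral => //.
  - by apply/measurable_EFinP; apply: measurable_funX; exact: measurable_funB (mpsi k) mu_.
  - by apply/measurable_EFinP; apply: measurable_funX; exact: measurable_funB (mpsi k) mv.
  apply: (@filterS _ _ (ae_filter_ringOfSetsType mu3) _ _ _ uv) => z /= /eqP.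
  by rewrite subr_eq0 => /eqP ->.
apply: (@filterS2 _ _ (ae_filter_ringOfSetsType mu3) _ _ _ _ uv cv) => z /= /eqP.
by rewrite subr_eq0 => /eqP ->.
Qed.

End approx.
(** * Energy estimate *)

Section regularized_powers.
Implicit Types (e nu s a b u M : R).

(* The equation is tested with [G = reg e 5 (2 * nu)], the energy being that of
   [H = reg e 3 nu]: [H s ^+ 2 = s * G s], while
   [5 + 4 * nu > 0] gives [G'] a lower bound by [H' ^+ 2]. *)
Definition reg e m nu s := s ^+ m * (e + s ^+ 2) `^ nu.
Definition dreg e m nu s :=
  s ^+ m * (e + s ^+ 2) `^ (nu - 1) * (m.+1%:R * (e + s ^+ 2) + 2 * nu * s ^+ 2).

Lemma reg_ge0 e m nu s : 0 <= s -> 0 <= reg e m nu s.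
Proof. by move=> s0; rewrite mulr_ge0 ?powR_ge0 ?exprn_ge0. Qed.

Lemma regular_pos e s : 0 < e -> 0 < e + s ^+ 2.
Proof. by move=> e0; rewrite ltr_wpDr // sqr_ge0. Qed.

Lemma powRS (x a : R) : 0 < x -> x `^ (a - 1) * x = x `^ a.
Proof.
move=> x0; rewrite -{2}(powRr1 (ltW x0)) -powRD; first by rewrite subrK.
by rewrite (gt_eqF x0) implybT.
Qed.

Lemma sqr_powR (x a : R) : (x `^ a) ^+ 2 = x `^ (2 * a).
Proof. by rewrite mulrC powRrM powR_mulrn // powR_ge0. Qed.

Lemma is_derive_reg e m nu s : 0 < e -> is_derive s (1 : R) (reg e m.+1 nu) (dreg e m nu s).
Proof.
move=> e0; have p := regular_pos s e0.
have := is_deriveM1 (is_derive_exprnS m s) (is_derive_regular_power nu s e0).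
set d := (X in is_derive _ _ _ X -> _) => h.
rewrite (_ : dreg e m nu s = d) //; rewrite /d /dreg -(powRS nu p).
move: (_ `^ _) (s ^+ m) (exprS s m) => x y ->; move: m.+1%:R => k; clear; ring.
Qed.

Lemma D1_reg n e m nu : 0 < e -> D1 n (reg e m nu).
Proof.
move=> e0; apply: D1M; last exact: D1_regular_power.
elim: m => [|m IH]; first by apply: D1_cst.
have -> : (fun s : R => s ^+ m.+1) = fun s => s * s ^+ m by apply/funext => s; rewrite exprS.
by apply: D1M => //; exact: D1_id.
Qed.

Lemma dreg_continuous e m nu : 0 < e -> continuous (dreg e m nu).
Proof.
move=> e0; have c : continuous (fun s : R => e + s ^+ 2).
  by move=> s; apply: cvgD; [exact: cvg_cst|exact: exprn_continuous].
move=> s; apply: cvgM.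
  apply: cvgM; first exact: exprn_continuous.
  exact: (D1_continuous (D1_regular_power 0 (nu - 1) e0)).
apply: cvgD; apply: cvgM; [exact: cvg_cst|exact: c|exact: cvg_cst|exact: exprn_continuous].
Qed.

Lemma ler_powR_npos (x y r : R) : 0 < x -> x <= y -> r <= 0 -> y `^ r <= x `^ r.
Proof.
move=> x0 xy r0; have y0 := lt_le_trans x0 xy.
have [t t0 ->] : exists2 t, 0 <= t & r = - t by exists (- r); rewrite ?oppr_ge0 ?opprK.
rewrite !powRN lef_pV2 ?posrE ?powR_gt0 //.
by apply: ge0_ler_powR; rewrite ?nnegrE ?(ltW x0) ?(ltW y0).
Qed.

Section estimates.
Variables (e nu : R).
Hypotheses (e0 : 0 < e) (nu1 : 0 < 5 + 4 * nu) (nu2 : 5 + 4 * nu < 1).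
Let H := reg e 3 nu.
Let G := reg e 5 (2 * nu).
Let dH := dreg e 2 nu.
Let dG := dreg e 4 (2 * nu).
Let Ce := e `^ (2 + 2 * nu) + e `^ (2 * nu).

(** With [t = s^2] and after removal of a common factor, the claim compares [(3(e+t) + 2 nu t)^2]
    with a multiple of [(e+t)(5e + (5 + 4 nu)t)]. As [nu < 0] the first is at most [9(e+t)^2], and
    the last factor is at least [(5 + 4 nu)(e+t)]. *)
Lemma sqr_dreg_le s : dH s ^+ 2 <= 9 / (5 + 4 * nu) * dG s.
Proof.
have p := regular_pos s e0; rewrite /dH /dG /dreg.
have xy : (e + s ^+ 2) `^ (2 * nu - 1) = ((e + s ^+ 2) `^ (nu - 1)) ^+ 2 * (e + s ^+ 2).
  by rewrite -(powRS (2 * nu - 1) p) sqr_powR; congr (_ `^ _ * _); ring.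
rewrite xy; move: (powR_ge0 (e + s ^+ 2) (nu - 1)); move: (_ `^ _) => y y0.
have s0 := sqr_ge0 s; move: p s0; rewrite (_ : s ^+ 4 = (s ^+ 2) ^+ 2); last by rewrite -exprM.
move: (s ^+ 2) => t p t0.
have -> : 9 / (5 + 4 * nu) * (t ^+ 2 * (y ^+ 2 * (e + t)) * (5 * (e + t) + 2 * (2 * nu) * t)) =
    (t * y) ^+ 2 * (9 / (5 + 4 * nu) * (e + t) * (5 * e + (5 + 4 * nu) * t)).
  by move: (_ / _) => c; ring.
rewrite exprMn; apply: ler_wpM2l; first exact: sqr_ge0.
have h1 : 3 * (e + t) + 2 * nu * t <= 3 * (e + t).
  have : nu * t <= 0 by apply: mulr_le0_ge0 => //; (move: e0 nu1 nu2; lra).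
  by rewrite -mulrA; (move: e0 nu1 nu2; lra).
have h0 : 0 <= 3 * (e + t) + 2 * nu * t.
  rewrite (_ : _ + _ = 3 * e + (3 + 2 * nu) * t); last by ring.
  by apply: addr_ge0; [(move: e0 nu1 nu2; lra)|apply: mulr_ge0 => //; (move: e0 nu1 nu2; lra)].
apply: (@le_trans _ _ ((3 * (e + t)) ^+ 2)); first by apply: lerXn2r; rewrite ?nnegrE //; (move: e0 nu1 nu2; lra).
rewrite (_ : _ ^+ 2 = 9 / (5 + 4 * nu) * (e + t) * ((5 + 4 * nu) * (e + t))); last first.
  by field; rewrite gt_eqF.
apply: ler_wpM2l; first by rewrite mulr_ge0 ?(ltW p) // divr_ge0 ?(ltW nu1).
by rewrite mulrDr lerD2r; apply: ler_wpM2r; (move: e0 nu1 nu2; lra).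
Qed.

(** Since [nu < -1], both [2 + 2 nu] and [2 nu] are negative, so these powers of [e + s^2] are
    largest at [s = 0]. The constants depend on [e], and the bounds serve only at fixed [e]. *)
Lemma dreg_bounds s : [/\ 0 <= dG s, dG s <= 5 * Ce & dG s <= 5 * Ce * s ^+ 4].
Proof.
have p := regular_pos s e0; have s0 := sqr_ge0 s.
have s4 : s ^+ 4 = (s ^+ 2) ^+ 2 by rewrite -exprM.
have dE : dG s = s ^+ 4 * (e + s ^+ 2) `^ (2 * nu - 1) * (5 * e + (5 + 4 * nu) * s ^+ 2).
  by rewrite /dG /dreg; congr (_ * _); ring.
have x0 := powR_ge0 (e + s ^+ 2) (2 * nu - 1).
have h0 : 0 <= 5 * e + (5 + 4 * nu) * s ^+ 2.
  by apply: addr_ge0; [(move: e0 nu1 nu2; lra)|apply: mulr_ge0 => //; (move: e0 nu1 nu2; lra)].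
have s40 : 0 <= s ^+ 4 by rewrite exprn_even_ge0.
have es : e <= e + s ^+ 2 by rewrite lerDl.
have dle : dG s <= 5 * (s ^+ 4 * (e + s ^+ 2) `^ (2 * nu)).
  rewrite dE -(powRS (2 * nu) p) [leRHS](_ : _ = s ^+ 4 * (e + s ^+ 2) `^ (2 * nu - 1) * (5 * (e + s ^+ 2))).
    apply: ler_wpM2l; first by rewrite mulr_ge0.
    by rewrite mulrDr lerD2l; apply: ler_wpM2r => //; (move: e0 nu1 nu2; lra).
  by ring.
split.
- by rewrite dE mulr_ge0 // mulr_ge0.
- apply: (le_trans dle); rewrite ler_pM2l //.
  apply: (@le_trans _ _ (e `^ (2 + 2 * nu))); last by rewrite lerDl powR_ge0.
  apply: (@le_trans _ _ ((e + s ^+ 2) `^ (2 + 2 * nu))); last by apply: ler_powR_npos => //; (move: e0 nu1 nu2; lra).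
  rewrite powRD; last by rewrite (gt_eqF p) implybT.
  apply: ler_wpM2r; first exact: powR_ge0.
  by rewrite powR_mulrn ?(ltW p) // s4; apply: lerXn2r; rewrite ?nnegrE ?(ltW p) // lerDr ltW.
- apply: (le_trans dle); rewrite -mulrA ler_pM2l // mulrC; apply: ler_wpM2r => //.
  apply: (@le_trans _ _ (e `^ (2 * nu))); last by rewrite lerDr powR_ge0.
  by apply: ler_powR_npos => //; (move: e0 nu1 nu2; lra).
Qed.

Lemma reg_lipschitz a b : exists2 c, `|c| <= Num.max `|a| `|b| & G b - G a = dG c * (b - a).
Proof.
wlog ab : a b / a <= b => [W|].
  have [/W//|/ltW /W [c cab h]] := leP a b.
  by exists c; [rewrite maxC|rewrite -opprB h -mulrN opprB].
have d (x : R) : is_derive x (1 : R) G (dG x) by exact: is_derive_reg.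
have cG : {within `[a, b], continuous G}.
  by apply: continuous_subspaceT; exact: (D1_continuous (D1_reg 0 5 (2 * nu) e0)).
have [c cab h] := MVT_segment ab (fun x _ => d x) cG.
move: cab; rewrite in_itv /= => /andP[ac cb].
exists c => //; rewrite le_max.
have [c0|/ltW c0] := leP 0 c.
  by apply/orP; right; rewrite !ger0_norm // (le_trans c0).
by apply/orP; left; rewrite !ler0_norm ?lerN2 // (le_trans ac).
Qed.

(** By the mean value theorem, with the two bounds on [G'] used in turn: for [u >= 1] the uniform
    one with [u^r <= M^5], for [u <= 1] the quartic one with [u^r <= M]. Both yield total degree 6,
    which the [L^6] norm controls. *)
Lemma powR_mul_reg_sub_le u a M (r : R) : 0 < u -> u <= M -> `|a| <= M -> 1 <= r -> r <= 5 ->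
  u `^ r * `|G a - G u| <= 5 * Ce * (M ^+ 5 * `|a - u|).
Proof.
move=> u0 uM aM r1 r5; have [c cM ->] := reg_lipschitz u a.
have {}cM : `|c| <= M by apply: (le_trans cM); rewrite ge_max aM gtr0_norm // uM.
have M0 := lt_le_trans u0 uM.
have [d0 d1 d2] := dreg_bounds c.
have C0 : 0 <= Ce by rewrite addr_ge0 ?powR_ge0.
rewrite normrM (ger0_norm d0) (mulrA (u `^ r)) (mulrA (5 * Ce)); apply: ler_wpM2r => //.
have [u1|/ltW u1] := leP 1 u.
  have h : u `^ r <= M ^+ 5.
    apply: (@le_trans _ _ (u `^ 5%:R)); first by apply: ler_powR; [exact: u1|exact: r5].
    by rewrite powR_mulrn ?(ltW u0) //; apply: lerXn2r; rewrite ?nnegrE ?(ltW u0) ?(ltW M0).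
  by rewrite [leLHS]mulrC; apply: (ler_pM d0 (powR_ge0 _ _) d1 h).
rewrite (_ : 5 * Ce * M ^+ 5 = M * (5 * Ce * M ^+ 4)); last by rewrite (exprS M 4) mulrCA.
have h1 : u `^ r <= M.
  apply: (le_trans _ uM); rewrite -[leRHS](powRr1 (ltW u0)).
  by apply: ger_powR; rewrite ?u0 ?u1.
have h2 : dG c <= 5 * Ce * M ^+ 4.
  apply: (le_trans d2); apply: ler_wpM2l; first by rewrite mulr_ge0.
  rewrite (exprM _ 2 2) (exprM _ 2 2) -(real_normK (num_real c)).
  by apply: lerXn2r; rewrite ?nnegrE ?sqr_ge0 //; apply: lerXn2r; rewrite ?nnegrE ?(ltW M0).
exact: (ler_pM (powR_ge0 _ _) d0 h1 h2).
Qed.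

Lemma sqr_reg s : H s ^+ 2 = s * G s.
Proof.
by rewrite /H /G /reg exprMn -exprM sqr_powR mulrA -exprS.
Qed.

Lemma sqr_reg_le s : 0 < s -> H s ^+ 2 <= s `^ (6 + 4 * nu).
Proof.
move=> s0; have h : H s <= s `^ (3 + 2 * nu).
  rewrite powRD; last by rewrite (gt_eqF s0) implybT.
  rewrite powR_mulrn ?(ltW s0) // /H /reg; apply: ler_wpM2l; first by rewrite exprn_ge0 // ltW.
  rewrite powRrM powR_mulrn ?(ltW s0) //; apply: ler_powR_npos; [exact: exprn_gt0| |(move: e0 nu1 nu2; lra)].
  by rewrite lerDr ltW.
rewrite (_ : 6 + 4 * nu = 2 * (3 + 2 * nu)); last by ring.
rewrite -sqr_powR; apply: lerXn2r; rewrite ?nnegrE ?powR_ge0 //.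
by rewrite reg_ge0 ?ltW.
Qed.

End estimates.

(* Either [b] dominates [L * a] or the converse. *)
Lemma powR_mul_young (a b L p : R) : 0 <= a -> 0 <= b -> 0 < L -> 1 <= p ->
  a `^ (p - 1) * b <= L `^ (1 - p) * b `^ p + L * a `^ p.
Proof.
move=> a0 b0 L0 p1; have p0 : 0 <= p - 1 by lra.
have [ab|/ltW ba] := leP (L * a) b.
  apply: (@le_trans _ _ (L `^ (1 - p) * b `^ p)); last by rewrite lerDl mulr_ge0 ?powR_ge0 ?(ltW L0).
  have [->|bn0] := eqVneq b 0; first by rewrite mulr0 mulr_ge0 ?powR_ge0.
  have bp : 0 < b by rewrite lt_def bn0.
  rewrite -(powRS p bp) mulrA; apply: ler_wpM2r => //.
  rewrite -(opprB p 1) powRN mulrC ler_pdivlMr ?powR_gt0 // mulrC -powRM ?(ltW L0) //.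
  by apply: ge0_ler_powR => //; rewrite nnegrE ?mulr_ge0 // ltW.
apply: (@le_trans _ _ (L * a `^ p)); last by rewrite lerDr mulr_ge0 ?powR_ge0.
have [az|an0] := eqVneq a 0.
  have -> : b = 0 by apply/eqP; rewrite eq_le b0 andbT (le_trans ba) // az mulr0.
  by rewrite mulr0 mulr_ge0 ?powR_ge0 ?(ltW L0).
have ap : 0 < a by rewrite lt_def an0.
by rewrite -(powRS p ap) mulrCA; apply: ler_wpM2l => //; exact: powR_ge0.
Qed.

Lemma young65 (M d eta : R) : 0 < eta -> 0 <= M -> 0 <= d ->
  M ^+ 5 * d <= eta * M ^+ 6 + (eta ^+ 5)^-1 * d ^+ 6.
Proof.
move=> e0 M0 d0; have e5 : 0 < (eta ^+ 5)^-1 by rewrite invr_gt0 exprn_gt0.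
have [dM|/ltW Md] := leP d (eta * M).
  apply: (@le_trans _ _ (eta * M ^+ 6)); last by rewrite lerDl mulr_ge0 ?exprn_ge0 ?(ltW e5).
  by rewrite (exprSr M 5) mulrCA ler_wpM2l ?exprn_ge0.
apply: (@le_trans _ _ ((eta ^+ 5)^-1 * d ^+ 6)); last by rewrite lerDr mulr_ge0 ?exprn_ge0 ?(ltW e0).
rewrite (exprSr d 5) mulrA; apply: ler_wpM2r => //.
rewrite mulrC ler_pdivlMr ?exprn_gt0 // -exprMn mulrC.
by apply: lerXn2r => //; rewrite nnegrE mulr_ge0 // ltW.
Qed.

End regularized_powers.

(** * The source term and the energy of the approximants *)

Section energy.
Implicit Types (h : T3 -> R).

Lemma le_integral3_ae f h : meas f -> meas h ->
  (forall z, 0 <= f z) -> (forall z, 0 <= h z) -> {ae mu3, forall z, f z <= h z} ->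
  (\I_z (f z) <= \I_z (h z))%E.
Proof.
move=> mf mh f0 h0 fh; apply: ae_ge0_le_integral => //.
- by move=> z _; rewrite lee_fin.
- exact/measurable_EFinP.
- by move=> z _; rewrite lee_fin.
- exact/measurable_EFinP.
apply: (@filterS _ _ (ae_filter_ringOfSetsType mu3) _ _ _ fh) => z fhz _.
by rewrite lee_fin.
Qed.

Lemma partial_reg (e nu : R) m i f z : 0 < e -> differentiable f z ->
  partial i (fun z => reg e m.+1 nu (f z)) z = dreg e m nu (f z) * partial i f z.
Proof. by move=> e0 df; exact: (partial_comp_at i df (is_derive_reg m nu (f z) e0)). Qed.

Lemma test_fun3_reg (e nu : R) m f : 0 < e -> test_fun3 f ->
  test_fun3 (fun z => reg e m.+1 nu (f z)).
Proof.
move=> e0 [/smooth3P sf [M hM]]; split.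
  by apply/smooth3P => n; apply: Cn_comp => //; exact: D1_reg.
by exists M => z Mz; rewrite hM // /reg expr0n mul0r.
Qed.

Lemma measurable_reg (e nu : R) m f : 0 < e -> meas f ->
  meas (fun z => reg e m nu (f z)).
Proof.
move=> e0 mf; apply: (measurableT_comp _ mf); apply: continuous_measurable_fun.
exact: (D1_continuous (D1_reg 0 m nu e0)).
Qed.

Lemma rho_le_sqr_norm2 (z : T3) : rho z <= (1 + norm2 z.1) ^+ 2.
Proof.
have h : 0 <= z.1.1 ^+ 2 + z.1.2 ^+ 2 by rewrite addr_ge0 ?sqr_ge0.
rewrite (_ : (1 + norm2 z.1) ^+ 2 = rho z + 2 * norm2 z.1).
  by rewrite lerDl mulr_ge0 // sqrtr_ge0.
rewrite sqrrD expr1n mul1r /norm2 sqr_sqrtr // /rho mulr_natl.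
by move: (Num.sqrt _) => s; ring.
Qed.

Lemma measurable_phi_norm2 (phi : R -> R) : meas phi ->
  meas (fun z : T3 => phi (norm2 z.1)).
Proof.
move=> mphi; apply: (measurableT_comp mphi); apply: continuous_measurable3.
have -> : (fun z : T3 => norm2 z.1) = (fun z => Num.sqrt (rho z - 1)).
  by apply/funext => z; rewrite /norm2 /rho; congr Num.sqrt; ring.
have [[dr cr] _] := rho_C1; move=> z.
apply: continuous_comp; last exact: sqrt_continuous.
by apply: cvgB; [exact: C1_continuous|exact: cvg_cst].
Qed.

(** From [rho <= (1 + |x|)^2] one gets [(1 + |x|)^(-gam) <= wt gam]. *)
Lemma weight_bound (gam C : R) (phi : R -> R) : 0 < gam ->
  {ae mu3, forall z : T3, `|(1 + norm2 z.1) `^ gam * phi (norm2 z.1)| <= C} ->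
  exists2 C', 0 <= C' & {ae mu3, forall z : T3, `|phi (norm2 z.1)| <= C' * wt gam z}.
Proof.
move=> g0 hC; exists `|C|; first by [].
apply: (@filterS _ _ (ae_filter_ringOfSetsType mu3) _ _ _ hC) => z hz.
have n0 : 0 < 1 + norm2 z.1 by rewrite ltr_wpDr ?sqrtr_ge0.
have p0 : 0 < (1 + norm2 z.1) `^ gam by exact: powR_gt0.
have hw : ((1 + norm2 z.1) `^ gam)^-1 <= wt gam z.
  rewrite -powRN /wt (_ : - gam = 2 * - (gam / 2)); last by field.
  rewrite powRrM powR_mulrn ?(ltW n0) //; apply: ler_powR_npos; first exact: rho_gt0.
    exact: rho_le_sqr_norm2.
  by rewrite oppr_le0 divr_ge0 // ltW.
move: hz; rewrite normrM (gtr0_norm p0) => hz.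
apply: (@le_trans _ _ (`|C| * ((1 + norm2 z.1) `^ gam)^-1)); last exact: ler_wpM2l.
by rewrite ler_pdivlMr // mulrC (le_trans hz) // ler_norm.
Qed.

Lemma norm_mul_le (x y : R) : `|x * y| <= 3 * x ^+ 2 + 2 * (y - x) ^+ 2.
Proof.
rewrite ler_norml; have := sqr_ge0 (x - y); have := sqr_ge0 (x + y); have := sqr_ge0 (2 * x - y).
have := sqr_ge0 x; have := sqr_ge0 y; rewrite !expr2 => *.
by apply/andP; split; lra.
Qed.

(** Used with [a] the gradient of [psi k], [b] the weak gradient of [u] and [d = G'(psi k)]. The
    identity [|a|^2 = b.a + a.(a - b)] isolates the tested expression, and Young's inequality makes
    the rest small with [|a - b|]. *)
Lemma grad_energy_split (d : R) (a b : 'I_3 -> R) (eta C : R) : 0 < eta -> 0 <= d -> d <= C ->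
  d * (\sum_(i < 3) a i ^+ 2) <= \sum_(i < 3) b i * (d * a i) +
    C * (eta * (2 * \sum_(i < 3) (a i - b i) ^+ 2 + 2 * \sum_(i < 3) b i ^+ 2) +
         eta^-1 * \sum_(i < 3) (a i - b i) ^+ 2).
Proof.
move=> e0 d0 dC; have ei : 0 < eta^-1 by rewrite invr_gt0.
set V := (X in C * X).
have V0 : 0 <= V.
  have s1 : 0 <= \sum_(i < 3) (a i - b i) ^+ 2 by apply: sumr_ge0 => i _; rewrite sqr_ge0.
  have s2 : 0 <= \sum_(i < 3) b i ^+ 2 by apply: sumr_ge0 => i _; rewrite sqr_ge0.
  by rewrite /V addr_ge0 ?mulr_ge0 ?addr_ge0 ?mulr_ge0 ?(ltW e0) ?(ltW ei).
apply: (@le_trans _ _ (\sum_(i < 3) b i * (d * a i) + d * V)); last by rewrite lerD2l ler_wpM2r.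
rewrite /V !mulr_sumr -!big_split /= !mulr_sumr -!big_split /= !mulr_sumr -!big_split /=.
apply: ler_sum => i _; move: (a i) (b i) => x y.
rewrite (_ : d * x ^+ 2 = y * (d * x) + d * (x * (x - y))); last by ring.
rewrite lerD2l; apply: ler_wpM2l => //.
have h1 : x ^+ 2 <= 2 * (x - y) ^+ 2 + 2 * y ^+ 2.
  rewrite -subr_ge0 (_ : _ - _ = (x - 2 * y) ^+ 2) ?sqr_ge0 //; ring.
apply: (@le_trans _ _ (eta * x ^+ 2 + eta^-1 * (x - y) ^+ 2)); last first.
  by rewrite lerD2r; apply: ler_wpM2l => //; exact: ltW.
have -> : eta * x ^+ 2 + eta^-1 * (x - y) ^+ 2 =
    eta^-1 * ((eta * x) ^+ 2 + (x - y) ^+ 2) by field; rewrite gt_eqF.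
rewrite [leRHS]mulrC ler_pdivlMr // (_ : _ * eta = (eta * x) * (x - y)); last by ring.
move: (eta * x) (x - y) => s t.
by have := sqr_ge0 (s - t); have := sqr_ge0 s; have := sqr_ge0 t; rewrite sqrrB; lra.
Qed.

Lemma measurable_source (gam r e nu : R) f : 0 < e -> meas f ->
  meas (fun z => wt gam z * (f z `^ r * reg e 5 nu (f z))).
Proof.
move=> e0 mf; apply: measurable_funM; first exact: measurable_wt.
by apply: measurable_funM; [exact: measurable_powRf|exact: measurable_reg].
Qed.

Lemma source_ge0 (gam r e nu : R) f z : 0 <= f z ->
  0 <= wt gam z * (f z `^ r * reg e 5 nu (f z)).
Proof. by move=> f0; rewrite mulr_ge0 ?wt_ge0 // mulr_ge0 ?powR_ge0 ?reg_ge0. Qed.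

Section estimate.
Variables (gam q Cp e nu : R) (phi : R -> R) (u : T3 -> R) (g : 'I_3 -> T3 -> R).
Variables (psi : nat -> T3 -> R) (Y : R).
Hypotheses (g0 : 0 < gam) (q1 : 1 <= q - 1) (q5 : q - 1 <= 5).
Hypotheses (mphi : meas phi) (Cp0 : 0 <= Cp).
Hypothesis hphi : {ae mu3, forall z : T3, `|phi (norm2 z.1)| <= Cp * wt gam z}.
Hypotheses (Hu : D12 u g) (u0 : forall z, 0 < u z) (wu : weak_solution phi q u g).
Hypotheses (e0 : 0 < e) (nu1 : 0 < 5 + 4 * nu) (nu2 : 5 + 4 * nu < 1).
Hypothesis tpsi : forall k, test_fun3 (psi k).
Hypothesis gpsi : forall k, (\I_z (grad_dist2 (psi k) g z) <= (tk k ^+ 4)%:E)%E.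
Hypothesis upsi : forall k, (\I_z ((psi k z - u z) ^+ 6) <= (C12 * tk k ^+ 12)%:E)%E.
Hypothesis YE : (\I_z (wt gam z * (u z `^ (q - 1) * reg e 5 (2 * nu) (u z))) = Y%:E)%E.

Let Ce := 5 * (e `^ (2 + 2 * nu) + e `^ (2 * nu)).
Let Ce0 : 0 <= Ce. Proof. by rewrite mulr_ge0 // addr_ge0 ?powR_ge0. Qed.
Let mu_ : meas u. Proof. by case: Hu. Qed.
Let mg i : meas (g i). Proof. by case: Hu => _ [_ [[h _] _]]. Qed.
Let cpsi k : C1c (psi k). Proof. exact: test_fun3_C1c. Qed.
Let mpsi k : meas (psi k). Proof. exact: C1c_measurable. Qed.
Let mphin := measurable_phi_norm2 mphi.

(** With [M] the maximum of [u] and [|psi k|], the increment of [G] costs [M^5 |psi_k - u|], split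
    by Young's inequality with parameter [tk k]. The coefficients come from [M^6 <= u^6 + psi_k^6]
    and [psi_k^6 <= 64 (u^6 + (psi_k - u)^6)]. *)
Lemma source_pointwise k z :
  u z `^ (q - 1) * `|reg e 5 (2 * nu) (psi k z)| <= u z `^ (q - 1) * reg e 5 (2 * nu) (u z) +
    Ce * (tk k * (65 * u z ^+ 6 + 64 * (psi k z - u z) ^+ 6) +
          (tk k ^+ 5)^-1 * (psi k z - u z) ^+ 6).
Proof.
set M := Num.max (u z) `|psi k z|.
have uM : u z <= M by rewrite le_max lexx.
have pM : `|psi k z| <= M by rewrite le_max lexx orbT.
have h := powR_mul_reg_sub_le e0 nu1 nu2 (u0 z) uM pM q1 q5.
have M0 : 0 <= M by rewrite (le_trans _ pM).
have G0 : 0 <= reg e 5 (2 * nu) (u z) by rewrite reg_ge0 ?ltW.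
have y0 := powR_ge0 (u z) (q - 1).
apply: (@le_trans _ _ (u z `^ (q - 1) * reg e 5 (2 * nu) (u z) +
   u z `^ (q - 1) * `|reg e 5 (2 * nu) (psi k z) - reg e 5 (2 * nu) (u z)|)).
  rewrite -mulrDr; apply: ler_wpM2l => //.
  have := ler_normD (reg e 5 (2 * nu) (psi k z) - reg e 5 (2 * nu) (u z)) (reg e 5 (2 * nu) (u z)).
  by rewrite subrK (ger0_norm G0) addrC.
rewrite lerD2l; apply: (le_trans h); apply: ler_wpM2l => //.
apply: (le_trans (young65 (tk_gt0 k) M0 (normr_ge0 _))).
have d6 : `|psi k z - u z| ^+ 6 = (psi k z - u z) ^+ 6.
  by rewrite -normrX ger0_norm // exprn_even_ge0.
rewrite d6 lerD2r; apply: ler_wpM2l; first by rewrite ltW // tk_gt0.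
have p6 : psi k z ^+ 6 <= 64 * (u z ^+ 6 + (psi k z - u z) ^+ 6).
  have := pow6B (u z) (u z - psi k z); rewrite subKr.
  suff -> : (u z - psi k z) ^+ 6 = (psi k z - u z) ^+ 6 by [].
  by rewrite -[in LHS]opprB (exprM (- _) 2 3) sqrrN -exprM.
have u6 : 0 <= u z ^+ 6 by rewrite exprn_even_ge0.
have dd6 : 0 <= (psi k z - u z) ^+ 6 by rewrite exprn_even_ge0.
rewrite /M; have [_|_] := leP (u z) `|psi k z|; last by lra.
rewrite -normrX ger0_norm ?exprn_even_ge0 //; lra.
Qed.

(** The test function is [G(psi k)] while the nonlinearity is that of [u]; the mismatch costs a
    multiple of [tk k], the worst factor being [tk^-5 tk^12 = tk^7]. *)
Lemma source_le (U6 : R) k : (\I_z (u z ^+ 6) <= U6%:E)%E ->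
  (\I_z (phi (norm2 z.1) * (u z `^ (q - 1)) * reg e 5 (2 * nu) (psi k z)) <=
   (Cp * (Y + Ce * (65 * U6 + 65 * C12) * tk k))%:E)%E.
Proof.
move=> hU; have t0 := tk_gt0 k.
pose U z := u z ^+ 6; pose D z := (psi k z - u z) ^+ 6.
pose V z := wt gam z * (u z `^ (q - 1) * reg e 5 (2 * nu) (u z)).
have mr := measurable_reg (2 * nu) 5 e0 (mpsi k).
have mV : meas V by exact: measurable_source.
have mU : meas U by exact: measurable_funX.
have mD : meas D by apply: measurable_funX; exact: measurable_funB.
have mS : meas (fun z => phi (norm2 z.1) * (u z `^ (q - 1)) * reg e 5 (2 * nu) (psi k z)).
  by apply: measurable_funM => //; apply: measurable_funM => //; exact: measurable_powRf.
have V0 z : 0 <= V z by apply: source_ge0; exact: ltW.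
have U0 z : 0 <= U z by rewrite exprn_even_ge0.
have D0 z : 0 <= D z by rewrite exprn_even_ge0.
have ti : 0 <= (tk k ^+ 5)^-1 by rewrite invr_ge0 exprn_ge0 // ltW.
have c65 : 0 <= (65 : R) by []. have c64 : 0 <= (64 : R) by [].
have CC0 : 0 <= Cp * Ce by rewrite mulr_ge0 ?Ce0.
have m1 := measurable_lincomb 65 64 mU mD; have p1 := lincomb_ge0 c65 c64 U0 D0.
have m2 := measurable_lincomb (tk k) (tk k ^+ 5)^-1 m1 mD.
have p2 := lincomb_ge0 (ltW t0) ti p1 D0.
have h1 := integral3_lincomb_le mU mD U0 D0 c65 c64 hU (upsi k).
have h2 := integral3_lincomb_le m1 mD p1 D0 (ltW t0) ti h1 (upsi k).
have hV : (\I_z (V z) <= Y%:E)%E by rewrite -YE.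
have h3 := integral3_lincomb_le mV m2 V0 p2 Cp0 CC0 hV h2.
apply: (le_trans (lee_abs _)).
apply: (le_trans (le_abse_integral mu3 measurableT _)); first exact/measurable_EFinP.
apply: (le_trans (le_trans _ h3)).
  apply: le_integral3_ae.
  - exact: measurableT_comp.
  - exact: measurable_lincomb.
  - by [].
  - exact: lincomb_ge0.
  apply: (@filterS _ _ (ae_filter_ringOfSetsType mu3) _ _ _ hphi) => z hz.
  rewrite -mulrA normrM normrM (ger0_norm (powR_ge0 _ _)).
  apply: (@le_trans _ _ (Cp * wt gam z * (u z `^ (q - 1) * `|reg e 5 (2 * nu) (psi k z)|))).
    by apply: ler_wpM2r => //; rewrite mulr_ge0 ?powR_ge0.
  rewrite -(mulrA Cp Ce) -mulrDr -mulrA; apply: ler_wpM2l => //.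
  apply: (@le_trans _ _ (wt gam z * _)); first by apply: ler_wpM2l; [exact: wt_ge0|exact: source_pointwise].
  by rewrite mulrDr lerD2l ler_piMl ?wt_le1 ?(ltW g0) // mulr_ge0 ?Ce0 ?p2.
rewrite lee_fin -(mulrA Cp Ce) -mulrDr; apply: ler_wpM2l => //; rewrite lerD2l -(mulrA Ce).
apply: ler_wpM2l; first exact: Ce0.
have C0 : 0 <= C12 by rewrite /C12 sqr_ge0.
have -> : (tk k ^+ 5)^-1 * (C12 * tk k ^+ 12) = C12 * tk k ^+ 7.
  by move: C12 t0 => c; move: (tk k) => t t0; field; rewrite gt_eqF.
have h7 : C12 * tk k ^+ 7 <= C12 * tk k by rewrite ler_wpM2l ?tk_expn_le.
have h12 : tk k * (C12 * tk k ^+ 12) <= C12 * tk k.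
  by rewrite mulrCA -exprS ler_wpM2l ?tk_expn_le.
move: h7 h12; move: C12 (tk k ^+ 7) (tk k ^+ 12) (tk k) => c a b t; lra.
Qed.

Lemma integral_sqr_sum_fin : exists2 Ga : R, 0 <= Ga &
  (\I_z (\sum_(i < 3) g i z ^+ 2) = Ga%:E)%E.
Proof.
have m2 i : meas (fun z => g i z ^+ 2) by exact: measurable_funX.
apply: integral3_fin; first exact: measurable_sqr_sum.
  by move=> z; apply: sumr_ge0 => i _; rewrite sqr_ge0.
have [_ [_ [_ [gf _]]]] := Hu.
have h z : \sum_(i < 3) g i z ^+ 2 = g ord0 z ^+ 2 + (g (lift ord0 ord0) z ^+ 2 + g (lift ord0 (lift ord0 ord0)) z ^+ 2).
  by rewrite !big_ord_recl big_ord0 addr0.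
under eq_integral do rewrite h.
rewrite integral3D //; last 3 first.
- exact: measurable_funD.
- by move=> z; rewrite sqr_ge0.
- by move=> z; rewrite addr_ge0 ?sqr_ge0.
rewrite integral3D //; last 2 first.
- by move=> z; rewrite sqr_ge0.
- by move=> z; rewrite sqr_ge0.
by apply: lte_add_pinfty; [|apply: lte_add_pinfty].
Qed.

(** The equation is tested with [G(psi k)], a genuine test function. The constant [B] depends on
    [e], but it multiplies [tk k] and disappears in the limit, whereas the coefficient of [Y] is
    free of [e]. *)
Lemma dirichlet_reg_le : exists B : R, forall k,
  (dirichlet (fun z => reg e 3 nu (psi k z)) <=
   (9 / (5 + 4 * nu) * (Cp * Y + B * tk k))%:E)%E.
Proof.
have [Ga Ga0 GaE] := integral_sqr_sum_fin.
have [U6 _ U6E] := D12_L6 Hu.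
exists (Cp * (Ce * (65 * U6 + 65 * C12)) + Ce * (3 + 2 * Ga)) => k.
have t0 := tk_gt0 k.
have ti : 0 < (tk k)^-1 by rewrite invr_gt0.
have [dps pps _] := cpsi k.
pose D z := dreg e 4 (2 * nu) (psi k z).
have [D0 DC] : (forall z, 0 <= D z) /\ (forall z, D z <= Ce).
  by split=> z; have [h1 h2 _] := dreg_bounds e0 nu1 nu2 (psi k z).
have mD : meas D.
  apply: (measurableT_comp _ (mpsi k)); apply: continuous_measurable_fun.
  exact: dreg_continuous.
have mp i : meas (partial i (psi k)) by exact: C1c_measurable_partial.
pose S z := \sum_(i < 3) partial i (psi k) z ^+ 2.
pose ga z := \sum_(i < 3) g i z ^+ 2.
pose gd := grad_dist2 (psi k) g.
have mS : meas S by exact: measurable_sqr_sum.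
have mga : meas ga by exact: measurable_sqr_sum.
have mgd : meas gd by exact: measurable_grad_dist2.
have S0 z : 0 <= S z by apply: sumr_ge0 => i _; rewrite sqr_ge0.
have ga0 z : 0 <= ga z by apply: sumr_ge0 => i _; rewrite sqr_ge0.
have gd0 z : 0 <= gd z by exact: grad_dist2_ge0.
pose f2 z := \sum_(i < 3) g i z * (D z * partial i (psi k) z).
have mf2 : meas f2.
  by apply: measurable_sum => i; apply: measurable_funM => //; exact: measurable_funM.
have f2E : (\I_z (f2 z) <= (Cp * (Y + Ce * (65 * U6 + 65 * C12) * tk k))%:E)%E.
  have := wu (test_fun3_reg (2 * nu) 4 e0 (tpsi k)).
  under eq_integral do under eq_bigr do rewrite (partial_reg (2 * nu) 4 _ e0 (dps _)).
  move=> ->; apply: source_le; by rewrite U6E.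
have c2 : 0 <= (2 : R) by []. have c3 : 0 <= (3 : R) by [].
have gaE : (\I_z (ga z) <= Ga%:E)%E by rewrite GaE.
have If2 : mu3.-integrable setT (EFin \o f2).
  apply: (@le_integrable3 f2 (fun z => Ce * (3 * ga z + 2 * gd z))) => //.
  - by apply: measurable_funM; [exact: measurable_cst|exact: measurable_lincomb].
  - move=> z; apply: (le_trans (ler_norm_sum _ _ _)).
    rewrite /ga /gd /grad_dist2 !mulr_sumr -big_split /= mulr_sumr; apply: ler_sum => i _.
    rewrite normrM normrM (ger0_norm (D0 z)) mulrCA.
    apply: ler_pM => //.
    by rewrite -normrM; exact: norm_mul_le.
  - rewrite (integral3Z (measurable_lincomb _ _ mga mgd) Ce0 (lincomb_ge0 c3 c2 ga0 gd0)).
    apply: lte_mul_pinfty; rewrite ?lee_fin ?Ce0 //.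
    by apply: (le_lt_trans (integral3_lincomb_le mga mgd ga0 gd0 c3 c2 gaE (gpsi k))); rewrite ltry.
(* The error term of [grad_energy_split] with [eta = tk k]: the inverse power is harmless because
   [tk^-1 tk^4 = tk^3]. *)
pose b z := Ce * (tk k * (2 * gd z + 2 * ga z) + (tk k)^-1 * gd z).
have m1 := measurable_lincomb 2 2 mgd mga; have p1 := lincomb_ge0 c2 c2 gd0 ga0.
have m2 := measurable_lincomb (tk k) (tk k)^-1 m1 mgd.
have p2 := lincomb_ge0 (ltW t0) (ltW ti) p1 gd0.
have mb : meas b by exact: measurable_funM (measurable_cst _) m2.
have b0 z : 0 <= b z by apply: mulr_ge0; [exact: Ce0|exact: p2].
have bE : (\I_z (b z) <= (Ce * (3 + 2 * Ga) * tk k)%:E)%E.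
  rewrite (integral3Z m2 Ce0 p2) -(mulrA Ce) [leRHS]EFinM.
  apply: lee_wpmul2l; first by rewrite lee_fin Ce0.
  have h1 := integral3_lincomb_le mgd mga gd0 ga0 c2 c2 (gpsi k) gaE.
  apply: (le_trans (integral3_lincomb_le m1 mgd p1 gd0 (ltW t0) (ltW ti) h1 (gpsi k))); rewrite lee_fin.
  have -> : (tk k)^-1 * tk k ^+ 4 = tk k ^+ 3.
    by move: t0; move: (tk k) => t t0; field; rewrite gt_eqF.
  have h3 : tk k ^+ 3 <= tk k by exact: tk_expn_le.
  have h4 : tk k * tk k ^+ 4 <= tk k by rewrite -exprS tk_expn_le.
  move: h3 h4; move: (tk k ^+ 3) (tk k ^+ 4) (tk k) => x y t; lra.
have Ib : mu3.-integrable setT (EFin \o b).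
  apply: (@le_integrable3 b b) => //; first by move=> z; rewrite ger0_norm.
  by apply: (le_lt_trans bE); rewrite ltry.
have f1b z : D z * S z <= f2 z + b z.
  exact: (grad_energy_split (fun i => partial i (psi k) z) (fun i => g i z) t0 (D0 z) (DC z)).
have mDS : meas (fun z => D z * S z) by exact: measurable_funM.
have nn0 : 0 <= 9 / (5 + 4 * nu) by rewrite divr_ge0 ?(ltW nu1).
have DS0 z : 0 <= D z * S z by exact: mulr_ge0.
apply: (@le_trans _ _ (\I_z (9 / (5 + 4 * nu) * (D z * S z)))%E).
  have cH : C1c (fun z => reg e 3 nu (psi k z)).
    exact: test_fun3_C1c (test_fun3_reg nu 2 e0 (tpsi k)).
  apply: le_integral3.
  - by apply: measurable_sqr_sum => i; exact: C1c_measurable_partial.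
  - exact: measurable_funM (measurable_cst _) mDS.
  - by move=> z; apply: sumr_ge0 => i _; rewrite sqr_ge0.
  - move=> z; rewrite /S !mulr_sumr; apply: ler_sum => i _.
    rewrite (partial_reg nu 2 i e0 (dps z)) exprMn [leRHS]mulrA.
    by apply: ler_wpM2r; [exact: sqr_ge0|exact: sqr_dreg_le].
rewrite (integral3Z mDS nn0 DS0) [leRHS]EFinM; apply: lee_wpmul2l; first by rewrite lee_fin.
apply: (@le_trans _ _ (\I_z (f2 z + b z))%E).
  by apply: le_integral3 => //; exact: measurable_funD.
have -> : (\I_z (f2 z + b z) = \I_z (f2 z) + \I_z (b z))%E.
  exact: (integralD measurableT If2 Ib).
apply: (le_trans (leeD f2E bE)); rewrite -EFinD lee_fin.
rewrite [leLHS](_ : _ = Cp * Y + (Cp * (Ce * (65 * U6 + 65 * C12)) + Ce * (3 + 2 * Ga)) * tk k) //.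
by move: Ce C12 (tk k) => c d t; ring.
Qed.

End estimate.
End energy.

(** * Absorption and finite mass *)

Section absorption.
Implicit Types (h : T3 -> R).

Lemma tk_eventually_le (d : R) : 0 < d -> \forall n \near \oo, tk n <= d.
Proof.
move=> d0; have [k hk] := half_pow_le d0.
by exists k => // n /= kn; exact: le_trans (tk_le kn) hk.
Qed.

Lemma cvg_tk : tk n @[n --> \oo] --> 0.
Proof.
apply/cvgrPdist_le => d d0; apply: filterS (tk_eventually_le d0) => n hn.
by rewrite sub0r normrN ger0_norm // ltW // tk_gt0.
Qed.

Lemma measurable_wt_powR (gam p : R) h : meas h ->
  meas (fun z => wt gam z * (h z ^+ 2) `^ p).
Proof.
move=> mh; apply: measurable_funM; first exact: measurable_wt.
by apply: measurable_powRf; exact: measurable_funX.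
Qed.

Lemma wt_powR_ge0 (gam p : R) h z : 0 <= wt gam z * (h z ^+ 2) `^ p.
Proof. by rewrite mulr_ge0 ?wt_ge0 ?powR_ge0. Qed.

(** Fatou's lemma along the sequence. Eventually [B tk k <= 1], whence the bound at energy [a + 1],
    which is also positive as scaling requires. *)
Lemma weighted_limit (gam C a B : R) (h_ : nat -> T3 -> R) h : gam < 3 -> 0 <= C ->
  weighted gam C -> 0 <= a -> (forall k, C1c (h_ k)) -> meas h ->
  {ae mu3, forall z, h_ ^~ z @ \oo --> h z} ->
  (forall k, (dirichlet (h_ k) <= (a + B * tk k)%:E)%E) ->
  (\I_z (wt gam z * (h z ^+ 2) `^ (3 - gam)) <= (C * (a + 1) `^ (3 - gam))%:E)%E.
Proof.
move=> g3 C0 W a0 ch mh hh dh.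
apply: (@fatou_le (fun k z => wt gam z * (h_ k z ^+ 2) `^ (3 - gam))).
- by move=> k; apply: measurable_wt_powR; exact: C1c_measurable.
- exact: measurable_wt_powR.
- by move=> k z; exact: wt_powR_ge0.
- apply: (@filterS _ _ (ae_filter_ringOfSetsType mu3) _ _ _ hh) => z hz.
  apply: cvgMr; have p0 : 0 < 3 - gam by lra.
  exact: (cvg_comp _ _ hz (continuous_sqr_powR p0 (x := h z))).
have B1 : 0 < `|B| + 1 by rewrite ltr_wpDl.
apply: filterS (tk_eventually_le (divr_gt0 ltr01 B1)) => k hk.
have N0 : 0 < Num.sqrt (a + 1) by rewrite sqrtr_gt0; lra.
have NE : Num.sqrt (a + 1) ^+ 2 = a + 1 by rewrite sqr_sqrtr; lra.
rewrite -NE; apply: weighted_scale => //; rewrite NE; apply: (le_trans (dh k)).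
rewrite lee_fin lerD2l; move: hk; rewrite ler_pdivlMr // => hk.
have t0 := tk_gt0 k.
have : B * tk k <= `|B| * tk k by rewrite ler_wpM2r ?(ltW t0) // ler_norm.
by move: hk; rewrite mulrDr mulr1 (mulrC _ `|B|); lra.
Qed.

Lemma measurable_lt_cst f (d : R) : meas f -> measurable [set z | f z < d].
Proof.
move=> mf; have -> : [set z | f z < d] = f @^-1` `]-oo, d[.
  by apply/seteqP; split=> z /=; rewrite in_itv.
by rewrite -[X in measurable X]setTI; exact: mf.
Qed.

(** As [f] is positive everywhere, the sets [{f < tk n}] eventually leave out every point, and
    dominated convergence applies. *)
Lemma small_values_tail f h (b : R) : (forall z, 0 < f z) -> meas f ->
  (forall z, 0 <= h z) -> meas h -> (\I_z (h z) < +oo)%E -> 0 < b ->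
  exists2 d : R, 0 < d <= 1 &
    (\I_z (h z * \1_[set z | f z < d] z) <= b%:E)%E.
Proof.
move=> f0 mf h0 mh hoo b0.
have m1 (d : R) : meas (\1_[set z | f z < d] : T3 -> R).
  by apply: measurable_indic; exact: measurable_lt_cst.
pose f_ n z := h z * \1_[set z | f z < tk n] z.
have mf_ n : meas (f_ n) by exact: measurable_funM.
have cv : (\I_z (f_ n z))%E @[n --> \oo] --> 0%E.
  rewrite -[X in _ --> X](@integral0 _ _ _ mu3 setT).
  apply: (@dominated_cvg _ _ _ mu3 setT measurableT (fun n z => (f_ n z)%:E) (cst 0%E) (fun z => (h z)%:E)).
  - by move=> n; apply/measurable_EFinP; exact: mf_.
  - move=> z _; apply: cvg_near_cst.
    have [k hk] := half_pow_le (f0 z).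
    exists k => // n /= kn; rewrite /f_ indicE.
    have : tk n <= f z by exact: le_trans (tk_le kn) hk.
    by move=> hn; rewrite memNset ?mulr0 //= => /(le_lt_trans hn); rewrite ltxx.
  - by [].
  - apply/integrableP; split; first exact/measurable_EFinP.
    by under eq_integral do rewrite /= ger0_norm //.
  - move=> n z _; rewrite abse_EFin lee_fin /f_ ger0_norm; last by rewrite mulr_ge0 // indicE.
    by rewrite ler_piMr // indicE; case: (_ \in _).
have [n hn] := cvge0_exists_le cv b0.
by exists (tk n); rewrite ?tk_gt0 ?tk_le1.
Qed.

Lemma powR_large_small (x r d : R) : 0 < d -> d <= x -> r <= 6 -> x `^ r <= d `^ (r - 6) * x ^+ 6.
Proof.
move=> d0 dx r6; have x0 := lt_le_trans d0 dx.
rewrite -(powR_mulrn 6 (ltW x0)) [leLHS](_ : _ = x `^ (r - 6) * x `^ 6%:R).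
  by apply: ler_wpM2r; [exact: powR_ge0|apply: ler_powR_npos => //; lra].
by rewrite -powRD ?subrK // (gt_eqF x0) implybT.
Qed.

Section absorb_pointwise.
Variables (gam q e nu d L N : R).
Hypotheses (g2 : gam < 2) (hq : 2 * (3 - gam) < q) (q6 : q < 6).
Hypotheses (e0 : 0 < e) (nu1 : 0 < 5 + 4 * nu) (nu2 : 5 + 4 * nu < 1).
Hypotheses (d0 : 0 < d) (d1 : d <= 1) (L0 : 0 < L) (N0 : 0 < N).

(** The absorption inequality before integration. [N] is to be the bound on the energy of [H(u)]:
    the factor [N^-p] then compensates the power produced by the Hardy-Sobolev inequality, and the
    right-hand side is linear in [N]. *)
Lemma powR_mul_reg_le (x w : R) : 0 < x -> 0 <= w -> w <= 1 ->
  w * (x `^ (q - 1) * reg e 5 (2 * nu) x) <=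
  d `^ (q - 2 + (6 + 4 * nu) - 6) * x ^+ 6 +
  N * (L `^ (1 - (3 - gam)) * (N `^ (3 - gam))^-1 * (w * (reg e 3 nu x ^+ 2) `^ (3 - gam)) +
       L * ((w * (x ^+ 2) `^ (3 - gam)) * (x < d)%R%:R)).
Proof.
move=> x0 w0 w1; have x6 : 0 <= x ^+ 6 by rewrite exprn_even_ge0.
have GH : x `^ (q - 1) * reg e 5 (2 * nu) x = x `^ (q - 2) * reg e 3 nu x ^+ 2.
  rewrite sqr_reg mulrA; congr (_ * _).
  by rewrite -(powRS (q - 1) x0); congr (_ `^ _ * _); ring.
have H2 := sqr_reg_le e0 nu1 nu2 x0; have H0 := sqr_ge0 (reg e 3 nu x).
rewrite GH; set A := d `^ _; have A0 : 0 <= A by exact: powR_ge0.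
have [dx|xd] := leP d x.
  apply: (@le_trans _ _ (A * x ^+ 6)); last first.
    rewrite lerDl mulr_ge0 ?(ltW N0) // mulr0 mulr0 addr0 mulr_ge0 //.
      by rewrite mulr_ge0 ?powR_ge0 // invr_ge0 powR_ge0.
    by rewrite mulr_ge0 ?powR_ge0.
  apply: (@le_trans _ _ (x `^ (q - 2) * reg e 3 nu x ^+ 2)).
    by rewrite ler_piMl // mulr_ge0 ?powR_ge0.
  apply: (@le_trans _ _ (x `^ (q - 2 + (6 + 4 * nu)))).
    rewrite [leRHS]powRD; last by rewrite (gt_eqF x0) implybT.
    by apply: ler_wpM2l => //; exact: powR_ge0.
  (* The exponent is below 6 because [q < 6] and [4 nu < -4]. *)
  by apply: powR_large_small => //; move: q6 nu2; lra.
(* Below [d <= 1] the power [q - 2] may be lowered to [2(p - 1)]; Young's inequality is then applied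
   to [x^2] and [H^2/N]. *)
apply: (@le_trans _ _ (N * (w * ((x ^+ 2) `^ (3 - gam - 1) * (reg e 3 nu x ^+ 2 / N))))).
  rewrite [leRHS](_ : _ = w * ((x ^+ 2) `^ (3 - gam - 1) * reg e 3 nu x ^+ 2)); last first.
    by rewrite mulrCA; congr (_ * _); rewrite mulrCA; congr (_ * _); rewrite mulrCA divff ?mulr1 // gt_eqF.
  apply: ler_wpM2l => //; apply: ler_wpM2r => //.
  rewrite -(powR_mulrn 2 (ltW x0)) -powRrM; apply: ger_powR; first by rewrite x0 (le_trans (ltW xd)).
  by move: hq; lra.
apply: (@le_trans _ _ (N * (L `^ (1 - (3 - gam)) * (N `^ (3 - gam))^-1 *
    (w * (reg e 3 nu x ^+ 2) `^ (3 - gam)) + L * (w * (x ^+ 2) `^ (3 - gam) * 1)))); last first.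
  by rewrite lerDr mulr_ge0.
rewrite mulr1; apply: ler_wpM2l; first exact: ltW.
have p1 : 1 <= 3 - gam by move: g2; lra.
have Hn : 0 <= reg e 3 nu x ^+ 2 / N by rewrite divr_ge0 ?(ltW N0).
have := ler_wpM2l w0 (powR_mul_young (sqr_ge0 x) Hn L0 p1).
move=> /le_trans; apply.
rewrite powRM //; last by rewrite invr_ge0 ltW.
rewrite -[N^-1]powR_inv1 ?(ltW N0) // -powRrM mulN1r powRN.
rewrite le_eqVlt; apply/orP; left; apply/eqP.
move: (L `^ _) => a; move: (N `^ _)^-1 => b; move: (_ `^ _) (_ `^ _) => c c'; ring.
Qed.

End absorb_pointwise.
End absorption.

(** * Uniform bound and removal of the regularisation *)

Section finite_mass.
Variables (gam q Cp Cw nu : R) (phi : R -> R) (u : T3 -> R) (g : 'I_3 -> T3 -> R).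
Variable psi : nat -> T3 -> R.
Hypotheses (g0 : 0 < gam) (g2 : gam < 2) (hq : 2 * (3 - gam) < q) (q6 : q < 6).
Hypotheses (mphi : meas phi) (Cp0 : 0 <= Cp).
Hypothesis hphi : {ae mu3, forall z : T3, `|phi (norm2 z.1)| <= Cp * wt gam z}.
Hypotheses (Hu : D12 u g) (u0 : forall z, 0 < u z) (wu : weak_solution phi q u g).
Hypotheses (nu1 : 0 < 5 + 4 * nu) (nu2 : 5 + 4 * nu < 1).
Hypotheses (Cw0 : 0 <= Cw) (W : weighted gam Cw).
Hypothesis tpsi : forall k, test_fun3 (psi k).
Hypothesis gpsi : forall k, (\I_z (grad_dist2 (psi k) g z) <= (tk k ^+ 4)%:E)%E.
Hypothesis upsi : forall k, (\I_z ((psi k z - u z) ^+ 6) <= (C12 * tk k ^+ 12)%:E)%E.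
Hypothesis apsi : {ae mu3, forall z, psi ^~ z @ \oo --> u z}.

Let mu_ : meas u. Proof. by case: Hu. Qed.
Let mg i : meas (g i). Proof. by case: Hu => _ [_ [[h _] _]]. Qed.
Let cpsi k : C1c (psi k). Proof. exact: test_fun3_C1c. Qed.
Let q1 : 1 <= q - 1. Proof. move: hq g2; lra. Qed.
Let q5 : q - 1 <= 5. Proof. move: q6; lra. Qed.
Let g3 : gam < 3. Proof. move: g2; lra. Qed.

(** The approximants have bounded energy, so the Hardy-Sobolev inequality passes to [u] itself. This
    finiteness is what makes the contribution of small values of [u] small. *)
Lemma weighted_solution_fin : (\I_z (wt gam z * (u z ^+ 2) `^ (3 - gam)) < +oo)%E.
Proof.
have [Ga Ga0 GaE] := integral_sqr_sum_fin Hu.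
have mga : meas (fun z => \sum_(i < 3) g i z ^+ 2) by exact: measurable_sqr_sum.
have c2 : 0 <= (2 : R) by [].
have h k : (dirichlet (psi k) <= (2 * Ga + 2 * tk k)%:E)%E.
  have mgd : meas (grad_dist2 (psi k) g) by exact: measurable_grad_dist2.
  have gd0 z : 0 <= grad_dist2 (psi k) g z by exact: grad_dist2_ge0.
  have ga0 z : 0 <= \sum_(i < 3) g i z ^+ 2 by apply: sumr_ge0 => i _; rewrite sqr_ge0.
  have gaE : (\I_z (\sum_(i < 3) g i z ^+ 2) <= Ga%:E)%E by rewrite GaE.
  have gdE : (\I_z (grad_dist2 (psi k) g z) <= (tk k)%:E)%E.
    by apply: (le_trans (gpsi k)); rewrite lee_fin tk_expn_le.
  apply: (le_trans _ (integral3_lincomb_le mga mgd ga0 gd0 c2 c2 gaE gdE)); apply: le_integral3.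
  - by apply: measurable_sqr_sum => i; exact: C1c_measurable_partial.
  - exact: measurable_lincomb.
  - by move=> z; apply: sumr_ge0 => i _; rewrite sqr_ge0.
  - move=> z; rewrite /grad_dist2 -mulrDr -big_split /= mulr_sumr; apply: ler_sum => i _.
    move: (partial i (psi k) z) (g i z) => x y.
    by rewrite -subr_ge0 (_ : _ - _ = (x - 2 * y) ^+ 2) ?sqr_ge0 //; ring.
have a0 : 0 <= 2 * Ga by rewrite mulr_ge0.
apply: (le_lt_trans (weighted_limit g3 Cw0 W a0 cpsi mu_ apsi h)).
by rewrite ltry.
Qed.

Let K := 9 / (5 + 4 * nu) * Cp.
Let K0 : 0 <= K. Proof. by rewrite mulr_ge0 // divr_ge0 // ltW. Qed.

Section fixed_regularization.
Variable e : R.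
Hypothesis e0 : 0 < e.

Let G z := wt gam z * (u z `^ (q - 1) * reg e 5 (2 * nu) (u z)).

(** Comparison of [G] at [u] with [G(0) = 0] bounds the integrand by a multiple of [u^6]. The
    multiple depends on [e]; only finiteness is retained, for the absorption. *)
Lemma source_fin : exists2 Y : R, 0 <= Y & (\I_z (G z) = Y%:E)%E.
Proof.
have [U6 _ U6E] := D12_L6 Hu.
have mG : meas G by exact: measurable_source.
have G0 z : 0 <= G z by apply: source_ge0; exact: ltW.
apply: integral3_fin => //.
pose C := 5 * (e `^ (2 + 2 * nu) + e `^ (2 * nu)).
have C0 : 0 <= C by rewrite mulr_ge0 // addr_ge0 ?powR_ge0.
have mu6 : meas (fun z => u z ^+ 6) by exact: measurable_funX.
apply: (@le_lt_trans _ _ (\I_z (C * u z ^+ 6))%E).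
  apply: le_integral3.
  - exact: mG.
  - exact: measurable_funM (measurable_cst _) mu6.
  - exact: G0.
  move=> z; have := powR_mul_reg_sub_le e0 nu1 nu2 (u0 z) (lexx _) _ q1 q5 (a := 0).
  rewrite normr0 (ltW (u0 z)) sub0r normrN (gtr0_norm (u0 z)) => /(_ isT).
  rewrite {1}/reg expr0n mul0r sub0r normrN -exprSr ger0_norm ?reg_ge0 ?(ltW (u0 z)) //.
  apply: le_trans; rewrite /G ler_piMl ?wt_le1 ?(ltW g0) //.
  by rewrite mulr_ge0 ?powR_ge0 ?reg_ge0 ?ltW.
rewrite (integral3Z mu6 C0); last by move=> z; rewrite exprn_even_ge0.
by rewrite U6E -EFinM ltry.
Qed.

Lemma weighted_reg_le (Y : R) : 0 <= Y -> (\I_z (G z) = Y%:E)%E ->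
  (\I_z (wt gam z * (reg e 3 nu (u z) ^+ 2) `^ (3 - gam)) <=
   (Cw * (K * Y + 1) `^ (3 - gam))%:E)%E.
Proof.
move=> Y0 YE.
have [B hB] := dirichlet_reg_le g0 q1 q5 mphi Cp0 hphi Hu u0 wu e0 nu1 nu2 tpsi gpsi upsi YE.
apply: (weighted_limit g3 Cw0 W _ (B := 9 / (5 + 4 * nu) * B)
   (h_ := fun k z => reg e 3 nu (psi k z)) (h := fun z => reg e 3 nu (u z))).
- exact: mulr_ge0.
- by move=> k; exact: test_fun3_C1c (test_fun3_reg nu 2 e0 (tpsi k)).
- exact: measurable_reg.
- apply: (@filterS _ _ (ae_filter_ringOfSetsType mu3) _ _ _ apsi) => z hz.
  exact: (cvg_comp _ _ hz (D1_continuous (D1_reg 0 3 nu e0) (x := u z))).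
- by move=> k; apply: (le_trans (hB k)); rewrite lee_fin /K mulrDr !mulrA.
Qed.

End fixed_regularization.

(** The numbers [b], [L] and [d] are fixed before [e] is introduced. Both Young terms are then at
    most [b N], and the resulting inequality is solved for [Y]. *)
Lemma source_uniform : exists Yb : R, forall (e Y : R), 0 < e -> 0 <= Y ->
  (\I_z (wt gam z * (u z `^ (q - 1) * reg e 5 (2 * nu) (u z))) = Y%:E)%E -> Y <= Yb.
Proof.
have [U6 U60 U6E] := D12_L6 Hu.
pose p := 3 - gam; have p1 : 0 < p - 1 by rewrite /p; move: g2; lra.
(* Chosen so that [2 b N = (K Y + 1) / (2 (K + 1))] is at most [(Y + 1)/2]. *)
pose b := (4 * (K + 1))^-1.
have b0 : 0 < b by rewrite invr_gt0 mulr_gt0 // ltr_wpDl.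
(* Solves [L^(1-p) (Cw + 1) = b]; the added 1 keeps [L] positive when [Cw] vanishes. *)
pose L := ((Cw + 1) / b) `^ (p - 1)^-1.
have Lb0 : 0 < (Cw + 1) / b by rewrite divr_gt0 // ltr_wpDl.
have L0 : 0 < L by exact: powR_gt0.
have LC : L `^ (1 - p) * Cw <= b.
  rewrite -(opprB p 1) powRN /L -powRrM mulVf ?gt_eqF // powRr1 ?(ltW Lb0) //.
  rewrite invf_div mulrAC ler_pdivrMr ?ltr_wpDl // ler_wpM2l ?(ltW b0) //; lra.
pose h z := wt gam z * (u z ^+ 2) `^ p.
have mh : meas h by exact: measurable_wt_powR.
have h0 z : 0 <= h z by exact: wt_powR_ge0.
(* The tail is asked to be at most [b / L], since it enters with the factor [L]. *)
have [d /andP[d0 d1] hd] := small_values_tail u0 mu_ h0 mh weighted_solution_fin (divr_gt0 b0 L0).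
pose A := d `^ (q - 2 + (6 + 4 * nu) - 6).
have A0 : 0 <= A by exact: powR_ge0.
exists (2 * (A * U6) + 1) => e Y e0 Y0 YE.
have X := weighted_reg_le e0 Y0 YE.
have N0 : 0 < K * Y + 1 by rewrite ltr_wpDl // mulr_ge0.
set N := K * Y + 1 in N0 X.
have Np : 0 < N `^ p by exact: powR_gt0.
pose H z := wt gam z * (reg e 3 nu (u z) ^+ 2) `^ p.
have mH : meas H by apply: measurable_wt_powR; exact: measurable_reg.
have H0 z : 0 <= H z by exact: mulr_ge0 (wt_ge0 _ _) (powR_ge0 _ _).
pose c := L `^ (1 - p) * (N `^ p)^-1.
have c0 : 0 <= c by rewrite mulr_ge0 ?powR_ge0 // invr_ge0 ltW.
pose t z := h z * \1_[set z | u z < d] z.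
have mt : meas t.
  by apply: measurable_funM => //; apply: measurable_indic; exact: measurable_lt_cst.
have t0 z : 0 <= t z by rewrite mulr_ge0 // indicE.
have mu6 : meas (fun z => u z ^+ 6) by exact: measurable_funX.
have u6 z : 0 <= u z ^+ 6 by rewrite exprn_even_ge0.
have m1 := measurable_lincomb c L mH mt; have n1 := lincomb_ge0 c0 (ltW L0) H0 t0.
have m2 := measurable_lincomb A N mu6 m1.
have U6E' : (\I_z (u z ^+ 6) <= U6%:E)%E by rewrite U6E.
have h1 := integral3_lincomb_le mH mt H0 t0 c0 (ltW L0) X hd.
have h2 := integral3_lincomb_le mu6 m1 u6 n1 A0 (ltW N0) U6E' h1.
have : (Y%:E <= (A * U6 + N * (b + b))%:E)%E.
  rewrite -YE; apply: (le_trans (le_trans _ h2)).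
    apply: le_integral3 => //; [exact: measurable_source|by move=> z; apply: source_ge0; exact: ltW|move=> z].
    have := powR_mul_reg_le g2 hq q6 e0 nu1 nu2 d0 d1 L0 N0 (u0 z) (wt_ge0 gam z) (wt_le1 z (ltW g0)).
    move/le_trans; apply; rewrite lerD2l; apply: ler_wpM2l; first exact: ltW.
    rewrite lerD2l; apply: ler_wpM2l; first exact: ltW.
    rewrite /t indicE /h; apply: ler_wpM2l; first exact: wt_powR_ge0.
    by case: (boolP (u z < d)) => // ud; rewrite mem_set.
  rewrite lee_fin lerD2l; apply: ler_wpM2l; first exact: ltW.
  rewrite [L * _]mulrCA divff ?gt_eqF // mulr1 lerD2r (_ : c * _ = L `^ (1 - p) * Cw) //.
  by rewrite /c mulrACA mulVf ?mulr1 // gt_eqF.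
rewrite lee_fin => hY.
have hb : N * (b + b) <= 2^-1 * (Y + 1).
  have K1 : 0 < K + 1 by rewrite ltr_wpDl.
  have -> : b + b = 2^-1 * (K + 1)^-1 by rewrite /b; move: K1; move: (K + 1) => k k0; field; rewrite gt_eqF.
  rewrite mulrCA ler_pM2l ?invr_gt0 // ler_pdivrMr // /N.
  have : 0 <= K * 1 + Y by rewrite addr_ge0 // mulr1.
  by rewrite mulrDl !mulrDr; move: (K * Y) (Y * K) (mulrC K Y) => x y ->; lra.
by move: hY hb; move: (A * U6) (N * (b + b)) => x y; lra.
Qed.

Let measurable_weighted_power :
  meas (fun z => wt gam z * (reg 0 3 nu (u z) ^+ 2) `^ (3 - gam)).
Proof.
apply: measurable_wt_powR; apply: measurable_funM; first exact: measurable_funX.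
apply: measurable_powRf; apply: measurable_funD; first exact: measurable_cst.
exact: measurable_funX.
Qed.

(* For [5 + 4 * nu = (2 - gam) / (3 - gam)] the integrand is [wt gam z * u z `^ (2 * (3 - gam) - 1)]. *)
Lemma weighted_power_fin :
  (\I_z (wt gam z * (reg 0 3 nu (u z) ^+ 2) `^ (3 - gam)) < +oo)%E.
Proof.
have [Yb hYb] := source_uniform.
have p0 : 0 < 3 - gam by move: g2; lra.
apply: (@le_lt_trans _ _ (Cw * (K * Yb + 1) `^ (3 - gam))%:E); last by rewrite ltry.
apply: (@fatou_le (fun n z => wt gam z * (reg (tk n) 3 nu (u z) ^+ 2) `^ (3 - gam))).
- by move=> n; apply: measurable_wt_powR; apply: measurable_reg => //; exact: tk_gt0.
- exact: measurable_weighted_power.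
- by move=> n z; exact: mulr_ge0 (wt_ge0 _ _) (powR_ge0 _ _).
- apply: aeW => z; apply: cvgMr.
  have s0 : 0 < 0 + u z ^+ 2 by rewrite add0r exprn_gt0.
  have hc : reg (tk n) 3 nu (u z) @[n --> \oo] --> reg 0 3 nu (u z).
    apply: cvgMr.
    have c1 : tk n + u z ^+ 2 @[n --> \oo] --> 0 + u z ^+ 2.
      by apply: cvgD; [exact: cvg_tk|exact: cvg_cst].
    have [dp _] := is_derive1_powR nu s0.
    have c2 : {for 0 + u z ^+ 2, continuous (fun x : R => x `^ nu)}.
      by apply: differentiable_continuous; apply/derivable1_diffP.
    exact: (cvg_comp _ _ c1 c2).
  exact: (cvg_comp _ _ hc (continuous_sqr_powR p0 (x := reg 0 3 nu (u z)))).
apply: nearW => n; have t0 := tk_gt0 n.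
have [Y Y0 YE] := source_fin t0.
apply: (le_trans (weighted_reg_le t0 Y0 YE)); rewrite lee_fin; apply: ler_wpM2l => //.
have YY := hYb _ _ t0 Y0 YE.
apply: ge0_ler_powR; [exact: ltW| | |by rewrite lerD2r ler_wpM2l].
- by rewrite nnegrE addr_ge0 // mulr_ge0.
- by rewrite nnegrE addr_ge0 // mulr_ge0 // (le_trans Y0).
Qed.

Lemma finite_mass : (6 + 4 * nu) * (3 - gam) <= q - 1 ->
  (\I_z (`|phi (norm2 z.1)| * (u z `^ (q - 1))) < +oo)%E.
Proof.
move=> nuq; have [U6 U60 U6E] := D12_L6 Hu.
pose H z := wt gam z * (reg 0 3 nu (u z) ^+ 2) `^ (3 - gam).
have mH : meas H by exact: measurable_weighted_power.
have H0 z : 0 <= H z by exact: mulr_ge0 (wt_ge0 _ _) (powR_ge0 _ _).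
have mu6 : meas (fun z => u z ^+ 6) by exact: measurable_funX.
have u6 z : 0 <= u z ^+ 6 by rewrite exprn_even_ge0.
have ms : meas (fun z => u z ^+ 6 + H z) by exact: measurable_funD.
have n0 z : 0 <= u z ^+ 6 + H z by exact: addr_ge0.
apply: (@le_lt_trans _ _ (\I_z (Cp * (u z ^+ 6 + H z)))%E).
  apply: le_integral3_ae.
  - apply: measurable_funM; last exact: measurable_powRf.
    by apply: measurableT_comp => //; exact: measurable_phi_norm2.
  - exact: measurable_funM (measurable_cst _) ms.
  - by move=> z; rewrite mulr_ge0 ?powR_ge0.
  - by move=> z; rewrite mulr_ge0.
  apply: (@filterS _ _ (ae_filter_ringOfSetsType mu3) _ _ _ hphi) => z hz.
  apply: (@le_trans _ _ (Cp * wt gam z * u z `^ (q - 1))).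
    by apply: ler_wpM2r; rewrite ?powR_ge0.
  rewrite -mulrA; apply: ler_wpM2l => //.
  (* Large values are charged to [u^6] as [q - 1 < 6]; below 1 the hypothesis on [nu] lets the power
     [q - 1] be replaced by the one in [H]. *)
  have [u1|/ltW u1] := leP 1 (u z).
    apply: (@le_trans _ _ (u z ^+ 6)); last by rewrite lerDl.
    apply: (@le_trans _ _ (u z `^ (q - 1))); first by rewrite ler_piMl ?powR_ge0 // wt_le1 // ltW.
    rewrite -(powR_mulrn 6 (ltW (u0 z))); apply: ler_powR => //.
    by move: q6; lra.
  apply: (@le_trans _ _ (H z)); last by rewrite lerDr.
  apply: ler_wpM2l; first exact: wt_ge0.
  rewrite /reg add0r exprMn sqr_powR -(powR_mulrn 2 (ltW (u0 z))) -powRrM -exprM.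
  rewrite -(powR_mulrn (3 * 2) (ltW (u0 z))) -powRD; last by rewrite (gt_eqF (u0 z)) implybT.
  rewrite -powRrM; apply: ger_powR; first by rewrite u0.
  by apply: (le_trans _ nuq); rewrite (_ : _ * _ = (6 + 4 * nu) * (3 - gam)) //; ring.
rewrite (integral3Z ms Cp0 n0) (integral3D mu6 mH u6 H0) U6E.
by apply: lte_mul_pinfty; [rewrite lee_fin|by []|apply: lte_add_pinfty; [rewrite ltry|exact: weighted_power_fin]].
Qed.

End finite_mass.

End space.

Theorem mainTheorem13 (R : realType) (gamma q : R) (phi : R -> R)
  (u : R * R * R -> R) (g : 'I_3 -> R * R * R -> R) :
  0 < gamma -> gamma < 2 ->
  measurable_fun setT phi ->
  (exists C : R, {ae leb3 R, forall z : R * R * R,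
     `|(1 + norm2 z.1) `^ gamma * phi (norm2 z.1)| <= C}) ->
  2 * (3 - gamma) < q -> q < 6 ->
  D12 u g ->
  (forall z, 0 < u z) ->
  weak_solution phi q u g ->
  (\int[leb3 R]_z (`|phi (norm2 z.1)| * (u z `^ (q - 1)))%:E < +oo)%E.
Proof.
move=> g0 g2 mphi [C hC] hq q6 Hu u0 wu.
have [Cp Cp0 hphi] := weight_bound g0 hC.
have [Cw Cw0 W] := mazya (ltW g0) g2.
have [psi [tpsi gpsi upsi apsi]] := D12_approx Hu.
have p0 : 0 < 3 - gamma by lra.
have e1 : 5 + 4 * (((2 - gamma) / (3 - gamma) - 5) / 4) = (2 - gamma) / (3 - gamma).
  by move: (_ / (3 - gamma)) => x; field.
apply: (finite_mass (nu := ((2 - gamma) / (3 - gamma) - 5) / 4) g0 g2 hq q6 mphi Cp0 hphi Hu u0 wu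
  _ _ Cw0 W tpsi gpsi upsi apsi).
- by rewrite e1 divr_gt0 // subr_gt0.
- by rewrite e1 ltr_pdivrMr // mul1r; lra.
(* Multiplied by [p = 3 - gamma] this is [p + (p - 1) = 2p - 1], and [2p < q]. *)
have -> : 6 + 4 * (((2 - gamma) / (3 - gamma) - 5) / 4) = 1 + (2 - gamma) / (3 - gamma).
  by rewrite -e1; move: (_ / (3 - gamma)) => x; field.
rewrite mulrDl mul1r divfK ?gt_eqF //; lra.
Qed.
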